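(* Suppose $\mathbb{X}$ is a Banach space with a basis and let $(\mathbb{S},\Vert\cdot\Vert_{\mathbb{S}})$ be a subsymmetric sequence space. Assume that $\mathbb{S}$ is isomorphic to a complemented subspace of $\mathbb{X}$, that $\mathbb{S}$ has nontrivial type, and that either $\ell_1$ or $c_0$ is isomorphic to a complemented subspace of $\mathbb{X}$. Then $\mathbb{X}$ has an almost greedy basis $\mathcal{B}_\kappa$ whose fundamental function is equivalent to $\left(\left\Vert\sum_{j=1}^m e_j\right\Vert_{\mathbb{S}}\right)_{m=1}^\infty$ and such that $L_m[\mathcal{B}_\kappa,\mathbb{X}]\approx\log m$ for $m\ge2$.
   Context: Banach spaces are real or complex, over the field $\mathbb{F}$. A basis $\mathcal{B}=(x_j)_{j=1}^\infty$ of a Banach space $\mathbb{X}$ is a Schauder basis, always assumed semi-normalized, i.e. $0<\inf_j\Vert x_j\Vert\le\sup_j\Vert x_j\Vert<\infty$; $(x_j^* )_{j=1}^\infty$ are its coordinate functionals. For $A\subseteq\mathbb{N}$, $S_A(f)=\sum_{j\in A}x_j^*(f)x_j$ (when well defined), and $\operatorname{supp}(f)=\{j: x_j^*(f)\ne0\}$. Define $$L_m[\mathcal{B},\mathbb{X}]=\sup\left\{\frac{\Vert S_A(f)\Vert}{\Vert f\Vert}: f\in\mathbb{X}\setminus\{0\},\ \max(\operatorname{supp}(f))\le m,\ A\subseteq\mathbb{N}\right\}.$$ The basis is almost greedy if there is a constant $C$ with $\Vert f-S_F(f)\Vert\le C\Vert f-S_A(f)\Vert$ whenever $f\in\mathbb{X}$,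 $|A|\le|F|<\infty$, and $|x_j^*(f)|\le|x_k^*(f)|$ for all $j\in\mathbb{N}\setminus F$, $k\in F$. Its fundamental function is $\varphi_m[\mathcal{B},\mathbb{X}]=\sup_{|A|\le m}\Vert\sum_{j\in A}x_j\Vert$, $m\in\mathbb{N}$. A subsymmetric sequence space is a Banach space $\mathbb{S}\subseteq\mathbb{F}^{\mathbb{N}}$ for which the unit-vector system $(e_j)_{j=1}^\infty$ is a basis satisfying $\Vert\sum_j\varepsilon_ja_je_{\phi(j)}\Vert_{\mathbb{S}}=\Vert\sum_ja_je_j\Vert_{\mathbb{S}}$ for all $\sum_ja_je_j\in\mathbb{S}$, all sequences of signs $(\varepsilon_j)$ and all increasing maps $\phi\colon\mathbb{N}\to\mathbb{N}$. For families of non-negative numbers, $\alpha_i\lesssim\beta_i$ means there is a constant $C$ with $\alpha_i\le C\beta_i$ for all $i$; $\alpha_i\approx\beta_i$ (equivalence) means $\alpha_i\lesssim\beta_i$ and $\beta_i\lesssim\alpha_i$. *)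

(* Defs.v *)
From HB Require Import structures.
From mathcomp Require Export all_boot all_order all_algebra finmap.
From mathcomp Require Export complex.
From mathcomp Require Export all_classical all_reals all_analysis.
Export numFieldNormedType.Exports.
Export Order.TTheory GRing.Theory Num.Theory.

Set Implicit Arguments.
Unset Strict Implicit.
Unset Printing Implicit Defensive.

Local Open Scope classical_set_scope.
Local Open Scope ring_scope.

Inductive scalar_kind := RealScalars | ComplexScalars.

Definition scalars (R : realType) (F : scalar_kind) : numFieldType :=
  match F with
  | RealScalars => R
  | ComplexScalars => R[i]
  end.

Definition scalar_Re (R : realType) (F : scalar_kind) : scalars R F -> R :=
  match F return scalars R F -> R with
  | RealScalars => fun a => a
  | ComplexScalars => @complex.Re R
  end.

(* The norm of a normedModType over K takes its values in K, as nonnegative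
   real elements; rnorm is the same norm with values in R. *)
Definition rnorm (R : realType) (F : scalar_kind)
    (V : normedModType (scalars R F)) (v : V) : R :=
  scalar_Re `|v|.

Definition rabs (R : realType) (F : scalar_kind) (a : scalars R F) : R :=
  scalar_Re `|a|.

(* Sequences are indexed from 0: x j stands for x_{j+1}. *)
Section bases.
Context (R : realType) (F : scalar_kind).
Local Notation K := (scalars R F).

Section one_space.
Context (X : completeNormedModType K).
Implicit Types (x : nat -> X) (f : X) (a : nat -> K).

Definition expansion x f a : Prop :=
  series (fun j => a j *: x j) @ \oo --> f.

Definition schauder x : Prop := forall f, exists! a, expansion x f a.

Definition semi_normalized x : Prop :=
  exists c C : R, 0 < c /\ forall j, c <= rnorm (x j) <= C.

Definition is_basis x : Prop := schauder x /\ semi_normalized x.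

(* coord x f j is x_j^*(f); the default value 0 is never used for a basis. *)
Definition coord x f : nat -> K := xget (fun=> 0) [set a | expansion x f a].

(* S_A(f), meaningful when the series converges. *)
Definition proj x (A : set nat) f : X :=
  limn (series (fun j => if j \in A then coord x f j *: x j else 0)).

Definition almost_greedy x : Prop :=
  exists C : R, forall (f : X) (A G : {fset nat}),
    (#|` A| <= #|` G|)%N ->
    (forall j k, j \notin G -> k \in G ->
       rabs (coord x f j) <= rabs (coord x f k)) ->
    rnorm (f - proj x [set` G] f) <= C * rnorm (f - proj x [set` A] f).

Definition fundamental x (m : nat) : \bar R :=
  ereal_sup [set (rnorm (\sum_(j <- A) x j))%:E
            | A in [set A : {fset nat} | (#|` A| <= m)%N]].

Definition cond_L x (m : nat) : \bar R :=
  ereal_sup [set q | exists (f : X) (A : set nat),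
    [/\ f != 0,
        forall j, (m <= j)%N -> coord x f j = 0 &
        q = (rnorm (proj x A f) / rnorm f)%:E]].

(* Rademacher type p. *)
Definition has_type (p : R) : Prop :=
  exists C : R, forall (n : nat) (v : 'I_n -> X),
    ((2 ^+ n)^-1 * \sum_(eps : {ffun 'I_n -> bool})
        rnorm (\sum_(i < n) (-1) ^+ (eps i) *: v i) `^ p) `^ p^-1
    <= C * (\sum_(i < n) rnorm (v i) `^ p) `^ p^-1.

Definition nontrivial_type : Prop := exists2 p : R, 1 < p <= 2 & has_type p.

End one_space.

(* The inclusion of S into F^N is iota, and e j is the j-th unit vector. *)
Definition subsymmetric_seq_space (S : completeNormedModType K)
    (iota : S -> nat -> K) (e : nat -> S) : Prop :=
  [/\ forall (a : K) (f g : S) (j : nat),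
        iota (a *: f + g) j = a * iota f j + iota g j,
      injective iota,
      forall j k, iota (e j) k = (k == j)%:R,
      is_basis e &
      forall (a : nat -> K) (eps : nat -> bool) (phi : nat -> nat) (f : S),
        {homo phi : i j / (i < j)%N} ->
        expansion e f a ->
        exists2 g : S,
          series (fun j => ((-1) ^+ (eps j) * a j) *: e (phi j)) @ \oo --> g &
          rnorm g = rnorm f].

(* The normed space E = (D, N), where D is a linear subspace of the vector
   space V and N is a norm on D, is isomorphic to a complemented subspace
   of X: the range of J on D is the range of the bounded projection P. *)
Definition complemented_in (V : lmodType K) (D : set V) (N : V -> R)
    (X : completeNormedModType K) : Prop :=
  exists (J : V -> X) (P : {linear X -> X}),
    [/\ forall (a : K) (u v : V), D u -> D v ->
          J (a *: u + v) = a *: J u + J v,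
        exists c C : R,
          0 < c /\ forall u, D u -> c * N u <= rnorm (J u) <= C * N u,
        continuous P,
        forall f, P (P f) = P f &
        range P = J @` D].

Definition space_complemented_in (S X : completeNormedModType K) : Prop :=
  @complemented_in S setT (@rnorm R F S) X.

Definition ell1_complemented_in (X : completeNormedModType K) : Prop :=
  @complemented_in (nat -> K^o)
    [set a | cvgn (series (fun j => rabs (a j)))]
    (fun a => limn (series (fun j => rabs (a j)))) X.

Definition c0_complemented_in (X : completeNormedModType K) : Prop :=
  @complemented_in (nat -> K^o)
    [set a | (fun j => rabs (a j)) @ \oo --> (0 : R)]
    (fun a => sup (range (fun j => rabs (a j)))) X.

End bases.

Definition equivalent_on (R : realType) (I : Type) (D : set I)
    (a b : I -> \bar R) : Prop :=
  exists C : R, 0 < C /\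
    forall i, D i -> (a i <= C%:E * b i)%E /\ (b i <= C%:E * a i)%E.

(* Main.v *)
Require Import Defs.
From mathcomp Require Import ring lra zify.

Set Implicit Arguments.
Unset Strict Implicit.
Unset Printing Implicit Defensive.

Local Open Scope classical_set_scope.
Local Open Scope ring_scope.

(** The basis is that of Dilworth, Kalton and Kutzarova, realized inside [X].

    Cut the index set into consecutive blocks of lengths 1, 2, 4, ... and let
    [P] be the projection of [S] that averages over the blocks, [Q = 1 - P].
    For any basis [z] of a Banach space [Z], give a finite sequence [a] the
    norm [||Q a||_S + ||sum_n v_n^*(a) z_n||_Z], where [v_n^*] is dual to the
    normalized indicator of the [n]-th block.  Its completion is isomorphic to
    [Q(S) + Z], and the unit vectors form a basis.  They are quasi-greedy
    ([greedy_Q], [greedy_v]) and democratic with the fundamental function of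
    [S] ([democratic_lower], [democratic_upper]), whatever [z] is: a basis
    lies between those of $c_0$ and $\ell_1$, and both extremes are harmless
    because the fundamental function [ones_norm] of [S] grows at least and at most
    like powers strictly between 0 and 1 ([type_growth]).  That growth is what
    nontrivial type provides: the type inequality for consecutive blocks gives
    the upper estimate, and the absence of copies of $\ell_\infty^N$ the lower
    one.  A quasi-greedy and democratic basis is almost greedy
    ([almost_greedy_finite]).

    The first [m] unit vectors live in about [log m] blocks, so the
    conditionality at [m] is that of [z] at about [log m] ([cond_L_equiv]).
    It is never more than linear in the number of blocks, and one has to find
    a [z] for which it is linear.  Such a sequence exists in $\ell_1$ (the
    difference basis) and in $c_0$ (the summing basis).

    It remains to see [X] as [Q(S) + Z] with such a [Z].  Since $\ell_1$, $c_0$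
    and [S] are isomorphic to their squares, [X] absorbs a further copy of any
    of them that it contains as a complemented subspace ([absorb]).  Absorbing
    $\ell_1$ or $c_0$ and interlacing bases, [X] gets a basis [w] whose
    conditionality is linear ([conditional_basis]).  Absorbing [S] as well, [X]
    is [S + X], that is, [Q(S) + (P(S) + X)], and [P(S) + X] has the basis [z]
    obtained by interlacing the normalized block indicators and [w].

    Everything is done on finite linear combinations: a seminormalized sequence
    with dense span is a basis exactly when it satisfies the partial sum
    inequality ([grunblum_basis], [basis_grunblum]); the second of these is
    Banach's theorem, for the given basis of [X]. *)


(** * Real-valued norms over both scalar fields *)

Section real_valued_norm.
Context (R : realType) (F : scalar_kind).
Local Notation K := (scalars R F).

(** Norms and fundamental functions are real numbers that also serve as
    coefficients of vectors; [emb] is the inclusion of the reals in [K]. *)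
Definition emb : R -> K :=
  match F return R -> scalars R F with
  | RealScalars => id
  | ComplexScalars => fun r => r%:C%C
  end.

Lemma scalar_ReK (x : K) : 0 <= x -> emb (scalar_Re x) = x.
Proof.
rewrite /emb /scalar_Re; case: F x => [//|[a b]] /=.
by rewrite lecE /= => /andP[/eqP-> _].
Qed.

Lemma emb_nneg r : (0 <= emb r) = (0 <= r).
Proof. by rewrite /emb; case: F => //=; rewrite lecE /= eqxx. Qed.

Lemma embD r s : emb (r + s) = emb r + emb s.
Proof. by rewrite /emb; case: F => //=; rewrite rmorphD. Qed.

Lemma embM r s : emb (r * s) = emb r * emb s.
Proof. by rewrite /emb; case: F => //=; rewrite rmorphM. Qed.

Lemma emb0 : emb 0 = 0.
Proof. by rewrite /emb; case: F => //=; rewrite rmorph0. Qed.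

Lemma emb1 : emb 1 = 1.
Proof. by rewrite /emb; case: F => //=; rewrite rmorph1. Qed.

Lemma emb_ReK r : scalar_Re (emb r) = r.
Proof. by rewrite /emb /scalar_Re; case: F. Qed.

Lemma emb_inj : injective emb.
Proof. exact: can_inj emb_ReK. Qed.

Lemma embN r : emb (- r) = - emb r.
Proof. by apply/eqP; rewrite -addr_eq0 -embD addNr emb0. Qed.

Lemma embB r s : emb (r - s) = emb r - emb s.
Proof. by rewrite embD embN. Qed.

Lemma emb_le r s : (emb r <= emb s) = (r <= s).
Proof. by rewrite -subr_ge0 -embB emb_nneg subr_ge0. Qed.

Lemma emb_lt r s : (emb r < emb s) = (r < s).
Proof. by rewrite !lt_neqAle emb_le (inj_eq emb_inj). Qed.

Lemma embV r : emb r^-1 = (emb r)^-1.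
Proof.
have [->|r0] := eqVneq r 0; first by rewrite invr0 emb0 invr0.
have er0 : emb r != 0 by rewrite -emb0 (inj_eq emb_inj).
by apply: (mulfI er0); rewrite -embM !mulfV // emb1.
Qed.

Lemma emb_nat n : emb n%:R = n%:R.
Proof. by elim: n => [|n IH]; rewrite ?emb0// -!natr1 embD IH emb1. Qed.

Section vectors.
Context (V : normedModType K).
Implicit Types (u v : V).

Lemma emb_rnorm v : emb (rnorm v) = `|v|.
Proof. by rewrite /rnorm scalar_ReK. Qed.

Lemma rnorm_ge0 v : 0 <= rnorm v.
Proof. by rewrite -emb_nneg emb_rnorm. Qed.

Lemma rnormD u v : rnorm (u + v) <= rnorm u + rnorm v.
Proof. by rewrite -emb_le embD !emb_rnorm ler_normD. Qed.

Lemma rnorm0 : rnorm (0 : V) = 0.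
Proof. by apply: emb_inj; rewrite emb_rnorm emb0 normr0. Qed.

Lemma rnorm0_eq0 v : rnorm v = 0 -> v = 0.
Proof. by move=> v0; apply/eqP; rewrite -normr_eq0 -emb_rnorm v0 emb0. Qed.

Lemma rnorm_gt0 v : (0 < rnorm v) = (v != 0).
Proof. by rewrite -emb_lt emb_rnorm emb0 normr_gt0. Qed.

Lemma rnormN v : rnorm (- v) = rnorm v.
Proof. by apply: emb_inj; rewrite !emb_rnorm normrN. Qed.

Lemma rnormB u v : rnorm (u - v) = rnorm (v - u).
Proof. by rewrite -rnormN opprB. Qed.

Lemma rnorm_triB u v : rnorm (u - v) <= rnorm u + rnorm v.
Proof. by rewrite -(rnormN v) rnormD. Qed.

Lemma rnorm_tri w u v : rnorm (u - v) <= rnorm (u - w) + rnorm (w - v).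
Proof. by apply: le_trans (rnormD _ _); rewrite addrA subrK. Qed.

Lemma rnorm_dist u v : rnorm u <= rnorm v + rnorm (u - v).
Proof. by apply: le_trans (rnormD _ _); rewrite addrC subrK. Qed.

Lemma rnorm_sum I (r : seq I) (P : pred I) (f : I -> V) :
  rnorm (\sum_(i <- r | P i) f i) <= \sum_(i <- r | P i) rnorm (f i).
Proof.
elim/big_rec2: _ => [|i y1 y2 Pi H]; first by rewrite rnorm0.
by apply: le_trans (rnormD _ _) _; rewrite lerD2l.
Qed.

End vectors.

Lemma emb_rabs (a : K) : emb (rabs a) = `|a|.
Proof. by rewrite /rabs scalar_ReK. Qed.

Lemma rabs_ge0 (a : K) : 0 <= rabs a.
Proof. by rewrite -emb_nneg emb_rabs. Qed.

Lemma rabsD (a b : K) : rabs (a + b) <= rabs a + rabs b.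
Proof. by rewrite -emb_le embD !emb_rabs ler_normD. Qed.

Lemma rabs0 : rabs (0 : K) = 0.
Proof. by apply: emb_inj; rewrite emb_rabs emb0 normr0. Qed.

Lemma rabs1 : rabs (1 : K) = 1.
Proof. by apply: emb_inj; rewrite emb_rabs emb1 normr1. Qed.

Lemma rabs0_eq0 (a : K) : rabs a = 0 -> a = 0.
Proof. by move=> v0; apply/eqP; rewrite -normr_eq0 -emb_rabs v0 emb0. Qed.

Lemma rabs_gt0 (a : K) : (0 < rabs a) = (a != 0).
Proof. by rewrite -emb_lt emb_rabs emb0 normr_gt0. Qed.

Lemma rabsN (a : K) : rabs (- a) = rabs a.
Proof. by apply: emb_inj; rewrite !emb_rabs normrN. Qed.

Lemma rabsM (a b : K) : rabs (a * b) = rabs a * rabs b.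
Proof. by apply: emb_inj; rewrite embM !emb_rabs normrM. Qed.

Lemma rabsV (a : K) : rabs a^-1 = (rabs a)^-1.
Proof. by apply: emb_inj; rewrite embV !emb_rabs normfV. Qed.

Lemma rabs_emb r : rabs (emb r) = `|r|.
Proof.
apply: emb_inj; rewrite emb_rabs; have [r0|r0] := lerP 0 r.
  by rewrite !ger0_norm // emb_nneg.
by rewrite !ler0_norm ?embN // -?emb0 ?emb_le ltW.
Qed.

Lemma rabs_nat n : rabs (n%:R : K) = n%:R.
Proof. by rewrite -emb_nat rabs_emb normr_nat. Qed.

Lemma rabs_sum I (r : seq I) (P : pred I) (f : I -> K) :
  rabs (\sum_(i <- r | P i) f i) <= \sum_(i <- r | P i) rabs (f i).
Proof.
elim/big_rec2: _ => [|i y1 y2 Pi H]; first by rewrite rabs0.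
by apply: le_trans (rabsD _ _) _; rewrite lerD2l.
Qed.

Lemma rnormZ (V : normedModType K) (a : K) (v : V) :
  rnorm (a *: v) = rabs a * rnorm v.
Proof. by apply: emb_inj; rewrite embM emb_rabs !emb_rnorm normrZ. Qed.

(** Over the complex field every scalar splits into a real and an imaginary
    part; [iota] is the imaginary unit, or 0 over the reals. *)
Lemma scalar_split : exists2 iota : K, rabs iota <= 1 &
  forall t : K, exists u v : R,
    [/\ t = emb u + iota * emb v, `|u| <= rabs t & `|v| <= rabs t].
Proof.
rewrite /emb /rabs /scalar_Re; case: F => /=.
  by exists 0 => [|t]; rewrite ?normr0 //; exists t, 0;
    rewrite mulr0 addr0 normr0 lexx normr_ge0.
exists 'i%C => [|[u v]] /=; first by rewrite expr0n expr1n add0r sqrtr1.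
exists u, v; split.
- by apply/eqP; rewrite eq_complex /= !(mul0r, mulr0, mul1r, addr0, subr0, add0r) !eqxx.
- by rewrite -sqrtr_sqr ler_wsqrtr // lerDl sqr_ge0.
- by rewrite -sqrtr_sqr ler_wsqrtr // lerDr sqr_ge0.
Qed.

(** Convergence is used below only in this form, which is insensitive to the
    scalar field. *)
Lemma cvg_rnormP (V : normedModType K) (u : nat -> V) (l : V) :
  u @ \oo --> l <->
  forall eps : R, 0 < eps -> exists N, forall n, (N <= n)%N -> rnorm (u n - l) < eps.
Proof.
split=> [/cvgrPdist_lt H eps eps0|H].
  have /H [N _ HN] : (0 : K) < emb eps by rewrite -emb0 emb_lt.
  exists N => n Nn; have := HN n Nn.
  by rewrite -emb_rnorm emb_lt rnormB.
apply/cvgrPdist_lt => eps eps0.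
have E : emb (scalar_Re eps) = eps by rewrite scalar_ReK // ltW.
have /H[N HN] : 0 < scalar_Re eps by rewrite -emb_lt E emb0.
exists N => // n /HN; rewrite rnormB -emb_lt E emb_rnorm; exact.
Qed.

Lemma rnorm_complete (V : completeNormedModType K) (u : nat -> V) :
  (forall eps : R, 0 < eps -> exists N, forall m n,
     (N <= m)%N -> (N <= n)%N -> rnorm (u m - u n) < eps) ->
  exists l : V, u @ \oo --> l.
Proof.
move=> H; suff /cauchy_cvgP/cvg_ex : cauchy (u @ \oo) by [].
apply: cauchy_exP => eps eps0.
have E : emb (scalar_Re eps) = eps by rewrite scalar_ReK // ltW.
have /H[N HN] : 0 < scalar_Re eps by rewrite -emb_lt E emb0.
exists (u N); exists N => // n /= Nn.
by rewrite -ball_normE /= -E -emb_rnorm emb_lt HN.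
Qed.

Lemma real_complete (u : nat -> R) :
  (forall eps : R, 0 < eps -> exists N, forall m n,
     (N <= m)%N -> (N <= n)%N -> `|u m - u n| < eps) ->
  exists l, forall eps : R, 0 < eps -> exists N, forall n, (N <= n)%N -> `|u n - l| < eps.
Proof.
move=> H; have : cvgn u.
  apply/cauchy_cvgP/cauchy_exP => eps /H[N HN].
  by exists (u N); exists N => // n /= Nn; rewrite /ball /= HN.
move=> /cvg_ex[l /cvgrPdist_lt Hl]; exists l => eps /Hl[N _ HN].
by exists N => n Nn; rewrite distrC; apply: HN.
Qed.

Lemma scalar_complete (u : nat -> K) :
  (forall eps : R, 0 < eps -> exists N, forall m n,
     (N <= m)%N -> (N <= n)%N -> rabs (u m - u n) < eps) ->
  exists l, forall eps : R, 0 < eps -> exists N, forall n, (N <= n)%N -> rabs (u n - l) < eps.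
Proof.
rewrite /rabs /scalar_Re; case: F u => [|] u H; first exact: real_complete.
have dist (a b : R[i]) : complex.Re `|a - b| =
    Num.sqrt ((complex.Re a - complex.Re b) ^+ 2 + (complex.Im a - complex.Im b) ^+ 2).
  by case: a b => [a1 a2] [b1 b2]; rewrite normc_def.
have [|x Hx] := @real_complete (fun n => complex.Re (u n)).
  move=> eps /H[N HN]; exists N => m n Nm Nn; apply: le_lt_trans (HN m n Nm Nn).
  by rewrite dist -sqrtr_sqr ler_wsqrtr // lerDl sqr_ge0.
have [|y Hy] := @real_complete (fun n => complex.Im (u n)).
  move=> eps /H[N HN]; exists N => m n Nm Nn; apply: le_lt_trans (HN m n Nm Nn).
  by rewrite dist -sqrtr_sqr ler_wsqrtr // lerDr sqr_ge0.
exists (x +i* y)%C => eps eps0.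
have e2 : 0 < eps / 2 by rewrite divr_gt0.
have [N1 H1] := Hx _ e2; have [N2 H2] := Hy _ e2.
exists (maxn N1 N2) => n; rewrite geq_max => /andP[/H1 h1 /H2 h2].
rewrite dist /=; set a := _ - x; set b := _ - y.
have -> : eps = Num.sqrt (eps ^+ 2) by rewrite sqrtr_sqr gtr0_norm.
rewrite ltr_sqrt ?exprn_gt0 //.
have ha : a ^+ 2 < (eps / 2) ^+ 2 by rewrite -real_normK ?num_real // ltr_pXn2r ?nnegrE // ltW.
have hb : b ^+ 2 < (eps / 2) ^+ 2 by rewrite -real_normK ?num_real // ltr_pXn2r ?nnegrE // ltW.
by nra.
Qed.

End real_valued_norm.

(** * Schauder bases and the partial sum inequality *)

Lemma half_pow_lt (R : realType) (D eps : R) : 0 < eps ->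
  exists n, D * 2^-1 ^+ n < eps.
Proof.
move=> e0; exists (Num.Def.archi_bound `|D / eps|).
set n := Num.Def.archi_bound _.
have le2 : (n%:R : R) <= 2 ^+ n by rewrite -natrX ler_nat ltnW // ltn_expl.
have lt : D / eps < n%:R := le_lt_trans (ler_norm _) (archi_boundP (normr_ge0 _)).
rewrite exprVn ltr_pdivrMr ?exprn_gt0 // mulrC -ltr_pdivrMr //.
exact: lt_le_trans lt le2.
Qed.

Lemma half_pow_gt0 (R : realType) n : 0 < (2^-1 : R) ^+ n.
Proof. by rewrite exprn_gt0 // invr_gt0. Qed.

Lemma half_pow_le (R : realType) m n : (m <= n)%N -> (2^-1 : R) ^+ n <= 2^-1 ^+ m.
Proof.
by move=> mn; rewrite ler_wiXn2l // ?invr_ge0 // invf_le1 // ler1n.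
Qed.

Section partial_sums.
Context (R : realType) (F : scalar_kind).
Local Notation K := (scalars R F).

Definition lin (V : lmodType K) (x : nat -> V) (a : nat -> K) (n : nat) : V :=
  \sum_(j < n) a j *: x j.

Section lmodule.
Context (V : lmodType K).
Implicit Types (x : nat -> V) (a b : nat -> K).

Lemma lin0 x a : lin x a 0 = 0.
Proof. by rewrite /lin big_ord0. Qed.

Lemma linS x a n : lin x a n.+1 = lin x a n + a n *: x n.
Proof. by rewrite /lin big_ord_recr. Qed.

Lemma eq_lin x a b n : (forall j, (j < n)%N -> a j = b j) -> lin x a n = lin x b n.
Proof. by move=> ab; apply: eq_bigr => j _; rewrite ab. Qed.

Lemma linD x a b n : lin x (fun j => a j + b j) n = lin x a n + lin x b n.
Proof. by rewrite /lin -big_split; apply: eq_bigr => j _; rewrite scalerDl. Qed.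

Lemma linB x a b n : lin x (fun j => a j - b j) n = lin x a n - lin x b n.
Proof. by rewrite /lin -sumrB; apply: eq_bigr => j _; rewrite scalerBl. Qed.

Lemma linZ x (t : K) a n : lin x (fun j => t * a j) n = t *: lin x a n.
Proof. by rewrite /lin scaler_sumr; apply: eq_bigr => j _; rewrite scalerA. Qed.

Lemma lin_zero x n : lin x (fun=> 0) n = 0.
Proof. by rewrite /lin big1 // => j _; rewrite scale0r. Qed.

Lemma lin_split x a m n : lin x a (m + n) =
  lin x a m + \sum_(i < n) a (m + i)%N *: x (m + i)%N.
Proof. exact: big_split_ord. Qed.

Lemma lin_supp x a m n : (m <= n)%N -> (forall j, (m <= j)%N -> a j = 0) ->
  lin x a n = lin x a m.
Proof.
move=> mn a0; rewrite -(subnKC mn) /lin big_split_ord /= [X in _ + X]big1 ?addr0 //.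
by move=> i _; rewrite a0 ?scale0r // leq_addr.
Qed.

Lemma lin_trunc x a m n : (m <= n)%N ->
  lin x (fun j => if (j < m)%N then a j else 0) n = lin x a m.
Proof.
move=> mn; rewrite (lin_supp _ mn) => [|j]; last by rewrite ltnNge => ->.
by apply: eq_lin => j ->.
Qed.

Lemma lin_delta x i n : (i < n)%N -> lin x (fun j => (j == i)%:R) n = x i.
Proof.
move=> ilt; rewrite /lin (bigD1 (Ordinal ilt)) //= eqxx scale1r big1 ?addr0 //.
by move=> j; rewrite -val_eqE /= => /negbTE->; rewrite scale0r.
Qed.

End lmodule.

Section normed.
Context (V : completeNormedModType K).
Implicit Types (x : nat -> V) (a b : nat -> K) (f : V).

Lemma expansionP x f a : expansion x f a <->
  forall eps : R, 0 < eps -> exists N, forall n, (N <= n)%N -> rnorm (lin x a n - f) < eps.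
Proof.
rewrite /expansion cvg_rnormP; split=> H eps /H[N HN]; exists N => n /HN;
by rewrite /series /= big_mkord.
Qed.

Lemma expansion_lin x a n : (forall j, (n <= j)%N -> a j = 0) -> expansion x (lin x a n) a.
Proof.
move=> a0; apply/expansionP => eps e0; exists n => m nm.
by rewrite (lin_supp _ nm) // subrr rnorm0.
Qed.

Lemma expansionD x f g a b : expansion x f a -> expansion x g b ->
  expansion x (f + g) (fun j => a j + b j).
Proof.
move=> /expansionP fa /expansionP gb; apply/expansionP => eps e0.
have e2 : 0 < eps / 2 by rewrite divr_gt0.
have [N1 H1] := fa _ e2; have [N2 H2] := gb _ e2.
exists (maxn N1 N2) => n; rewrite geq_max => /andP[/H1 h1 /H2 h2].
rewrite linD opprD addrACA; apply: le_lt_trans (rnormD _ _) _.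
by rewrite (splitr eps) ltrD.
Qed.

Lemma expansionZ x f (t : K) a : expansion x f a -> expansion x (t *: f) (fun j => t * a j).
Proof.
move=> /expansionP fa; apply/expansionP => eps e0.
have t0 : 0 < rabs t + 1 by rewrite ltr_wpDl // rabs_ge0.
have /fa[N HN] : 0 < eps / (rabs t + 1) by rewrite divr_gt0.
exists N => n /HN; rewrite linZ -scalerBr rnormZ ltr_pdivlMr // => lt.
apply: le_lt_trans lt; rewrite mulrC ler_wpM2l ?rnorm_ge0 //.
by rewrite lerDl.
Qed.

(** Coefficientwise convergence suffices for a fixed number of terms. *)
Lemma lin_cvg x (b : nat -> nat -> K) a m :
  (forall j, forall eps : R, 0 < eps -> exists N, forall n, (N <= n)%N -> rabs (b n j - a j) < eps) ->
  forall eps : R, 0 < eps -> exists N, forall n, (N <= n)%N ->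
    rnorm (lin x (b n) m - lin x a m) < eps.
Proof.
move=> ba; elim: m => [|m IH] eps e0.
  by exists 0%N => n _; rewrite !lin0 subrr rnorm0.
have e2 : 0 < eps / 2 by rewrite divr_gt0.
have [N1 H1] := IH _ e2.
have x0 : 0 < rnorm (x m) + 1 by rewrite ltr_wpDl // rnorm_ge0.
have e3 : 0 < eps / 2 / (rnorm (x m) + 1) by rewrite !divr_gt0.
have [N2 H2] := ba m _ e3.
exists (maxn N1 N2) => n; rewrite geq_max => /andP[/H1 h1 /H2 h2].
rewrite !linS opprD addrACA -scalerBl; apply: le_lt_trans (rnormD _ _) _.
rewrite (splitr eps) ltrD // rnormZ; rewrite ltr_pdivlMr // in h2.
by apply: le_lt_trans h2; rewrite ler_wpM2l ?rabs_ge0 // lerDl.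
Qed.

(** Uniform boundedness of the partial sum projections, stated on finite
    combinations only.  Together with a dense span it characterizes Schauder
    bases, so all bases below are built and compared at the level of finite
    combinations, without coordinate functionals. *)
Definition grunblum x (C : R) : Prop :=
  forall a m n, (m <= n)%N -> rnorm (lin x a m) <= C * rnorm (lin x a n).

Definition dense_span x : Prop :=
  forall f (eps : R), 0 < eps -> exists n a, rnorm (f - lin x a n) < eps.

Lemma grunblum_coef x C c a j n : 0 < c -> (forall i, c <= rnorm (x i)) ->
  grunblum x C -> (j < n)%N -> rabs (a j) <= 2 * C / c * rnorm (lin x a n).
Proof.
move=> c0 cx xC jn; rewrite mulrAC ler_pdivlMr //.
apply: (@le_trans _ _ (rabs (a j) * rnorm (x j))); first by rewrite ler_wpM2l ?rabs_ge0.
have -> : rabs (a j) * rnorm (x j) = rnorm (lin x a j.+1 - lin x a j).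
  by rewrite linS addrC addKr rnormZ.
apply: le_trans (rnorm_triB _ _) _.
by rewrite -mulrA mulr2n mulrDl !mul1r; apply: lerD; apply: xC => //; apply: ltnW.
Qed.

End normed.
End partial_sums.

Section basis_criterion.
Context (R : realType) (F : scalar_kind).
Local Notation K := (scalars R F).
Context (V : completeNormedModType K).
Implicit Types (x : nat -> V) (a b : nat -> K) (f : V).

Lemma coordE x f a : schauder x -> expansion x f a -> coord x f = a.
Proof.
move=> sx fa; rewrite /coord; case: xgetP => [_ -> /= fb|/(_ a)//].
by have [c [_ uc]] := sx f; rewrite -(uc _ fa) -(uc _ fb).
Qed.

Lemma coordP x f : schauder x -> expansion x f (coord x f).
Proof. by move=> sx; have [a [fa _]] := sx f; rewrite (coordE sx fa). Qed.

(** Grunblum's criterion: on the dense span the partial sum projections are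
    equicontinuous, so the coefficients of approximating finite combinations
    converge and the limits are the coefficients of an expansion. *)
Lemma grunblum_basis x (C : R) :
  semi_normalized x -> grunblum x C -> dense_span x -> is_basis x.
Proof.
move=> snx gx dx; split=> //; have [c [c1 [c0 /(_ _)/andP-cx]]] := snx.
have cx1 j : c <= rnorm (x j) by have [] := cx j.
have C0 : 0 <= C.
  have := gx (fun=> 1) 1%N 1%N (leqnn _); rewrite /lin big_ord1 scale1r => H.
  rewrite leNgt; apply/negP => Cn.
  have := lt_le_trans c0 (cx1 0%N) => x0; nra.
have C1 : 0 < C + 1 by rewrite ltr_wpDl.
pose M := 2 * C / c; have M0 : 0 <= M by rewrite divr_ge0 ?mulr_ge0 // ltW.
have gc a j n : (j < n)%N -> rabs (a j) <= M * rnorm (lin x a n).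
  exact: grunblum_coef c0 cx1 gx.
move=> f.
have approx k : exists p : nat * (nat -> K), rnorm (f - lin x p.2 p.1) < 2^-1 ^+ k /\
    (forall j, (p.1 <= j)%N -> p.2 j = 0).
  have k0 : 0 < (2^-1 : R) ^+ k by rewrite exprn_gt0 // invr_gt0.
  have [n [a fa]] := dx f _ k0.
  exists (n, fun j => if (j < n)%N then a j else 0); split => /=.
    by rewrite lin_trunc.
  by move=> j; rewrite ltnNge => ->.
have {approx} [p Hp] := choice approx.
have pf k := proj1 (Hp k); have p0 k := proj2 (Hp k).
have close k l : rnorm (lin x (p k).2 (p k).1 - lin x (p l).2 (p l).1) <= 2^-1 ^+ k + 2^-1 ^+ l.
  apply: le_trans (rnorm_tri f _ _) _.
  by rewrite rnormB; apply: lerD; apply: ltW.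
pose b k := (p k).2.
have linb k n : ((p k).1 <= n)%N -> lin x (b k) n = lin x (b k) (p k).1.
  by move=> kn; rewrite (lin_supp _ kn) // => j; apply: p0.
have cauchy j (eps : R) : 0 < eps -> exists N, forall m n, (N <= m)%N -> (N <= n)%N ->
    rabs (b m j - b n j) < eps.
  move=> e0; have [N HN] := half_pow_lt (2 * (M + 1)) e0.
  exists N => m n Nm Nn; apply: le_lt_trans HN.
  set q := maxn j.+1 (maxn (p m).1 (p n).1).
  apply: le_trans (gc (fun j => b m j - b n j) j q _) _; first by rewrite leq_maxl.
  rewrite linB !linb ?leq_max ?leqnn ?orbT //.
  have t0 : 0 <= (2^-1 : R) ^+ N by rewrite exprn_ge0 // invr_ge0.
  have h : rnorm (lin x (b m) (p m).1 - lin x (b n) (p n).1) <= 2 * 2^-1 ^+ N.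
    apply: le_trans (close _ _) _; rewrite mulr2n mulrDl mul1r.
    by apply: lerD; exact: half_pow_le.
  by apply: le_trans (ler_wpM2l M0 h) _; lra.
have [a Ha] := choice (fun j => scalar_complete (cauchy j)).
have near k m : rnorm (lin x a m - lin x (b k) m) <= C * 2^-1 ^+ k.
  apply/ler_addgt0Pl => eps e0.
  have e2 : 0 < eps / (C + 2) by rewrite divr_gt0 // ltr_wpDl.
  have [N1 HN1] := lin_cvg x m Ha e2.
  have [N2 HN2] := half_pow_lt 1 e2.
  set n := maxn N1 N2.
  have h1 := HN1 n (leq_maxl _ _).
  have h2 : (2^-1 : R) ^+ n < eps / (C + 2).
    apply: le_lt_trans HN2; rewrite mul1r; apply: half_pow_le; exact: leq_maxr.
  have h3 : rnorm (lin x (b n) m - lin x (b k) m) <= C * (2^-1 ^+ n + 2^-1 ^+ k).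
    set q := maxn m (maxn (p n).1 (p k).1).
    rewrite -linB; apply: le_trans (gx _ _ q _) _; first by rewrite leq_maxl.
    rewrite linB !linb ?leq_max ?leqnn ?orbT //.
    by rewrite ler_wpM2l // close.
  apply: le_trans (rnorm_tri (lin x (b n) m) _ _) _.
  rewrite rnormB in h1.
  have -> : eps = eps / (C + 2) + C * (eps / (C + 2)) + eps / (C + 2).
    by field; rewrite gt_eqF // ltr_wpDl.
  have := ler_wpM2l C0 (ltW h2); have := divr_ge0 (ltW e0) (addr_ge0 C0 (ler0n R 2)).
  nra.
have Hexp : expansion x f a.
  apply/expansionP => eps e0; have [k Hk] := half_pow_lt (C + 1) e0.
  exists (p k).1 => n kn; apply: le_lt_trans Hk.
  apply: le_trans (rnorm_tri (lin x (b k) n) _ _) _.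
  rewrite mulrDl mul1r; apply: lerD; first exact: near.
  by rewrite linb // rnormB; apply: ltW; apply: pf.
exists a; split=> //.
move=> a' /expansionP Ha'.
apply: funext => j; apply/eqP; rewrite -subr_eq0; apply/eqP/rabs0_eq0/eqP.
rewrite eq_le rabs_ge0 andbT; apply/ler_addgt0Pl => eps e0; rewrite addr0.
have e3 : 0 < eps / (M + 1) / 2 by rewrite !divr_gt0 // ltr_wpDl.
have [N1 H1] := Ha' _ e3; have /expansionP/(_ _ e3)[N2 H2] := Hexp.
set n := maxn j.+1 (maxn N1 N2).
have h1 : rnorm (lin x a' n - f) < eps / (M + 1) / 2.
  by apply: H1; rewrite !leq_max leqnn orbT.
have h2 : rnorm (lin x a n - f) < eps / (M + 1) / 2.
  by apply: H2; rewrite !leq_max leqnn !orbT.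
apply: le_trans (gc (fun j => a j - a' j) j n _) _; first by rewrite leq_maxl.
rewrite linB; apply: (@le_trans _ _ (M * (eps / (M + 1)))).
  rewrite ler_wpM2l //; apply: le_trans (rnorm_tri f _ _) _.
  by rewrite (splitr (eps / _)) [rnorm (f - _)]rnormB lerD // ltW.
by rewrite mulrA ler_pdivrMr ?ltr_wpDl //; lra.
Qed.

End basis_criterion.

(** * Banach's theorem on the partial sum projections *)

Section banach.
Context (R : realType) (F : scalar_kind).
Local Notation K := (scalars R F).
Context (V : completeNormedModType K).
Implicit Types (x : nat -> V) (a b : nat -> K) (f : V).

(** If no set of the cover were dense in a ball, one could choose nested balls
    whose [k]-th member keeps a positive distance from the [k]-th set; their
    common point would be covered by none of the sets. *)
Lemma baire_cover (E : nat -> set V) : (forall f, exists k, E k f) ->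
  exists k f0 (rho : R), 0 < rho /\ forall h, rnorm (h - f0) < rho ->
    forall eps : R, 0 < eps -> exists2 g, E k g & rnorm (h - g) < eps.
Proof.
move=> cover; apply: contrapT => nE.
have step (p : nat * (V * R)) : exists q : V * R, 0 < p.2.2 ->
    [/\ 0 < q.2, q.2 <= p.2.2 / 2, rnorm (q.1 - p.2.1) + q.2 <= p.2.2 &
        forall g, E p.1 g -> q.2 < rnorm (q.1 - g)].
  case: p => k [c r] /=; have [r0|r0] := ltP 0 r; last first.
    by exists (c, r).
  have [h [eps [hc e0 he]]] : exists h eps, [/\ rnorm (h - c) < r, 0 < eps &
      forall g, E k g -> eps <= rnorm (h - g)].
    apply: contrapT => nh; apply: nE; exists k, c, r; split=> // h hc eps e0.
    apply: contrapT => ng; apply: nh; exists h, eps; split=> // g Eg.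
    by rewrite leNgt; apply/negP => lt; apply: ng; exists g.
  have d0 : 0 < r - rnorm (h - c) by rewrite subr_gt0.
  set m := Num.min eps (r - rnorm (h - c)).
  have m0 : 0 < m by rewrite lt_min e0 d0.
  have me : m <= eps by rewrite ge_min lexx.
  have mr : m <= r - rnorm (h - c) by rewrite ge_min lexx orbT.
  have := rnorm_ge0 (h - c) => n0.
  exists (h, m / 2) => _ /=; split; rewrite ?divr_gt0 //; try lra.
  by move=> g /he; lra.
have [nxt Hnxt] := choice step.
pose s := fix s n := if n is n'.+1 then nxt (n', s n') else (0 : V, 1 : R).
have s0 n : 0 < (s n).2.
  by elim: n => [|n IH] /=; [exact: ltr01 | have [] := Hnxt (n, s n) IH].
have sS n := Hnxt (n, s n) (s0 n).
have half n : (s n).2 <= 2^-1 ^+ n.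
  elim: n => [|n IH]; first by rewrite expr0.
  by have [_ + _ _] := sS n; rewrite exprS /= => H; apply: le_trans H _; lra.
have nest n k : rnorm ((s (n + k)%N).1 - (s n).1) + (s (n + k)%N).2 <= (s n).2.
  elim: k => [|k IH]; first by rewrite addn0 subrr rnorm0 add0r.
  rewrite addnS; have [_ _ /= H _] := sS (n + k)%N; rewrite /= in H IH *.
  have := rnorm_tri (s (n + k)%N).1 (nxt ((n + k)%N, s (n + k)%N)).1 (s n).1; lra.
have [l /cvg_rnormP Hl] : exists l : V, (fun n => (s n).1) @ \oo --> l.
  apply: rnorm_complete => eps e0; have [N HN] := half_pow_lt 2 e0.
  exists N => m n Nm Nn; apply: le_lt_trans HN.
  rewrite -(subnKC Nm) -(subnKC Nn).
  have h1 := nest N (m - N)%N; have h2 := nest N (n - N)%N.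
  have := rnorm_tri (s N).1 (s (N + (m - N))%N).1 (s (N + (n - N))%N).1.
  have := rnormB (s N).1 (s (N + (n - N))%N).1 => eN h3; rewrite eN in h3.
  have := ltW (s0 (N + (m - N))%N); have := ltW (s0 (N + (n - N))%N); have := half N.
  lra.
have inball n : rnorm ((s n).1 - l) <= (s n).2.
  apply/ler_addgt0Pl => eps /Hl[N HN].
  have h1 := HN (n + N)%N (leq_addl _ _); have h2 := nest n N.
  have := rnorm_tri (s (n + N)%N).1 (s n).1 l; rewrite (rnormB (s n).1 (s (n + N)%N).1) => h3.
  have := ltW (s0 (n + N)%N); rewrite /= in h1; lra.
have [k Ek] := cover l.
have [_ _ _ /(_ l Ek) /=] := sS k; apply/negP; rewrite -leNgt; exact: (inball k.+1).
Qed.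

Section coordinates.
Context (x : nat -> V) (sx : schauder x).

Lemma coordD f g : coord x (f + g) = (fun j => coord x f j + coord x g j).
Proof. by apply: coordE => //; apply: expansionD; exact: coordP. Qed.

Lemma coordZ (t : K) f : coord x (t *: f) = (fun j => t * coord x f j).
Proof. by apply: coordE => //; apply: expansionZ; exact: coordP. Qed.

Lemma coordB f g : coord x (f - g) = (fun j => coord x f j - coord x g j).
Proof.
by rewrite -scaleN1r coordD coordZ; apply: funext => j; rewrite mulN1r.
Qed.

Lemma coord_lin a n : (forall j, (n <= j)%N -> a j = 0) -> coord x (lin x a n) = a.
Proof. by move=> a0; apply: coordE => //; apply: expansion_lin. Qed.

Lemma partial_sumB f g m :
  lin x (coord x (f - g)) m = lin x (coord x f) m - lin x (coord x g) m.
Proof. by rewrite coordB linB. Qed.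

Lemma partial_sum_bounded f : exists k : nat, forall m, rnorm (lin x (coord x f) m) <= k%:R.
Proof.
have /expansionP/(_ 1 ltr01)[N HN] : expansion x f (coord x f) by exact: coordP.
set B := rnorm f + 1 + \sum_(m < N) rnorm (lin x (coord x f) m).
have S0 : 0 <= \sum_(m < N) rnorm (lin x (coord x f) m) by rewrite sumr_ge0 // => i _; exact: rnorm_ge0.
have B0 : 0 <= B by have := rnorm_ge0 f; rewrite /B; lra.
exists (Num.Def.archi_bound B) => m; apply: le_trans (ltW (archi_boundP B0)).
have [Nm|mN] := leqP N m.
  have := HN m Nm; have := rnorm_dist (lin x (coord x f) m) f; rewrite /B; lra.
have := rnorm_ge0 f; rewrite /B (bigD1 (Ordinal mN)) //=.
have : 0 <= \sum_(i < N | i != Ordinal mN) rnorm (lin x (coord x f) i).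
  by rewrite sumr_ge0 // => i _; exact: rnorm_ge0.
lra.
Qed.

(** Some set [{g | sup_m |S_m g| <= k}] is dense in a ball by the category
    argument; translating the ball to the origin and rescaling gives this. *)
Lemma approx_bounded : exists2 C : R, 0 <= C & forall h (eps : R), 0 < eps -> exists g,
  rnorm (h - g) < eps /\ forall m, rnorm (lin x (coord x g) m) <= C * rnorm h.
Proof.
have [k [f0 [rho [r0 H]]]] := baire_cover partial_sum_bounded.
exists (4 * k%:R / rho) => [|h eps e0]; first by rewrite divr_ge0 ?mulr_ge0 // ltW.
have [->|hn0] := eqVneq h 0.
  exists 0; rewrite subrr rnorm0 mulr0; split=> // m.
  by rewrite -(lin0 x (fun=> 0)) coord_lin // lin_zero rnorm0.
have h0 : 0 < rnorm h by rewrite rnorm_gt0.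
pose t := rho / 2 / rnorm h; have t0 : 0 < t by rewrite !divr_gt0.
have te : 0 < t * eps / 2 by exact: divr_gt0 (mulr_gt0 t0 e0) (ltr0Sn R 1).
have [|g1 E1 d1] := H (emb F t *: h + f0) _ _ te.
  rewrite addrK rnormZ rabs_emb gtr0_norm // /t divfK ?gt_eqF //; lra.
have [|g2 E2 d2] := H f0 _ _ te; first by rewrite subrr rnorm0.
have et0 : emb F t != 0 by rewrite -(emb0 R F) (inj_eq (@emb_inj R F)) gt_eqF.
exists (emb F t^-1 *: (g1 - g2)); split.
  have -> : h - emb F t^-1 *: (g1 - g2) = emb F t^-1 *: ((emb F t *: h + f0 - g1) - (f0 - g2)).
    have th : h = emb F t^-1 *: (emb F t *: h).
      by rewrite scalerA -embM mulVf ?gt_eqF // emb1 scale1r.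
    rewrite {1}th -scalerBr; congr (_ *: _); move: (emb F t *: h) => u.
    by rewrite !opprB [g2 - f0]addrC [g2 - g1]addrC !addrA [u + f0 - g1 - f0]addrAC addrK.
  rewrite rnormZ rabs_emb gtr0_norm ?invr_gt0 // mulrC ltr_pdivrMr //.
  apply: le_lt_trans (rnorm_triB _ _) _; lra.
move=> m; rewrite coordZ linZ rnormZ rabs_emb gtr0_norm ?invr_gt0 //.
rewrite partial_sumB mulrC ler_pdivrMr //.
have -> : 4 * k%:R / rho * rnorm h * t = 2 * k%:R.
  by rewrite /t; field; rewrite !gt_eqF.
apply: le_trans (rnorm_triB _ _) _; have := E1 m; have := E2 m; lra.
Qed.

End coordinates.

Lemma basis_lb x : is_basis x -> exists2 c : R, 0 < c & forall j, c <= rnorm (x j).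
Proof. by move=> [_ [c [C [c0 H]]]]; exists c => // j; case/andP: (H j). Qed.

(** Banach's theorem: the partial sum projections of a Schauder basis are
    uniformly bounded.  As in the open mapping theorem, every vector is the sum
    of a geometric series of vectors whose partial sums are controlled. *)
Lemma basis_grunblum x : is_basis x -> exists C : R, grunblum x C.
Proof.
move=> bx; have [sx _] := bx; have [c c0 cx] := basis_lb bx.
have [C C0 H] := approx_bounded sx.
suff main f : forall m, rnorm (lin x (coord x f) m) <= 2 * C * rnorm f.
  exists (2 * C) => a m n mn.
  set b := fun j => if (j < n)%N then a j else 0.
  have b0 j : (n <= j)%N -> b j = 0 by rewrite /b ltnNge => ->.
  have Em : lin x a m = lin x b m.
    by apply: eq_lin => j jm; rewrite /b (leq_trans jm mn).
  have En : lin x a n = lin x b n by apply: eq_lin => j jn; rewrite /b jn.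
  by rewrite Em En; have := main (lin x b n) m; rewrite coord_lin.
have [->|fn0] := eqVneq f 0 => [m|].
  by rewrite -[X in coord x X](lin0 x (fun=> 0)) coord_lin // lin_zero !rnorm0 mulr0.
set D := rnorm f; have D0 : 0 < D by rewrite /D rnorm_gt0.
pose e n := D * 2^-1 ^+ n; have e0 n : 0 < e n by rewrite mulr_gt0 // half_pow_gt0.
have eS n : e n = 2 * e n.+1 by rewrite /e exprS; field.
have step (p : nat * V) : exists g, rnorm (p.2 - g) < e p.1.+1 /\
    forall m, rnorm (lin x (coord x g) m) <= C * rnorm p.2 by exact: H.
have [G HG] := choice step.
pose h := fix h n := if n is n'.+1 then h n' - G (n', h n') else f.
have hS n : h n - h n.+1 = G (n, h n) by rewrite /= opprB addrC subrK.
have hn n : rnorm (h n) <= e n.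
  case: n => [|n]; first by rewrite /e expr0 mulr1.
  by have [+ _] := HG (n, h n); exact: ltW.
have inc n k m : rnorm (lin x (coord x (h n - h (n + k)%N)) m) <= 2 * C * (e n - e (n + k)%N).
  elim: k => [|k IH].
    by rewrite addn0 !subrr -(lin0 x (fun=> 0)) coord_lin // lin_zero rnorm0 mulr0.
  have -> : h n - h (n + k.+1)%N = (h n - h (n + k)%N) + G ((n + k)%N, h (n + k)%N).
    by rewrite -hS addnS addrA subrK.
  rewrite coordD // linD; apply: le_trans (rnormD _ _) _.
  have [_ /(_ m)] := HG ((n + k)%N, h (n + k)%N) => /= Hg.
  have Ch := ler_wpM2l C0 (hn (n + k)%N).
  have Ce : C * e (n + k)%N = 2 * (C * e (n + k).+1) by rewrite eS; ring.
  rewrite addnS; lra.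
have inc' n k m : rnorm (lin x (coord x (h n - h (n + k)%N)) m) <= 2 * C * e n.
  apply: le_trans (inc n k m) _; have := ltW (e0 (n + k)%N); have := e0 n; nra.
have cauchy j (eps : R) : 0 < eps -> exists N, forall m n, (N <= m)%N -> (N <= n)%N ->
    rabs (coord x (f - h m) j - coord x (f - h n) j) < eps.
  move=> eps0; have [N HN] := half_pow_lt (8 * C * D) (mulr_gt0 eps0 c0).
  exists N => m n Nm Nn.
  have co k : rabs (coord x (h N - h (N + k)%N) j) * c <= 4 * C * e N.
    set a := coord x _.
    apply: (@le_trans _ _ (rnorm (a j *: x j))); first by rewrite rnormZ ler_wpM2l ?rabs_ge0.
    have -> : a j *: x j = lin x a j.+1 - lin x a j by rewrite linS addrC addKr.
    by apply: le_trans (rnorm_triB _ _) _; have := inc' N k j; have := inc' N k j.+1; rewrite -/a; lra.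
  have E k : coord x (f - h k) j = coord x (f - h N) j + coord x (h N - h k) j.
    have -> : f - h k = (f - h N) + (h N - h k) by rewrite addrA subrK.
    by rewrite coordD.
  rewrite (E m) (E n) opprD addrACA subrr add0r -(subnKC Nm) -(subnKC Nn).
  have := co (m - N)%N; have := co (n - N)%N.
  set p := coord x (h N - h (N + (n - N))%N) j; set q := coord x _ j => cp cq.
  rewrite -(ltr_pM2r c0); apply: le_lt_trans HN.
  have := rabsD q (- p); rewrite rabsN => /(ler_wpM2r (ltW c0)).
  by move: cp cq; rewrite /e; lra.
have [a Ha] := choice (fun j => scalar_complete (cauchy j)).
have near n m : rnorm (lin x a m - lin x (coord x (f - h n)) m) <= 2 * C * e n.
  apply/ler_addgt0Pl => eps eps0; have [N HN] := lin_cvg x m Ha eps0.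
  have h1 := HN (n + N)%N (leq_addl _ _).
  have h2 := rnorm_tri (lin x (coord x (f - h (n + N)%N)) m) (lin x a m) (lin x (coord x (f - h n)) m).
  rewrite -partial_sumB // in h2; rewrite rnormB in h1.
  have fh : f - h (n + N)%N - (f - h n) = h n - h (n + N)%N.
    by rewrite opprB addrC addrA subrK.
  by rewrite fh in h2; have := inc' n N m; lra.
suff : expansion x f a.
  move=> /(coordE sx) -> m; have := near 0%N m.
  rewrite subrr -[X in coord x X](lin0 x (fun=> 0)) coord_lin // lin_zero subr0.
  by rewrite /e expr0 mulr1.
apply/expansionP => eps eps0.
have [n Hn] := half_pow_lt ((2 * C + 1) * D) (divr_gt0 eps0 (ltr0Sn R 1)).
have : expansion x (f - h n) (coord x (f - h n)) by exact: coordP.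
move=> /expansionP/(_ _ (divr_gt0 eps0 (ltr0Sn R 1)))[N HN].
exists N => m /HN Hm.
have := rnorm_tri (lin x (coord x (f - h n)) m) (lin x a m) f.
have := rnorm_tri (f - h n) (lin x (coord x (f - h n)) m) f.
have -> : f - h n - f = - h n by rewrite addrAC subrr add0r.
rewrite rnormN; have := near n m; have := hn n; rewrite /e in Hn *; lra.
Qed.

End banach.

(** * Subsymmetric sequences *)

Section subsymmetric.
Context (R : realType) (F : scalar_kind).
Local Notation K := (scalars R F).

Definition ind (B : pred nat) (a : nat -> K) (j : nat) : K := if B j then a j else 0.

(** The finite form of subsymmetry: only vectors of the span are moved. *)
Definition subsym (V : normedModType K) (e : nat -> V) : Prop :=
  forall n (a : nat -> K) (eps : nat -> bool) (phi : nat -> nat),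
  {homo phi : i j / (i < j)%N} ->
  rnorm (lin (e \o phi) (fun j => (-1) ^+ (eps j) * a j) n) = rnorm (lin e a n).

Context (V : normedModType K) (e : nat -> V) (ss : subsym e).
Implicit Types (a b : nat -> K) (B : pred nat).

Lemma subsym_spread n a phi : {homo phi : i j / (i < j)%N} ->
  rnorm (lin (e \o phi) a n) = rnorm (lin e a n).
Proof.
move=> /(ss n a (fun=> false)) <-; congr rnorm; apply: eq_lin => j _.
by rewrite expr0 mul1r.
Qed.

Lemma subsym_sign n a (eps : nat -> bool) :
  rnorm (lin e (fun j => (-1) ^+ (eps j) * a j) n) = rnorm (lin e a n).
Proof. by rewrite -(ss n a eps (phi := id)). Qed.

(** Each real multiplier in [-1, 1] is a convex combination of the two signs. *)
Lemma subsym_real_mult n a (c : nat -> R) : (forall j, (j < n)%N -> `|c j| <= 1) ->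
  rnorm (lin e (fun j => emb F (c j) * a j) n) <= rnorm (lin e a n).
Proof.
move=> c1.
suff H k : (k <= n)%N ->
    rnorm (lin e (fun j => (if (j < k)%N then emb F (c j) else 1) * a j) n) <= rnorm (lin e a n).
  apply: le_trans (H n (leqnn n)); rewrite le_eqVlt; apply/orP; left; apply/eqP.
  by congr rnorm; apply: eq_lin => j ->.
elim: k => [|k IH] kn.
  by rewrite le_eqVlt; apply/orP; left; apply/eqP; congr rnorm; apply: eq_lin => j _; rewrite mul1r.
have {}IH := IH (ltnW kn).
set b := (fun j => _) in IH.
set b' := (fun j => (-1) ^+ (j == k) * b j).
have -> : lin e (fun j => (if (j < k.+1)%N then emb F (c j) else 1) * a j) n =
    emb F ((1 + c k) / 2) *: lin e b n + emb F ((1 - c k) / 2) *: lin e b' n.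
  rewrite -!linZ -linD; apply: eq_lin => j _; rewrite /b' /b ltnS leq_eqVlt.
  have [->|jk] := eqVneq j k.
    rewrite ltnn /= expr1 mulN1r !mul1r mulrN -mulrBl -embB; congr (emb F _ * _); lra.
  rewrite /= expr0 mul1r -mulrDl -embD.
  have -> : (1 + c k) / 2 + (1 - c k) / 2 = 1 :> R by lra.
  by rewrite emb1 mul1r.
apply: le_trans (rnormD _ _) _; rewrite !rnormZ !rabs_emb subsym_sign.
have := c1 k kn; rewrite ler_norml => /andP[l1 l2].
by rewrite !ger0_norm; lra.
Qed.

Lemma subsym_ind n a B : rnorm (lin e (ind B a) n) <= rnorm (lin e a n).
Proof.
have := @subsym_real_mult n a (fun j => (B j)%:R).
have -> : (fun j => emb F (B j)%:R * a j) = ind B a.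
  by apply: funext => j; rewrite /ind; case: (B j); rewrite ?emb1 ?emb0 ?mul1r ?mul0r.
by apply => j _; rewrite normr_nat; case: (B j).
Qed.

(** Over the complex field the multiplier splits into its real and imaginary
    parts, each of which contracts; hence the factor 2. *)
Lemma subsym_dom n a b : (forall j, (j < n)%N -> rabs (b j) <= rabs (a j)) ->
  rnorm (lin e b n) <= 2 * rnorm (lin e a n).
Proof.
move=> ba; have [iota iota1 split] := scalar_split R F.
pose t j := b j / a j.
have t1 j : (j < n)%N -> rabs (t j) <= 1.
  move=> /ba baj; rewrite /t rabsM rabsV; have [->|a0] := eqVneq (a j) 0.
    by rewrite rabs0 invr0 mulr0.
  by rewrite ler_pdivrMr ?rabs_gt0 // mul1r.
have bt j : (j < n)%N -> b j = t j * a j.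
  move=> /ba baj; rewrite /t; have [a0|a0] := eqVneq (a j) 0; last by rewrite divfK.
  rewrite a0 mulr0; apply: rabs0_eq0; apply: le_anti; rewrite rabs_ge0 andbT.
  by apply: le_trans baj _; rewrite a0 rabs0 lexx.
have [u Hu] := choice (fun j => split (t j)).
have [v Hv] := choice Hu.
have -> : lin e b n = lin e (fun j => emb F (u j) * a j) n + iota *: lin e (fun j => emb F (v j) * a j) n.
  rewrite -linZ -linD; apply: eq_lin => j jn.
  by rewrite bt //; have [tE _ _] := Hv j; rewrite tE mulrDl mulrA.
apply: le_trans (rnormD _ _) _; rewrite rnormZ mulr2n mulrDl mul1r.
apply: lerD; first by apply: subsym_real_mult => j /t1 h; have [_ h' _] := Hv j; apply: le_trans h' h.
rewrite -[leRHS]mul1r; apply: ler_pM; rewrite ?rabs_ge0 ?rnorm_ge0 //.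
by apply: subsym_real_mult => j /t1 h; have [_ _ h'] := Hv j; apply: le_trans h' h.
Qed.

Lemma subsym_grunblum a m n : (m <= n)%N -> rnorm (lin e a m) <= rnorm (lin e a n).
Proof.
move=> mn; rewrite -(lin_trunc e a mn).
exact: (subsym_ind n a (fun j => j < m)%N).
Qed.

(** Strictly increasing finite lists extend to increasing maps of [nat]. *)
Lemma subsym_list (c : nat -> K) (s : seq nat) : sorted ltn s ->
  rnorm (\sum_(i < size s) c i *: e (nth 0%N s i)) = rnorm (lin e c (size s)).
Proof.
move=> ssort.
pose phi i := if (i < size s)%N then nth 0%N s i else (\max_(j <- s) j + i).+1.
have hphi : {homo phi : i j / (i < j)%N}.
  move=> i j ij; rewrite /phi; case: (ltnP j (size s)) => js.
    rewrite (ltn_trans ij js); apply: (sorted_ltn_nth ltn_trans 0%N ssort) => //.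
    by rewrite inE (ltn_trans ij js).
  case: (ltnP i (size s)) => is_; last by lia.
  have : (nth 0%N s i <= \max_(j <- s) j)%N by apply: leq_bigmax_seq => //; exact: mem_nth.
  by lia.
rewrite -(subsym_spread (size s) c hphi); congr rnorm; apply: eq_bigr => i _.
by rewrite /phi /= ltn_ord.
Qed.

Lemma big_ord_filter (W : nmodType) n B (f : nat -> W) (s := [seq j <- iota 0 n | B j]) :
  \sum_(j < n | B j) f j = \sum_(i < size s) f (nth 0%N s i).
Proof.
rewrite -(big_mkord B f) -big_filter /index_iota subn0 -/s.
by rewrite (big_nth 0%N) big_mkord.
Qed.

(** Moving the indices in [B] increasingly does not change the norm: both sides
    are the norm of the same coefficients on an initial segment. *)
Lemma subsym_move n a B (pi : nat -> nat) :
  (forall i j, (i < j < n)%N -> B i -> B j -> (pi i < pi j)%N) ->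
  rnorm (\sum_(j < n | B j) a j *: e (pi j)) = rnorm (lin e (ind B a) n).
Proof.
move=> Hpi.
have -> : lin e (ind B a) n = \sum_(j < n | B j) a j *: e j.
  by rewrite [RHS]big_mkcond; apply: eq_bigr => j _; rewrite /ind; case: (B j); rewrite ?scale0r.
rewrite (@big_ord_filter _ n B (fun j => a j *: e (pi j))) (@big_ord_filter _ n B (fun j => a j *: e j)).
set s := [seq j <- iota 0 n | B j].
have ssort : sorted ltn s by apply: sorted_filter; [exact: ltn_trans | exact: iota_ltn_sorted].
rewrite (subsym_list (fun i => a (nth 0%N s i)) ssort).
have sB i : (i < size s)%N -> B (nth 0%N s i) && (nth 0%N s i < n)%N.
  by move=> /(mem_nth 0%N); rewrite mem_filter mem_iota add0n.
have psort : sorted ltn (map pi s).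
  apply/(sortedP 0%N) => i; rewrite size_map => is_.
  rewrite !(nth_map 0%N) // 1?ltnW //.
  have /andP[B1 n1] := sB _ is_; have /andP[B2 n2] := sB i (ltnW is_).
  apply: Hpi => //; rewrite n1 andbT.
  by apply: (sortedP 0%N ssort).
rewrite -[in RHS](size_map pi) -(subsym_list (fun i => a (nth 0%N s i)) psort) size_map.
congr rnorm; apply: eq_bigr => i _; by rewrite (nth_map 0%N).
Qed.

(** Each piece is moved without change of norm.  This applies to cyclic shifts,
    although the norm need not be invariant under permutations. *)
Lemma subsym_two_pieces n a B (pi : nat -> nat) :
  (forall i j, (i < j < n)%N -> B i = B j -> (pi i < pi j)%N) ->
  rnorm (\sum_(j < n) a j *: e (pi j)) <= 2 * rnorm (lin e a n).
Proof.
move=> Hpi; rewrite (bigID (fun j : 'I_n => B j)) /=.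
apply: le_trans (rnormD _ _) _; rewrite mulr2n mulrDl mul1r; apply: lerD.
  by rewrite subsym_move ?subsym_ind // => i j ij Bi Bj; apply: Hpi => //; rewrite Bi Bj.
rewrite (@subsym_move n a (predC B)) ?subsym_ind // => i j ij /negbTE Bi /negbTE Bj.
by apply: Hpi => //; rewrite Bi Bj.
Qed.

(** By subsymmetry this is the norm of the sum of any [m] basis vectors. *)
Definition ones_norm m := rnorm (\sum_(j < m) e j).

Lemma LamE m : ones_norm m = rnorm (lin e (fun=> 1) m).
Proof. by congr rnorm; apply: eq_bigr => j _; rewrite scale1r. Qed.

Lemma Lam_ge0 m : 0 <= ones_norm m. Proof. exact: rnorm_ge0. Qed.

Lemma Lam_mono m n : (m <= n)%N -> ones_norm m <= ones_norm n.
Proof. by rewrite !LamE; exact: subsym_grunblum. Qed.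

Lemma Lam_count n B : rnorm (lin e (ind B (fun=> 1)) n) = ones_norm (count B (iota 0 n)).
Proof.
rewrite -(@subsym_move n _ B id) // => [|i j /andP[]//].
rewrite (@big_ord_filter _ n B (fun j => 1 *: e j)) -size_filter LamE.
rewrite (subsym_list (fun=> 1)) //.
by apply: sorted_filter; [exact: ltn_trans | exact: iota_ltn_sorted].
Qed.

Lemma Lam_shift m k : rnorm (\sum_(j < m) e (k + j)%N) = ones_norm m.
Proof.
rewrite LamE -(subsym_spread m (fun=> 1) (phi := fun j => (k + j)%N)) => [|i j]; last by lia.
by congr rnorm; apply: eq_bigr => j _; rewrite scale1r.
Qed.

Lemma Lam_add m n : ones_norm (m + n) <= ones_norm m + ones_norm n.
Proof.
rewrite /ones_norm big_split_ord /=; apply: le_trans (rnormD _ _) _; rewrite lerD2l.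
by rewrite (Lam_shift n m).
Qed.

Lemma sum_mod (W : nmodType) (f : nat -> W) s i k : (0 < s)%N ->
  \sum_(c < k * s) f ((i + c) %% s)%N = (\sum_(j < s) f j) *+ k.
Proof.
move=> s0; have one : forall i, \sum_(c < s) f ((i + c) %% s)%N = \sum_(j < s) f j.
  move=> {}i; elim: i => [|i IH]; first by apply: eq_bigr => j _; rewrite add0n modn_small.
  case: s s0 IH => // s _ <-; rewrite big_ord_recr big_ord_recl /= addrC addn0; congr (_ + _).
    by rewrite addSnnS -modnDmr modnn addn0.
  by apply: eq_bigr => j _; rewrite /bump /= addnCA addnA add1n.
elim: k => [|k IH]; first by rewrite mul0n big_ord0 mulr0n.
rewrite mulSn big_split_ord /= one mulrS; congr (_ + _); rewrite -IH.
by apply: eq_bigr => j _; rewrite addnCA modnDl.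
Qed.

(** Averaging over the cyclic shifts replaces a vector by a constant one; this
    bounds the norm of the sum functional on [k] coordinates by [2 * k / ones_norm k],
    where [ones_norm k] is the norm of the sum of [k] basis vectors. *)
Lemma subsym_sum k a : rabs (\sum_(j < k) a j) * ones_norm k <= 2 * k%:R * rnorm (lin e a k).
Proof.
have [->|k0] := posnP k; first by rewrite big_ord0 rabs0 !(mul0r, mulr0).
have -> : rabs (\sum_(j < k) a j) * ones_norm k = rnorm (\sum_(c < k) \sum_(j < k) a j *: e ((j + c) %% k)%N).
  rewrite exchange_big /= -rnormZ scaler_suml; congr rnorm; apply: eq_bigr => j _.
  by have := @sum_mod _ e k j 1 k0; rewrite -scaler_sumr mul1n mulr1n => ->.
apply: le_trans (rnorm_sum _ _ _) _.
have -> : 2 * k%:R * rnorm (lin e a k) = \sum_(c < k) 2 * rnorm (lin e a k).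
  by rewrite sumr_const card_ord -[RHS]mulr_natl mulrA [2 * _]mulrC.
apply: ler_sum => c _; apply: (@subsym_two_pieces k a (fun j => j + c < k)%N (fun j => (j + c) %% k)%N) => i j.
case/andP=> ij jk; have ck := ltn_ord c.
have E x : (x < k)%N -> ((x + c) %% k = if (x + c < k) then x + c else x + c - k)%N.
  move=> xk; case: ltnP => h; first by rewrite modn_small.
  by rewrite -{1}(subnK h) modnDr modn_small //; lia.
rewrite !E ?(ltn_trans ij jk) //; case h1: (i + c < k)%N; case h2: (j + c < k)%N => // _; lia.
Qed.

(** Only the number of coordinates in the support matters, since they can be
    pushed together to an initial segment. *)
Lemma subsym_sum_count k a B m : (count B (iota 0 k) <= m)%N ->
  rabs (\sum_(j < k) ind B a j) * ones_norm m <= 2 * m%:R * rnorm (lin e (ind B a) k).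
Proof.
set s := [seq j <- iota 0 k | B j]; rewrite -size_filter -/s => sm.
pose c i := if (i < size s)%N then a (nth 0%N s i) else 0.
have Ec (W : nmodType) (f : nat -> K -> W) : (forall i, f i 0 = 0) ->
    \sum_(i < m) f i (c i) = \sum_(i < size s) f i (a (nth 0%N s i)).
  move=> f0; rewrite -(subnKC sm) big_split_ord /= [X in _ + X]big1 ?addr0 => [|i _].
    by apply: eq_bigr => i _; rewrite /c ltn_ord.
  by rewrite /c ltnNge leq_addr /= f0.
have -> : \sum_(j < k) ind B a j = \sum_(i < m) c i.
  rewrite (Ec _ (fun=> id)) // -(@big_ord_filter _ k B a) [RHS]big_mkcond.
  by apply: eq_bigr.
have -> : rnorm (lin e (ind B a) k) = rnorm (lin e c m); last exact: subsym_sum.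
rewrite -(@subsym_move k a B id) // => [|i j /andP[]//].
rewrite (@big_ord_filter _ k B (fun j => a j *: e j)).
rewrite /lin (Ec _ (fun i t => t *: e i)) => [|i]; last by rewrite scale0r.
rewrite (subsym_list (fun i => a (nth 0%N s i))) //.
by apply: sorted_filter; [exact: ltn_trans | exact: iota_ltn_sorted].
Qed.

Lemma Lam_count_le n a B (t : R) : 0 <= t ->
  (forall j, (j < n)%N -> B j -> t <= rabs (a j)) ->
  t * ones_norm (count B (iota 0 n)) <= 2 * rnorm (lin e a n).
Proof.
move=> t0 ta; rewrite -Lam_count -{1}(ger0_norm t0) -(@rabs_emb R F) -rnormZ -linZ.
apply: subsym_dom => j jn; rewrite rabsM rabs_emb ger0_norm // /ind.
by case: ifPn => Bj; rewrite ?rabs1 ?rabs0 ?mulr1 ?mulr0 ?rabs_ge0 // ta.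
Qed.

Lemma le_Lam_count n a B (t : R) : 0 <= t ->
  (forall j, (j < n)%N -> rabs (a j) <= if B j then t else 0) ->
  rnorm (lin e a n) <= 2 * (t * ones_norm (count B (iota 0 n))).
Proof.
move=> t0 ta; rewrite -Lam_count -{1}(ger0_norm t0) -(@rabs_emb R F) -rnormZ -linZ.
apply: subsym_dom => j jn; rewrite rabsM rabs_emb ger0_norm // /ind.
by have := ta j jn; case: ifPn => Bj; rewrite ?rabs1 ?rabs0 ?mulr1 ?mulr0.
Qed.

End subsymmetric.

(** * Dyadic blocks and the averaging projection *)

(** The index of the [i]-th element of the [n]-th block, which has length
    [2 ^ n] and starts at [2 ^ n - 1]. *)
Definition bs (n i : nat) : nat := (2 ^ n).-1 + i.
Definition blk (j : nat) : nat := trunc_log 2 j.+1.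

Lemma bsS n i : (bs n i).+1 = (2 ^ n + i)%N.
Proof. by rewrite /bs -addSn prednK // expn_gt0. Qed.

Lemma bsK n i : (bs n i - bs n 0 = i)%N.
Proof. by rewrite /bs addn0 addKn. Qed.

Lemma blk_bs n i : (i < 2 ^ n)%N -> blk (bs n i) = n.
Proof.
by move=> h; rewrite /blk bsS; apply: trunc_log_eq => //; rewrite leq_addr expnS; lia.
Qed.

Lemma bs_blk j : exists2 i, (i < 2 ^ blk j)%N & j = bs (blk j) i.
Proof.
have /andP[h1 h2] := trunc_log_bounds (ltnSn 1) (ltn0Sn j).
exists (j.+1 - 2 ^ blk j)%N; first by rewrite /blk; move: h2; rewrite expnS; lia.
by apply: succn_inj; rewrite bsS subnKC.
Qed.

Lemma blk_lt j N : (j < (2 ^ N).-1)%N = (blk j < N)%N.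
Proof.
have h : (j < (2 ^ N).-1)%N = (j.+1 < 2 ^ N)%N by have := expn_gt0 2 N; lia.
have /andP[h1 h2] := trunc_log_bounds (ltnSn 1) (ltn0Sn j).
rewrite h; apply/idP/idP => lt.
  by rewrite -(ltn_exp2l _ _ (ltnSn 1)); apply: leq_ltn_trans h1 lt.
by apply: leq_trans h2 _; rewrite leq_exp2l.
Qed.

Lemma sum_blocks (W : nmodType) (f : nat -> W) N :
  \sum_(j < (2 ^ N).-1) f j = \sum_(n < N) \sum_(i < 2 ^ n) f (bs n i).
Proof.
elim: N => [|N IH]; first by rewrite !big_ord0.
rewrite big_ord_recr /= -IH.
have -> : (2 ^ N.+1).-1 = ((2 ^ N).-1 + 2 ^ N)%N by rewrite expnS; have := expn_gt0 2 N; lia.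
by rewrite big_split_ord.
Qed.

Lemma sum_mul (W : nmodType) (f : nat -> W) k m :
  \sum_(j < k * m) f j = \sum_(i < k) \sum_(j < m) f (i * m + j)%N.
Proof.
elim: k => [|k IH]; first by rewrite mul0n !big_ord0.
by rewrite big_ord_recr /= -IH mulSn addnC big_split_ord.
Qed.

Section averaging.
Context (R : realType) (F : scalar_kind).
Local Notation K := (scalars R F).

Definition blksum (a : nat -> K) n : K := \sum_(i < 2 ^ n) a (bs n i).

(** The conditional expectation onto the sequences that are constant on the
    dyadic blocks. *)
Definition avg (a : nat -> K) j : K := (2 ^ blk j)%:R^-1 * blksum a (blk j).

Lemma nat_neq0 n : (2 ^ n)%:R != 0 :> K.
Proof. by rewrite pnatr_eq0 expn_eq0. Qed.

Lemma lin_blocks (W : lmodType K) (x : nat -> W) a N :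
  lin x a (2 ^ N).-1 = \sum_(n < N) \sum_(i < 2 ^ n) a (bs n i) *: x (bs n i).
Proof. exact: (sum_blocks (fun j => a j *: x j)). Qed.

Lemma avg_bs a n i : (i < 2 ^ n)%N -> avg a (bs n i) = (2 ^ n)%:R^-1 * blksum a n.
Proof. by move=> h; rewrite /avg blk_bs. Qed.

Lemma lin_avg (W : lmodType K) (x : nat -> W) a N :
  lin x (avg a) (2 ^ N).-1 =
  \sum_(n < N) ((2 ^ n)%:R^-1 * blksum a n) *: \sum_(i < 2 ^ n) x (bs n i).
Proof.
rewrite lin_blocks; apply: eq_bigr => n _; rewrite scaler_sumr.
by apply: eq_bigr => i _; rewrite avg_bs.
Qed.

Context (V : normedModType K) (e : nat -> V) (ss : subsym e).

(** Shifting the block of length [2 ^ n] cyclically by [c %% 2 ^ n], one common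
    [c] moves all blocks at once; averaging over [c < 2 ^ N] equidistributes
    the shifts in each of the first [N] blocks. *)
Lemma rnorm_avg a N : rnorm (lin e (avg a) (2 ^ N).-1) <= 2 * rnorm (lin e a (2 ^ N).-1).
Proof.
pose pi c j := bs (blk j) ((j - bs (blk j) 0 + c) %% 2 ^ blk j)%N.
have pi_bs c n i : (i < 2 ^ n)%N -> pi c (bs n i) = bs n ((i + c) %% 2 ^ n).
  by move=> h; rewrite /pi blk_bs // bsK.
have E : (2 ^ N)%:R *: lin e (avg a) (2 ^ N).-1 =
    \sum_(c < 2 ^ N) \sum_(j < (2 ^ N).-1) a j *: e (pi c j).
  rewrite lin_avg scaler_sumr.
  under [RHS]eq_bigr => c _ do rewrite (sum_blocks (fun j => a j *: e (pi c j))).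
  rewrite exchange_big /=; apply: eq_bigr => n _.
  rewrite exchange_big /= /blksum mulr_sumr scaler_suml scaler_sumr.
  apply: eq_bigr => i _; rewrite -scaler_sumr.
  have -> : \sum_(c < 2 ^ N) e (pi c (bs n i)) = (\sum_(j < 2 ^ n) e (bs n j)) *+ 2 ^ (N - n).
    have n0 : (0 < 2 ^ n)%N by rewrite expn_gt0.
    have <- := @sum_mod _ (fun j => e (bs n j)) (2 ^ n) i (2 ^ (N - n)) n0.
    rewrite -expnD subnK; last exact: ltnW (ltn_ord n).
    by apply: eq_bigr => c _; rewrite pi_bs.
  rewrite -[X in _ = _ *: X]scaler_nat !scalerA; congr (_ *: _).
  have -> : (2 ^ N)%:R = (2 ^ (N - n))%:R * (2 ^ n)%:R :> K.
    by rewrite -natrM -expnD subnK //; exact: ltnW (ltn_ord n).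
  have := nat_neq0 n; set A := (2 ^ (N - n))%:R; set B := (2 ^ n)%:R => B0.
  by rewrite !mulrA mulfK // mulrC.
have N0 : 0 < (2 ^ N)%:R :> R by rewrite ltr0n expn_gt0.
rewrite -(ler_pM2l N0) -{1}(@rabs_nat R F) -rnormZ E; apply: le_trans (rnorm_sum _ _ _) _.
have -> : (2 ^ N)%:R * (2 * rnorm (lin e a (2 ^ N).-1)) =
    \sum_(c < 2 ^ N) 2 * rnorm (lin e a (2 ^ N).-1).
  by rewrite sumr_const card_ord -[RHS]mulr_natl.
apply: ler_sum => c _.
apply: (@subsym_two_pieces _ _ _ _ ss _ a
  (fun j => (j - bs (blk j) 0) + c %% 2 ^ blk j < 2 ^ blk j)%N (pi c)) => j k /andP[jk _].
have [i hi ei] := bs_blk j; have [l hl el] := bs_blk k.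
have jkb : (blk j <= blk k)%N by apply: leq_trunc_log; lia.
move: (blk j) (blk k) hi ei hl el jkb jk => n m hi -> hl -> nm lt.
rewrite !pi_bs // !bsK.
have [nem|nm'] := eqVneq n m; last first.
  move=> _; have : (2 ^ n.+1 <= 2 ^ m)%N by rewrite leq_exp2l // ltn_neqAle nm'.
  rewrite expnS; have := ltn_pmod (i + c) (expn_gt0 2 n : 0 < 2 ^ n)%N.
  by have := bsS n ((i + c) %% 2 ^ n); have := bsS m ((l + c) %% 2 ^ m); lia.
rewrite -{m nm}nem in hl lt *.
have il : (i < l)%N by move: lt; rewrite /bs; lia.
have E' x : (x < 2 ^ n)%N -> ((x + c) %% 2 ^ n =
    if (x + c %% 2 ^ n < 2 ^ n) then x + c %% 2 ^ n else x + c %% 2 ^ n - 2 ^ n)%N.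
  move=> xk; rewrite -modnDmr; have hc := ltn_pmod c (expn_gt0 2 n : 0 < 2 ^ n)%N.
  case: ltnP => h; first by rewrite modn_small.
  by rewrite -{1}(subnK h) modnDr modn_small //; lia.
rewrite !E' //; case h1: (i + _ < _)%N; case h2: (l + _ < _)%N => // _; rewrite /bs; lia.
Qed.

End averaging.

(** * The fundamental function under nontrivial type *)

Section growth.
Context (R : realType) (F : scalar_kind).
Local Notation K := (scalars R F).
Context (S : completeNormedModType K).

(** The constant of the type inequality is absorbed by the gap between
    [k ^ (1 / p)] and [k], as soon as the number [k] of vectors is large. *)
Lemma type_bound : nontrivial_type S -> exists k0 : nat,
  forall k, (k0 <= k)%N -> forall (v : 'I_k -> S) (B D : R), 0 <= B -> 0 <= D ->
  (forall eps : {ffun 'I_k -> bool}, B <= rnorm (\sum_(i < k) (-1) ^+ (eps i) *: v i)) ->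
  (forall i, rnorm (v i) <= D) -> B <= k%:R / 2 * D.
Proof.
move=> [p /andP[p1 _] [C HC]].
have p0 : 0 < p by lra.
have pV : p * p^-1 = 1 by rewrite mulfV // gt_eqF.
pose q := 1 - p^-1; have q0 : 0 < q by rewrite subr_gt0 invf_lt1.
pose c := 2 * `|C|.
have c0 : 0 <= c by rewrite mulr_ge0.
exists (Num.Def.archi_bound (c `^ q^-1)).+1 => k kk0 v B D B0 D0 HB HD.
have k0 : 0 < k%:R :> R by rewrite ltr0n; lia.
have kc : c <= k%:R `^ q.
  have -> : c = (c `^ q^-1) `^ q by rewrite -powRrM mulVf ?powRr1 // gt_eqF.
  apply: ge0_ler_powR; rewrite ?nnegrE ?powR_ge0 ?ltW //.
  by apply: lt_le_trans (archi_boundP (powR_ge0 _ _)) _; rewrite ler_nat; lia.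
have left : B <= ((2 ^+ k)^-1 * \sum_(eps : {ffun 'I_k -> bool})
        rnorm (\sum_(i < k) (-1) ^+ (eps i) *: v i) `^ p) `^ p^-1.
  have -> : B = ((2 ^+ k)^-1 * \sum_(eps : {ffun 'I_k -> bool}) B `^ p) `^ p^-1.
    rewrite sumr_const card_ffun card_bool card_ord -[X in _ * X]mulr_natl natrX mulrA.
    by rewrite mulVf ?expf_neq0 // mul1r -powRrM pV powRr1.
  have pos (f : {ffun 'I_k -> bool} -> R) : 0 <= (2 ^+ k)^-1 * \sum_(eps : {ffun 'I_k -> bool}) f eps `^ p.
    by rewrite mulr_ge0 ?invr_ge0 ?exprn_ge0 // sumr_ge0 // => i _; exact: powR_ge0.
  apply: ge0_ler_powR; rewrite ?nnegrE ?pos ?invr_ge0 ?(ltW p0) //.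
  rewrite ler_wpM2l ?invr_ge0 ?exprn_ge0 //; apply: ler_sum => eps _.
  by apply: ge0_ler_powR; rewrite ?nnegrE ?rnorm_ge0 ?(ltW p0).
apply: le_trans left _; apply: le_trans (HC k v) _.
have right : (\sum_(i < k) rnorm (v i) `^ p) `^ p^-1 <= k%:R `^ p^-1 * D.
  have -> : k%:R `^ p^-1 * D = (\sum_(i < k) D `^ p) `^ p^-1.
    rewrite sumr_const card_ord -[X in _ = X `^ _]mulr_natl powRM ?powR_ge0 //.
    by rewrite -powRrM pV powRr1.
  have pos (f : 'I_k -> R) : 0 <= \sum_(i < k) f i `^ p by rewrite sumr_ge0 // => i _; exact: powR_ge0.
  apply: ge0_ler_powR; rewrite ?nnegrE ?pos ?invr_ge0 ?(ltW p0) //.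
  by apply: ler_sum => i _; apply: ge0_ler_powR; rewrite ?nnegrE ?rnorm_ge0 ?(ltW p0).
apply: (@le_trans _ _ (`|C| * (k%:R `^ p^-1 * D))).
  apply: le_trans (ler_wpM2l (normr_ge0 C) right).
  by rewrite ler_wpM2r ?powR_ge0 ?ler_norm.
rewrite mulrA ler_wpM2r //.
have E : k%:R = k%:R `^ p^-1 * k%:R `^ q.
  have pq : p^-1 + q = 1 by rewrite /q addrC subrK.
  by rewrite -powRD pq ?powRr1 ?oner_eq0 // ltW.
rewrite [X in _ <= X / 2]E.
rewrite mulrC -mulrA ler_wpM2l ?powR_ge0 //; move: kc; rewrite /c; lra.
Qed.

Context (e : nat -> S) (ss : subsym e).

Lemma lin_mul_const (c : nat -> K) k m :
  lin e (fun j => c (j %/ m)%N) (k * m) = \sum_(i < k) c i *: \sum_(j < m) e (i * m + j)%N.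
Proof.
have [->|m0] := posnP m.
  by rewrite muln0 lin0 big1 // => i _; rewrite big_ord0 scaler0.
rewrite /lin (@sum_mul _ (fun j => c (j %/ m)%N *: e j)); apply: eq_bigr => i _.
by rewrite scaler_sumr; apply: eq_bigr => j _; rewrite divnMDl // divn_small // addn0.
Qed.

Lemma rnorm_signed_const (c : nat -> bool) n :
  rnorm (lin e (fun j => (-1) ^+ (c j)) n) = ones_norm e n.
Proof.
rewrite LamE -(subsym_sign ss _ _ c); congr rnorm; apply: eq_lin => j _; by rewrite mulr1.
Qed.

(** The upper estimate is the type inequality for consecutive blocks.  For the
    lower one, the type inequality for Rademacher-like vectors: were
    [ones_norm (2 ^ k * m) < 2 * ones_norm m], the [2 ^ k] blocks would span a copy of
    $\ell_\infty^{2^k}$, in which the [k] coordinatewise sign vectors span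
    a copy of $\ell_1^k$. *)
Lemma type_growth : nontrivial_type S -> exists k0 : nat, forall k m, (k0 <= k)%N ->
  ones_norm e (k * m) <= k%:R / 2 * ones_norm e m /\ 2 * ones_norm e m <= ones_norm e (2 ^ k * m).
Proof.
move=> /type_bound[k0 H]; exists k0.+1 => k m k0k; have {}H := H k (ltnW k0k).
split.
  apply: (H (fun i => \sum_(j < m) e (i * m + j)%N)); rewrite ?Lam_ge0 //.
    move=> eps; pose c i := if insub i is Some i' then eps i' else false.
    rewrite -(rnorm_signed_const (fun j => c (j %/ m)%N)).
    rewrite (lin_mul_const (fun i => (-1) ^+ (c i))) le_eqVlt; apply/orP; left; apply/eqP.
    by congr rnorm; apply: eq_bigr => i _; rewrite /c valK.
  by move=> i; rewrite (Lam_shift ss).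
pose s := enum {: {ffun 'I_k -> bool}}.
pose eps0 : {ffun 'I_k -> bool} := [ffun=> false].
have size_s : size s = (2 ^ k)%N by rewrite -cardE card_ffun card_bool card_ord.
pose v (t : 'I_k) := lin e (fun j => (-1) ^+ (nth eps0 s (j %/ m)%N t)) (2 ^ k * m).
have k_gt0 : 0 < k%:R :> R by rewrite ltr0n; lia.
suff : k%:R * ones_norm e m <= k%:R / 2 * ones_norm e (2 ^ k * m).
  by rewrite -mulrA ler_pM2l // mulrC ler_pdivlMr // mulrC.
apply: (H v _ _ (mulr_ge0 (ler0n _ _) (Lam_ge0 _ _)) (Lam_ge0 _ _)) => [eps|t]; last first.
  by rewrite (rnorm_signed_const (fun j => nth eps0 s (j %/ m)%N t)).
have eps_s : eps \in s by rewrite mem_enum inE.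
pose i0 := index eps s.
(* on block [i0] the [t]-th sign vector has the sign [eps t], for all [t] *)
have i0_lt : (i0 < 2 ^ k)%N by rewrite -size_s index_mem.
pose a j : K := \sum_(t < k) (-1) ^+ (eps t) * (-1) ^+ (nth eps0 s (j %/ m)%N t).
have -> : \sum_(t < k) (-1) ^+ (eps t) *: v t = lin e a (2 ^ k * m).
  rewrite /lin /a; under [RHS]eq_bigr => j _ do rewrite scaler_suml.
  rewrite exchange_big /=; apply: eq_bigr => t _; rewrite scaler_sumr.
  by apply: eq_bigr => j _; rewrite scalerA.
apply: le_trans (subsym_ind ss _ _ (fun j => (j %/ m)%N == i0)).
have -> : lin e (ind (fun j => (j %/ m)%N == i0) a) (2 ^ k * m) =
    k%:R *: \sum_(j < m) e (i0 * m + j)%N.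
  transitivity (lin e (fun j => if (j %/ m)%N == i0 then (k%:R : K) else 0) (2 ^ k * m)).
    apply: eq_lin => j _; rewrite /ind; case: eqP => // ji.
    rewrite /a ji nth_index // (eq_bigr (fun=> 1)) ?sumr_const ?card_ord // => t _.
    by rewrite -expr2 sqrr_sign.
  rewrite (lin_mul_const (fun i => if i == i0 then (k%:R : K) else 0)).
  rewrite (bigD1 (Ordinal i0_lt)) //= eqxx [X in _ + X]big1 ?addr0 // => i.
  by rewrite -val_eqE /= => /negbTE->; rewrite scale0r.
by rewrite rnormZ rabs_nat (Lam_shift ss).
Qed.

Definition dyad_norm n := ones_norm e (2 ^ n).
(** The reciprocal of [dyad_ratio n], times the sum of the coefficients in a block of
    length [2 ^ n], is the functional dual to the normalized sum of the block. *)
Definition dyad_ratio n := (2 ^ n)%:R / dyad_norm n.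

(** Both the fundamental function along powers of 2 and the function [dyad_ratio] thus
    grow geometrically, which makes the sums of [dyad_norm] over initial segments and
    of [1 / dyad_ratio] over tails comparable to a single term. *)
Lemma lam_growth : nontrivial_type S -> (forall n, 0 < dyad_norm n) -> exists2 r : nat, (0 < r)%N &
  forall n, 2 * dyad_norm n <= dyad_norm (n + r) /\ 2 * dyad_ratio n <= dyad_ratio (n + r).
Proof.
move=> /type_growth[k0 H] l0; exists k0.+1 => // n; rewrite /dyad_ratio /dyad_norm expnD mulnC.
have [_ h2] := H k0.+1 (2 ^ n)%N (leqnSn _).
have [h1 _] := H (2 ^ k0.+1)%N (2 ^ n)%N (ltnW (ltn_trans (ltnSn k0) (ltn_expl _ (ltnSn 1)))).
split=> //; rewrite ler_pdivlMr; last by rewrite mulnC -expnD; exact: l0.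
have := l0 n; rewrite /dyad_norm => ln.
have c0 : 0 <= 2 * ((2 ^ n)%:R / ones_norm e (2 ^ n)) by rewrite mulr_ge0 // divr_ge0 // ltW.
apply: le_trans (ler_wpM2l c0 h1) _; rewrite [in leRHS]mulnC natrM.
move: (ones_norm e (2 ^ n)) ((2 ^ n)%:R : R) ((2 ^ k0.+1)%:R : R) ln => L a b L0.
have -> : 2 * (a / L) * (b / 2 * L) = b * a by field; rewrite gt_eqF.
by rewrite mulrC lexx.
Qed.

End growth.

(** * Sequences with geometric growth *)

Section doubling_sequences.
Context (R : realType) (u : nat -> R) (r : nat).
Hypotheses (u0 : forall n, 0 < u n) (umono : forall m n, (m <= n)%N -> u m <= u n).
Hypotheses (r0 : (0 < r)%N) (udbl : forall n, 2 * u n <= u (n + r)).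

Lemma doubling_sum n : \sum_(i < n.+1) u i <= 2 * r%:R * u n.
Proof.
have [m nm] := ubnP n; elim: m n nm => // m IH n /ltnSE nm.
have tail k l : (k + l = n.+1)%N -> \sum_(i < l) u (k + i)%N <= l%:R * u n.
  move=> kl; rewrite -[l in l%:R]card_ord -sumr_const mulr_suml; apply: ler_sum => i _.
  by rewrite mul1r umono //; have := ltn_ord i; lia.
have un0 := ltW (u0 n).
have [nr|rn] := ltnP n r.
  apply: le_trans (tail 0%N n.+1 _) _ => //; rewrite ler_wpM2r //.
  by rewrite -natrM ler_nat; lia.
have [k ek] : exists k, n = (k + r)%N by exists (n - r)%N; lia.
rewrite ek -addSn big_split_ord /=; rewrite -ek.
have := tail k.+1 r; rewrite ek addSn -ek => /(_ erefl) h1.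
have h2 : \sum_(i < k.+1) u i <= 2 * r%:R * u k by apply: IH; lia.
have h3 := udbl k; rewrite -ek in h3.
have h4 : r%:R * (2 * u k) <= r%:R * u n by rewrite ler_wpM2l.
by apply: le_trans (lerD h2 h1) _; lra.
Qed.

Lemma doubling_sumV n k : \sum_(i < k) (u (n + i)%N)^-1 <= 2 * r%:R / u n.
Proof.
have [m km] := ubnP k; elim: m n k km => // m IH n k /ltnSE km.
have head l : \sum_(i < l) (u (n + i)%N)^-1 <= l%:R / u n.
  rewrite -[l in l%:R]card_ord -sumr_const mulr_suml; apply: ler_sum => i _.
  by rewrite mul1r lef_pV2 ?posrE // umono // leq_addr.
have un0 : 0 < (u n)^-1 by rewrite invr_gt0.
have [kr|rk] := leqP k r.
  apply: le_trans (head k) _; rewrite ler_wpM2r ?(ltW un0) //.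
  by rewrite -natrM ler_nat; lia.
rewrite -(subnKC (ltnW rk)) big_split_ord /=.
have h1 := head r.
have h2 : \sum_(i < k - r) (u (n + (r + i))%N)^-1 <= 2 * r%:R / u (n + r)%N.
  under eq_bigr => i _ do rewrite addnA.
  by apply: IH; lia.
have h3 : (u (n + r)%N)^-1 <= (u n)^-1 / 2.
  by rewrite -invfM lef_pV2 ?posrE ?mulr_gt0 // mulrC.
have h4 : r%:R * (u (n + r)%N)^-1 <= r%:R * ((u n)^-1 / 2) by rewrite ler_wpM2l.
by apply: le_trans (lerD h1 h2) _; lra.
Qed.

End doubling_sequences.

(** * Estimates for the norm of Dilworth, Kalton and Kutzarova *)

(** For coefficients [a], let [Qf a] be [a] minus its averages over the blocks
    and let [vf a n] be the value at [a] of the functional dual to the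
    normalized sum of the [n]-th block.  The norm under study is
    [|| sum_j (Qf a j) e_j || + || sum_n (vf a n) z_n ||], for a subsymmetric
    [e] and a sequence [z].  All estimates concern the coefficients in the first
    [N] blocks, with constants independent of [N]. *)
Section dkk.
Context (R : realType) (F : scalar_kind).
Local Notation K := (scalars R F).
Context (V : completeNormedModType K) (e : nat -> V) (ss : subsym e).
Local Notation lam := (dyad_norm e).
Local Notation mu := (dyad_ratio e).
Local Notation Lam := (ones_norm e).
Hypothesis lam0 : forall n, 0 < lam n.
Context (r : nat).
Hypotheses (r0 : (0 < r)%N) (lamD : forall n, 2 * lam n <= lam (n + r))
  (muD : forall n, 2 * mu n <= mu (n + r)).
Context (X : completeNormedModType K) (z : nat -> X) (Cz : R).
Hypotheses (z1 : forall n, rnorm (z n) <= Cz).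
Implicit Types (a b : nat -> K) (B G : pred nat).

Definition dkk_coef a n : K := emb F (lam n) / (2 ^ n)%:R * blksum a n.
Local Notation vf := dkk_coef.

Definition Qf a j : K := a j - avg a j.

Lemma lam_mono m n : (m <= n)%N -> lam m <= lam n.
Proof. by move=> mn; apply: (Lam_mono ss); rewrite leq_exp2l. Qed.

Lemma lamS n : lam n.+1 <= 2 * lam n.
Proof. by rewrite /dyad_norm expnS mul2n -addnn mulr2n mulrDl mul1r; exact: (Lam_add ss). Qed.

Lemma pow0 n : 0 < (2 ^ n)%:R :> R.
Proof. by rewrite ltr0n expn_gt0. Qed.

Lemma mu0 n : 0 < mu n. Proof. by rewrite divr_gt0 ?pow0. Qed.

Lemma mu_mono m n : (m <= n)%N -> mu m <= mu n.
Proof.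
move=> mn; rewrite -(subnKC mn); elim: (n - m)%N => [|k IH]; first by rewrite addn0.
apply: le_trans IH _; rewrite addnS; move: (m + k)%N => l.
rewrite /dyad_ratio ler_pdivrMr // mulrAC ler_pdivlMr // expnS natrM -mulrA mulrCA.
by rewrite ler_wpM2l ?(ltW (pow0 _)) // lamS.
Qed.

Lemma eq_blksum a b n : (forall i, (i < 2 ^ n)%N -> a (bs n i) = b (bs n i)) ->
  blksum a n = blksum b n.
Proof. by move=> ab; apply: eq_bigr => i _; rewrite ab. Qed.

Lemma blksumD a b n : blksum (fun j => a j + b j) n = blksum a n + blksum b n.
Proof. by rewrite /blksum big_split. Qed.

Lemma blksum_const (c : K) a n : (forall i, (i < 2 ^ n)%N -> a (bs n i) = c) ->
  blksum a n = (2 ^ n)%:R * c.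
Proof.
move=> ac; rewrite /blksum (eq_bigr (fun=> c)) => [|i _]; last by rewrite ac.
by rewrite sumr_const card_ord mulr_natl.
Qed.

Lemma rabs_blksum a n (t : R) : (forall i, (i < 2 ^ n)%N -> rabs (a (bs n i)) <= t) ->
  rabs (blksum a n) <= (2 ^ n)%:R * t.
Proof.
move=> at_; apply: le_trans (rabs_sum _ _ _) _.
have -> : (2 ^ n)%:R * t = \sum_(i < 2 ^ n) t by rewrite sumr_const card_ord mulr_natl.
by apply: ler_sum => i _; exact: at_.
Qed.

Lemma vfD a b n : vf (fun j => a j + b j) n = vf a n + vf b n.
Proof. by rewrite /vf blksumD mulrDr. Qed.

Lemma rabs_vf a n : rabs (vf a n) = lam n / (2 ^ n)%:R * rabs (blksum a n).
Proof. by rewrite /vf !rabsM rabsV rabs_nat rabs_emb gtr0_norm. Qed.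

Lemma rabs_vf_le a n (t : R) : (forall i, (i < 2 ^ n)%N -> rabs (a (bs n i)) <= t) ->
  rabs (vf a n) <= t * lam n.
Proof.
move=> /rabs_blksum h; rewrite rabs_vf mulrAC ler_pdivrMr ?pow0 //.
by apply: le_trans (ler_wpM2l (ltW (lam0 n)) h) _; lra.
Qed.

Lemma avgE a j : avg a j = vf a (blk j) / emb F (lam (blk j)).
Proof.
have l0 : emb F (lam (blk j)) != 0 by rewrite -(emb0 R F) (inj_eq (@emb_inj R F)) gt_eqF.
have := nat_neq0 R F (blk j); rewrite /avg /vf => p0.
by rewrite -[X in X / _]mulrA [X in X / _]mulrC mulfK.
Qed.

Lemma rabs_avg a j : rabs (avg a j) = rabs (vf a (blk j)) / lam (blk j).
Proof. by rewrite avgE rabsM rabsV rabs_emb gtr0_norm. Qed.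

Lemma avgD a b j : avg (fun j => a j + b j) j = avg a j + avg b j.
Proof. by rewrite /avg blksumD mulrDr. Qed.

Lemma QfD a b : Qf (fun j => a j + b j) = (fun j => Qf a j + Qf b j).
Proof. by apply: funext => j; rewrite /Qf avgD opprD addrACA. Qed.

Lemma Qf_const a : (forall i j, blk i = blk j -> a i = a j) -> Qf a = fun=> 0.
Proof.
move=> ac; apply: funext => j; rewrite /Qf /avg.
rewrite (@blksum_const (a j)) => [|i ilt]; last by apply: ac; rewrite blk_bs.
by rewrite mulKf ?nat_neq0 // subrr.
Qed.

Lemma avg_Qf a : avg (Qf a) = fun=> 0.
Proof.
apply: funext => j; rewrite /avg; suff -> : blksum (Qf a) (blk j) = 0 by rewrite mulr0.
rewrite /blksum /Qf sumrB; apply/eqP; rewrite subr_eq0; apply/eqP.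
rewrite -/(blksum a _) -/(blksum (avg a) _).
rewrite [RHS](@blksum_const ((2 ^ blk j)%:R^-1 * blksum a (blk j))) => [|i h']; last by rewrite avg_bs.
by rewrite mulVKf ?nat_neq0.
Qed.

Lemma Qf_Qf a : Qf (Qf a) = Qf a.
Proof. by apply: funext => j; rewrite {1}/Qf avg_Qf subr0. Qed.

Section finite_level.
Context (N : nat).
Local Notation M := (2 ^ N).-1.
Local Notation ns a := (rnorm (lin e a M)).

Lemma block_le a n : (n < N)%N -> rnorm (lin e (fun i => a (bs n i)) (2 ^ n)) <= ns a.
Proof.
move=> nN; rewrite -(@subsym_spread _ _ _ _ ss _ _ (bs n)) => [|i j]; last by rewrite /bs; lia.
have -> : lin (e \o bs n) (fun i => a (bs n i)) (2 ^ n) = lin e (ind (fun j => blk j == n) a) M.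
  rewrite lin_blocks (bigD1 (Ordinal nN)) //= [X in _ + X]big1 ?addr0 => [|m].
    by apply: eq_bigr => i _; rewrite /ind blk_bs //= eqxx.
  rewrite -val_eqE /= => mn; rewrite big1 // => i _.
  by rewrite /ind blk_bs // (negbTE mn) scale0r.
exact: subsym_ind.
Qed.

Lemma vf_le a n : (n < N)%N -> rabs (vf a n) <= 2 * ns a.
Proof.
move=> nN; rewrite rabs_vf mulrAC ler_pdivrMr ?pow0 // mulrC.
have := subsym_sum ss (2 ^ n) (fun i => a (bs n i)).
have := block_le a nN; have := pow0 n.
rewrite -/(lam n) -/(blksum a n); move: (2 ^ n)%:R => p p0 h1 h2.
apply: le_trans h2 _; rewrite -mulrA -[leRHS]mulrA ler_pM2l // [leRHS]mulrC.
by rewrite ler_pM2l.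
Qed.

Lemma ns_avg a : ns (avg a) <= 2 * ns a.
Proof. exact: rnorm_avg. Qed.

Lemma ns_Qf a : ns (Qf a) <= 3 * ns a.
Proof. by rewrite linB; apply: le_trans (rnorm_triB _ _) _; have := ns_avg a; lra. Qed.

Lemma nsD a b : ns (fun j => a j + b j) <= ns a + ns b.
Proof. by rewrite linD rnormD. Qed.

(** [beta] stands for a multiple of the norm of [a]. *)
Section bounded.
Context (a : nat -> K) (beta : R).
Hypotheses (Qa : ns (Qf a) <= beta) (va : forall n, (n < N)%N -> rabs (vf a n) <= beta).

Lemma beta_ge0 : 0 <= beta.
Proof. exact: le_trans (rnorm_ge0 _) Qa. Qed.

Lemma split_avg B : ind B a = (fun j => ind B (Qf a) j + ind B (avg a) j).
Proof. by apply: funext => j; rewrite /ind /Qf; case: (B j); rewrite ?subrK ?addr0. Qed.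

Lemma Cz_ge0 : 0 <= Cz. Proof. exact: le_trans (rnorm_ge0 _) (z1 0%N). Qed.

Lemma rabs_avg_le j : (j < M)%N -> rabs (avg a j) * lam (blk j) <= beta.
Proof. by rewrite blk_lt => jN; rewrite rabs_avg divfK ?gt_eqF // va. Qed.

(** Since [lam] is nondecreasing, the blocks with [t * lam n <= 2 * beta] come
    first.  On the late ones the averages, which are at most [beta / lam n], lie
    below [t / 2]. *)
Lemma early_late (t : R) : 0 < t -> exists n1, [/\ (n1 <= N)%N,
  forall n, (n < n1)%N -> t * lam n <= 2 * beta &
  forall n, (n1 <= n < N)%N -> 2 * beta < t * lam n].
Proof.
move=> t0; have [ex|ne] := pselect (exists n, (n < N)%N && (2 * beta < t * lam n)).
  have [n1 /andP[n1N l1] mn] := ex_minnP ex.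
  exists n1; split=> [|m mn1|m /andP[mn1 mN]]; first exact: ltnW.
    rewrite leNgt; apply/negP => lt; have := mn m; rewrite (ltn_trans mn1 n1N) lt => /(_ isT).
    by lia.
  by apply: lt_le_trans l1 _; rewrite ler_wpM2l ?lam_mono // ltW.
exists N; split=> // n nN; last by lia.
by rewrite leNgt; apply/negP => lt; apply: ne; exists n; rewrite nN.
Qed.

(** The early blocks together are at most twice as long as the last of them. *)
Lemma early_Lam (t : R) n1 : 0 < t -> (forall n, (n < n1)%N -> t * lam n <= 2 * beta) ->
  t * Lam (2 ^ n1).-1 <= 4 * beta.
Proof.
move=> t0; case: n1 => [_|n1 H].
  by rewrite expn0 /= /ones_norm big_ord0 rnorm0 mulr0 mulr_ge0 // beta_ge0.
have h : Lam (2 ^ n1.+1).-1 <= 2 * lam n1.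
  by apply: le_trans (lamS n1); apply: (Lam_mono ss); lia.
have := H n1 (ltnSn _); have := ler_wpM2l (ltW t0) h; lra.
Qed.

Lemma early_ns (t : R) n1 b : 0 < t -> (n1 <= N)%N ->
  (forall n, (n < n1)%N -> t * lam n <= 2 * beta) ->
  (forall j, (j < M)%N -> rabs (b j) <= if (blk j < n1)%N then t else 0) ->
  ns b <= 8 * beta.
Proof.
move=> t0 n1N H bt.
have := early_Lam t0 H; rewrite LamE -{1}(gtr0_norm t0) -(@rabs_emb R F) -rnormZ -linZ.
have n1M : ((2 ^ n1).-1 <= M)%N.
  by have : (2 ^ n1 <= 2 ^ N)%N by [rewrite leq_exp2l]; lia.
rewrite -(lin_trunc e _ n1M) => h.
apply: (@le_trans _ _ (2 * (4 * beta))); last by lra.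
apply: le_trans (_ : 2 * rnorm (lin e _ M) <= _); last by rewrite ler_pM2l //; exact: h.
apply: (subsym_dom ss) => j jM; have := bt j jM; rewrite blk_lt.
by case: ifP => _; rewrite ?mulr1 ?rabs0 // rabs_emb gtr0_norm.
Qed.

(** On the averaged part of [a], restricted to a greedy set [G], three cases
    occur.  On late blocks ([g1]) and, off [G], on early blocks with large
    averages ([g2]), the average is dominated by [Qf a], because the threshold
    [t] separates the size of [a] from that of its average; passing from [G] to
    its complement on a whole block is free, as [Qf] kills block constants.  On
    the remaining early blocks ([g3]) everything is at most [2 * t]. *)
Lemma greedy_Q G (t : R) : 0 < t ->
  (forall j, (j < M)%N -> G j -> t <= rabs (a j)) ->
  (forall j, (j < M)%N -> ~~ G j -> rabs (a j) <= t) ->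
  ns (Qf (ind G a)) <= 69 * beta.
Proof.
move=> t0 tG Gt; have [n1 [n1N early late]] := early_late t0; have b0 := beta_ge0.
have QaE j : a j = Qf a j + avg a j by rewrite /Qf subrK.
pose L j := (n1 <= blk j)%N.
pose H j := ~~ L j && (2 * t <= rabs (avg a j)).
pose W j := ~~ L j && ~~ (2 * t <= rabs (avg a j)).
have Hblk i j : blk i = blk j -> H i = H j by rewrite /H /L !rabs_avg => ->.
pose g1 := ind (fun j => G j && L j) (avg a).
pose g2 := ind (fun j => ~~ G j && H j) (avg a).
pose g3 := ind (fun j => G j && W j) (avg a).
have gE : ind G a = fun j => ind G (Qf a) j + (g1 j + (ind H (avg a) j + (- 1 * g2 j + g3 j))).
  rewrite split_avg; apply: funext => j; congr (_ + _).
  rewrite /g1 /g2 /g3 /ind /W /H.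
  case: (G j); case: (L j) => /=; case: (2 * t <= _);
    by rewrite ?mulr0 ?mulN1r ?addr0 ?add0r ?subrr.
have QH : Qf (ind H (avg a)) = fun=> 0.
  by apply: Qf_const => i j ij; rewrite /ind (Hblk i j ij) /avg ij.
have QN b : ns (Qf (fun j => - 1 * b j)) = ns (Qf b).
  have -> : Qf (fun j => - 1 * b j) = fun j => - 1 * Qf b j.
    by apply: funext => j; rewrite /Qf /avg /blksum -mulr_sumr mulrBr mulrCA.
  by rewrite linZ rnormZ rabsN rabs1 mul1r.
(* 69 = 3 + 6 + 12 + 48, the bounds for the four nonzero terms of [gE] *)
rewrite gE !QfD QH.
apply: le_trans (nsD _ _) _; apply: le_trans (lerD (lexx _) (nsD _ _)) _.
apply: le_trans (lerD (lexx _) (lerD (lexx _) (nsD _ _))) _.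
apply: le_trans (lerD (lexx _) (lerD (lexx _) (lerD (lexx _) (nsD _ _)))) _.
rewrite lin_zero rnorm0 add0r QN.
have h0 : ns (Qf (ind G (Qf a))) <= 3 * beta.
  apply: le_trans (ns_Qf _) _; rewrite ler_pM2l //; apply: le_trans Qa; exact: subsym_ind.
have h1 : ns (Qf g1) <= 6 * beta.
  apply: le_trans (ns_Qf _) _; suff : ns g1 <= 2 * ns (Qf a) by move: Qa; lra.
  apply: (subsym_dom ss) => j jM; rewrite /g1 /ind.
  case: ifP => [/andP[Gj Lj]|_]; last by rewrite rabs0 rabs_ge0.
  have jN : (blk j < N)%N by rewrite -blk_lt.
  have := late (blk j); rewrite jN andbT => /(_ Lj) lt.
  have := rabs_avg_le jM; have := tG j jM Gj; have := rabsD (Qf a j) (avg a j).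
  rewrite -QaE => i1 i2 i3.
  have : 2 * rabs (avg a j) <= t.
    by rewrite -(ler_pM2r (lam0 (blk j))) -mulrA; lra.
  lra.
have h2 : ns (Qf g2) <= 12 * beta.
  apply: le_trans (ns_Qf _) _.
  suff : ns g2 <= 2 * ns (fun j => 2 * Qf a j) by rewrite linZ rnormZ rabs_nat; move: Qa; lra.
  apply: (subsym_dom ss) => j jM; rewrite /g2 /ind rabsM rabs_nat.
  case: ifP => [/andP[Gj /andP[_ Hj]]|_]; last by rewrite rabs0 mulr_ge0 ?rabs_ge0.
  have := Gt j jM Gj; have := rabsD (a j) (- Qf a j); rewrite rabsN.
  have -> : a j - Qf a j = avg a j by rewrite /Qf opprB addrCA subrr addr0.
  lra.
have h3 : ns (Qf g3) <= 48 * beta.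
  apply: le_trans (ns_Qf _) _.
  suff : ns (fun j => 2^-1 * g3 j) <= 8 * beta.
    by rewrite linZ rnormZ rabsV rabs_nat => h; have := h; lra.
  apply: (early_ns t0 n1N early) => j jM; rewrite /g3 /ind rabsM rabsV rabs_nat.
  case: ifP => [/andP[Gj /andP[Lj]]|_]; last first.
    by rewrite rabs0 mulr0; case: ifP => // _; exact: ltW.
  by rewrite /L -ltnNge in Lj; rewrite Lj -ltNge; lra.
lra.
Qed.


Hypothesis (za : forall m, (m <= N)%N -> rnorm (lin z (vf a) m) <= beta).

Lemma rnorm_lin_z (b : nat -> K) n : rnorm (lin z b n) <= Cz * \sum_(i < n) rabs (b i).
Proof.
apply: le_trans (rnorm_sum _ _ _) _; rewrite mulr_sumr; apply: ler_sum => i _.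
by rewrite rnormZ mulrC ler_wpM2r ?rabs_ge0.
Qed.

(** On a late block [a] is dominated on [G] by [Qf a], an element of the
    subsymmetric part, so that [G] meets the block in a set of the order of
    [2 ^ n1] indices; the sum functional on so few indices is small. *)
Lemma vf_ind_late G (t : R) n1 n : 0 < t -> (n1 <= n < N)%N ->
  (forall m, (n1 <= m < N)%N -> 2 * beta < t * lam m) ->
  (forall j, (j < M)%N -> G j -> t <= rabs (a j)) ->
  rabs (vf (ind G a) n) <= 8 * 4 ^+ r * beta * mu n1 / mu n.
Proof.
move=> t0 /andP[n1n nN] late tG; have b0 := beta_ge0.
have bsM i : (i < 2 ^ n)%N -> (bs n i < M)%N by move=> h; rewrite blk_lt blk_bs.
pose B i := G (bs n i); pose a' i := a (bs n i); pose q i := Qf a (bs n i).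
have dom i : (i < 2 ^ n)%N -> B i -> rabs (a' i) <= 2 * rabs (q i).
  move=> h Bi; have := late n; rewrite n1n nN => /(_ isT) lt.
  have := rabs_avg_le (bsM i h); have := tG _ (bsM i h) Bi; have := rabsD (q i) (avg a (bs n i)).
  rewrite /q /Qf subrK /a' blk_bs // => i1 i2 i3.
  have : 2 * rabs (avg a (bs n i)) <= t by rewrite -(ler_pM2r (lam0 n)) -mulrA; lra.
  by rewrite /Qf in i1; lra.
have nB : rnorm (lin e (ind B a') (2 ^ n)) <= 4 * beta.
  apply: (@le_trans _ _ (2 * rnorm (lin e (fun i => 2 * q i) (2 ^ n)))).
    apply: (subsym_dom ss) => i h; rewrite /ind rabsM rabs_nat.
    by case: ifPn => [Bi|_]; rewrite ?dom // rabs0 mulr_ge0 ?rabs_ge0.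
  by rewrite linZ rnormZ rabs_nat; have := block_le (Qf a) nN; move: Qa; rewrite -/q; lra.
have cB : t * Lam (count B (iota 0 (2 ^ n))) <= 8 * beta.
  have -> : count B (iota 0 (2 ^ n)) = count (fun i => B i) (iota 0 (2 ^ n)) by [].
  have h : forall i, (i < 2 ^ n)%N -> B i -> t <= rabs (ind B a' i).
    by move=> i h Bi; rewrite /ind Bi; apply: tG => //; exact: bsM.
  by have := Lam_count_le ss (ltW t0) h; lra.
have lr : 4 * lam n1 <= lam (n1 + 2 * r).
  have := lamD n1; have := lamD (n1 + r); rewrite -addnA addnn -mul2n; lra.
have cnt : (count B (iota 0 (2 ^ n)) <= 2 ^ (n1 + 2 * r))%N.
  rewrite leqNgt; apply/negP => /ltnW /(Lam_mono ss) h.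
  have := late n1; rewrite leqnn (leq_ltn_trans n1n nN) => /(_ isT) lt.
  have h2 : 4 * lam n1 <= Lam (count B (iota 0 (2 ^ n))) by apply: le_trans lr h.
  by have := ler_wpM2l (ltW t0) h2; lra.
have := subsym_sum_count ss a' cnt.
have -> : \sum_(j < 2 ^ n) ind B a' j = blksum (ind G a) n by [].
rewrite -/(lam _) => h.
have {}h : rabs (blksum (ind G a) n) <= 8 * beta * mu (n1 + 2 * r).
  rewrite /dyad_ratio mulrA ler_pdivlMr //; apply: le_trans h _.
  rewrite -mulrA [leRHS]mulrC; have := ler_wpM2l (ltW (pow0 (n1 + 2 * r))) nB; lra.
have mur : mu (n1 + 2 * r) <= 4 ^+ r * mu n1.
  have e4 : (2 ^ (n1 + 2 * r))%:R = 4 ^+ r * (2 ^ n1)%:R :> R.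
    by rewrite expnD natrM expnM (natrX _ (2 ^ 2)) mulrC.
  rewrite /dyad_ratio ler_pdivrMr // e4 -!mulrA.
  rewrite ler_wpM2l ?exprn_ge0 // ler_peMr ?ler0n // mulrC.
  by rewrite ler_pdivlMr // mul1r lam_mono // leq_addr.
have -> : rabs (vf (ind G a) n) = rabs (blksum (ind G a) n) / mu n.
  by rewrite rabs_vf /dyad_ratio invf_div mulrC.
rewrite ler_pM2r ?invr_gt0 ?mu0 //; apply: le_trans h _.
by have := ler_wpM2l b0 mur; lra.
Qed.

(** On early blocks the functionals see [a] up to an error of [t * lam n], and
    these errors form a geometric sum; the late blocks give a geometric tail. *)
Lemma greedy_v G (t : R) : 0 < t ->
  (forall j, (j < M)%N -> G j -> t <= rabs (a j)) ->
  (forall j, (j < M)%N -> ~~ G j -> rabs (a j) <= t) ->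
  rnorm (lin z (vf (ind G a)) N) <= beta + Cz * (4 * r%:R + 16 * r%:R * 4 ^+ r) * beta.
Proof.
move=> t0 tG Gt; have [n1 [n1N early late]] := early_late t0; have b0 := beta_ge0.
have C0 := Cz_ge0.
have -> : lin z (vf (ind G a)) N = lin z (vf (ind G a)) n1 +
    \sum_(i < N - n1) vf (ind G a) (n1 + i)%N *: z (n1 + i)%N.
  by rewrite -lin_split subnKC.
apply: le_trans (rnormD _ _) _.
have h1 : rnorm (lin z (vf (ind G a)) n1) <= beta + Cz * (4 * r%:R * beta).
  have -> : lin z (vf (ind G a)) n1 = lin z (vf a) n1 - lin z (vf (ind (predC G) a)) n1.
    rewrite -linB; apply: eq_lin => n _; apply/eqP; rewrite eq_sym subr_eq -vfD; apply/eqP.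
    congr (_ * _); apply: eq_blksum => i _; rewrite /ind /=.
    by case: (G _); rewrite ?addr0 ?add0r.
  apply: le_trans (rnorm_triB _ _) _; apply: lerD; first exact: za.
  apply: le_trans (rnorm_lin_z _ _) _; rewrite ler_wpM2l //.
  case: n1 n1N early {late} => [|m] mN early; first by rewrite big_ord0 mulr_ge0 // mulr_ge0.
  apply: (@le_trans _ _ (\sum_(i < m.+1) t * lam i)).
    apply: ler_sum => n _; apply: rabs_vf_le => i h; rewrite /ind /=.
    case: ifP => Gj; last by rewrite rabs0 ltW.
    by apply: Gt => //; rewrite blk_lt blk_bs //; apply: leq_trans (ltn_ord n) mN.
  rewrite -mulr_sumr.
  have := doubling_sum lam0 lam_mono r0 lamD m => h.
  apply: le_trans (ler_wpM2l (ltW t0) h) _.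
  have rr : 0 <= 2 * r%:R :> R by rewrite mulr_ge0.
  by have := ler_wpM2l rr (early m (ltnSn m)); lra.
have h2 : rnorm (\sum_(i < N - n1) vf (ind G a) (n1 + i)%N *: z (n1 + i)%N) <=
    Cz * (16 * r%:R * 4 ^+ r * beta).
  apply: le_trans (rnorm_sum _ _ _) _.
  apply: (@le_trans _ _ (Cz * \sum_(i < N - n1) 8 * 4 ^+ r * beta * mu n1 * (mu (n1 + i)%N)^-1)).
    rewrite mulr_sumr; apply: ler_sum => i _; rewrite rnormZ mulrC.
    apply: ler_pM; rewrite ?rnorm_ge0 ?rabs_ge0 //.
    by apply: (vf_ind_late t0) => //; have := ltn_ord i; lia.
  rewrite ler_wpM2l // -mulr_sumr.
  have := doubling_sumV mu0 mu_mono r0 muD n1 (N - n1) => h.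
  have c0 : 0 <= 8 * 4 ^+ r * beta * mu n1.
    by apply: mulr_ge0; [rewrite !mulr_ge0 // exprn_ge0 | exact: ltW (mu0 n1)].
  apply: le_trans (ler_wpM2l c0 h) _.
  rewrite le_eqVlt; apply/orP; left; apply/eqP; field.
  exact: lt0r_neq0 (mu0 n1).
by apply: le_trans (lerD h1 h2) _; lra.
Qed.

(** A coefficient of size at least [t] is at least [t / 2] in [Qf a] or in the
    averages; in the second case it lies in an early block. *)
Lemma democratic_lower B (t : R) : 0 < t ->
  (forall j, (j < M)%N -> B j -> t <= rabs (a j)) ->
  t * Lam (count B (iota 0 M)) <= 8 * beta.
Proof.
move=> t0 tB; have [n1 [n1N early late]] := early_late t0; have b0 := beta_ge0.
pose B1 j := B j && (t / 2 <= rabs (Qf a j)).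
pose B2 j := B j && ~~ (t / 2 <= rabs (Qf a j)).
have cB : count B (iota 0 M) = (count B1 (iota 0 M) + count B2 (iota 0 M))%N.
  rewrite /B1 /B2; elim: (iota 0 M) => //= j l ->.
  by case: (B j); case: (t / 2 <= _) => /=; lia.
have h1 : t / 2 * Lam (count B1 (iota 0 M)) <= 2 * beta.
  apply: le_trans (_ : 2 * ns (Qf a) <= _); last by rewrite ler_pM2l.
  by apply: (Lam_count_le ss) => [|j jM /andP[]//]; rewrite ltW // divr_gt0.
have h2 : t * Lam (count B2 (iota 0 M)) <= 4 * beta.
  apply: le_trans (early_Lam t0 early); rewrite ler_pM2l // -(Lam_count ss) LamE.
  have n1M : ((2 ^ n1).-1 <= M)%N.
    by have : (2 ^ n1 <= 2 ^ N)%N by [rewrite leq_exp2l]; lia.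
  rewrite -(lin_trunc e _ n1M); apply: le_trans (subsym_ind ss _ _ B2).
  rewrite le_eqVlt; apply/orP; left; apply/eqP; congr rnorm; apply: eq_lin => j jM.
  rewrite /ind blk_lt; case: ifP => // /andP[Bj]; case: ltnP => // Lj.
  rewrite -ltNge => Qj; have jN : (blk j < N)%N by rewrite -blk_lt.
  have := late (blk j); rewrite jN andbT => /(_ Lj) lt.
  have := rabs_avg_le jM; have := tB j jM Bj; have := rabsD (Qf a j) (avg a j).
  have -> : Qf a j + avg a j = a j by rewrite /Qf subrK.
  move=> i1 i2 i3; have : 2 * rabs (avg a j) <= t.
    by rewrite -(ler_pM2r (lam0 (blk j))) -mulrA; lra.
  by move=> i4; exfalso; lra.
rewrite cB; have := ler_wpM2l (ltW t0) (Lam_add ss (count B1 (iota 0 M)) (count B2 (iota 0 M))).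
lra.
Qed.

(** Each of the two parts of [ind A a] costs at most [beta] per block. *)
Lemma vf_ind_le A n : (n < N)%N -> rabs (vf (ind A a) n) <= 3 * beta.
Proof.
move=> nN; have b0 := beta_ge0; rewrite split_avg vfD; apply: le_trans (rabsD _ _) _.
have h1 : rabs (vf (ind A (Qf a)) n) <= 2 * beta.
  apply: le_trans (vf_le _ nN) _; rewrite ler_pM2l //; apply: le_trans Qa; exact: subsym_ind.
have h2 : rabs (vf (ind A (avg a)) n) <= beta / lam n * lam n.
  apply: rabs_vf_le => i h; rewrite /ind; case: ifP => _; last by rewrite rabs0 divr_ge0 // ltW.
  by rewrite rabs_avg blk_bs // ler_pM2r ?invr_gt0 // va.
by rewrite divfK ?gt_eqF // in h2; lra.
Qed.

Lemma ns_avg_block n B : (n < N)%N -> ns (ind B (ind (fun j => blk j == n) (avg a))) <= beta.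
Proof.
move=> nN; apply: le_trans (subsym_ind ss _ _ _) _.
have -> : lin e (ind (fun j => blk j == n) (avg a)) M =
    (vf a n / emb F (lam n)) *: \sum_(i < 2 ^ n) e (bs n i).
  rewrite lin_blocks (bigD1 (Ordinal nN)) //= [X in _ + X]big1 ?addr0 => [|m].
    rewrite scaler_sumr; apply: eq_bigr => i _.
    by rewrite /ind blk_bs //= eqxx avgE blk_bs.
  rewrite -val_eqE /= => mn; rewrite big1 // => i _.
  by rewrite /ind blk_bs // (negbTE mn) scale0r.
rewrite rnormZ rabsM rabsV rabs_emb gtr0_norm // /bs (Lam_shift ss) -/(lam n).
by rewrite divfK ?gt_eqF // va.
Qed.

Lemma ns_ind_avg A : ns (ind A (avg a)) <= N%:R * beta.
Proof.
have -> : lin e (ind A (avg a)) M = \sum_(n < N) lin e (ind A (ind (fun j => blk j == n) (avg a))) M.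
  rewrite /lin exchange_big /=; apply: eq_bigr => j _; rewrite -scaler_suml; congr (_ *: _).
  have jN : (blk j < N)%N by rewrite -blk_lt.
  rewrite (bigD1 (Ordinal jN)) //= big1 ?addr0 => [|m]; first by rewrite /ind eqxx; case: (A j).
  by rewrite -val_eqE /= eq_sym /ind => /negbTE->; case: (A j).
apply: le_trans (rnorm_sum _ _ _) _.
rewrite -[N in N%:R * _]card_ord -sumr_const mulr_suml; apply: ler_sum => n _.
by rewrite mul1r ns_avg_block.
Qed.

Lemma conditional_bound A : (0 < N)%N ->
  ns (Qf (ind A a)) <= 6 * N%:R * beta /\ rnorm (lin z (vf (ind A a)) N) <= 3 * Cz * N%:R * beta.
Proof.
move=> N0; have b0 := beta_ge0; have N1 : 1 <= N%:R :> R by rewrite ler1n.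
split.
  apply: le_trans (ns_Qf _) _; rewrite split_avg.
  have h1 := nsD (ind A (Qf a)) (ind A (avg a)).
  have h2 : ns (ind A (Qf a)) <= beta by apply: le_trans Qa; exact: subsym_ind.
  have := ns_ind_avg A; have := ler_wpM2r b0 N1; lra.
apply: le_trans (rnorm_lin_z _ _) _.
have h : \sum_(i < N) rabs (vf (ind A a) i) <= N%:R * (3 * beta).
  rewrite -[N in N%:R * _]card_ord -sumr_const mulr_suml; apply: ler_sum => n _.
  by rewrite mul1r vf_ind_le.
by apply: le_trans (ler_wpM2l Cz_ge0 h) _; lra.
Qed.

(** Cutting at [m] leaves all blocks intact but the one containing [m], and a
    single block is harmless. *)
Lemma initial_bound m : (m < M)%N ->
  ns (Qf (ind (fun j => j < m)%N a)) <= 6 * beta /\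
  rnorm (lin z (vf (ind (fun j => j < m)%N a)) N) <= (1 + 3 * Cz) * beta.
Proof.
move=> mM; have b0 := beta_ge0; have C0 := Cz_ge0.
set B := (fun j => j < m)%N; set n0 := blk m.
have n0N : (n0 < N)%N by rewrite /n0 -blk_lt.
have blkB j : (blk j < n0)%N -> B j.
  by rewrite /B ltnNge => h; rewrite ltnNge; apply: contra h => mj; apply: leq_trunc_log; lia.
have blkNB j : (n0 < blk j)%N -> ~~ B j.
  by rewrite /B ltnNge => h; apply: contra h => mj; apply: leq_trunc_log; lia.
split.
  pose c := ind (fun j => blk j < n0)%N (avg a).
  have -> : ind B a = fun j => ind B (Qf a) j + (c j + ind B (ind (fun j => blk j == n0) (avg a)) j).
    rewrite split_avg; apply: funext => j; congr (_ + _); rewrite /c /ind.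
    by have [/blkB->|/blkNB/negbTE->|_] := ltngtP (blk j) n0; rewrite ?addr0 ?add0r.
  have Qc : Qf c = fun=> 0 by apply: Qf_const => i j ij; rewrite /c /ind /avg ij.
  rewrite !QfD Qc; apply: le_trans (nsD _ _) _; apply: le_trans (lerD (lexx _) (nsD _ _)) _.
  rewrite lin_zero rnorm0 add0r.
  have h1 := ns_Qf (ind B (Qf a)).
  have h2 : ns (ind B (Qf a)) <= beta by apply: le_trans Qa; exact: subsym_ind.
  have h3 := ns_Qf (ind B (ind (fun j => blk j == n0) (avg a))).
  have h4 := ns_avg_block B n0N; lra.
have -> : lin z (vf (ind B a)) N = lin z (vf a) n0 + vf (ind B a) n0 *: z n0.
  rewrite (@lin_supp _ _ _ _ _ n0.+1) // => [|n n0n]; last first.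
    rewrite /vf (@blksum_const 0) ?mulr0 // => i h.
    by rewrite /ind (negbTE (blkNB _ _)) // blk_bs.
  rewrite linS; congr (_ + _); apply: eq_lin => n nn0; congr (_ * _); apply: eq_blksum => i h.
  by rewrite /ind blkB // blk_bs.
apply: le_trans (rnormD _ _) _; rewrite mulrDl mul1r; apply: lerD; first by apply: za; exact: ltnW.
rewrite rnormZ [3 * Cz]mulrC -mulrA [leRHS]mulrC; apply: ler_pM; rewrite ?rabs_ge0 ?rnorm_ge0 //.
exact: vf_ind_le.
Qed.

End bounded.

(** The block functionals at such an [a] are at most [t * min(lam n, k / mu n)],
    where [k] is the number of indices in [B]; the two bounds are summed over the
    blocks shorter and longer than [k]. *)
Lemma democratic_upper a B (t : R) : 0 <= t ->
  (forall j, (j < M)%N -> rabs (a j) <= if B j then t else 0) ->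
  ns (Qf a) <= 6 * t * Lam (count B (iota 0 M)) /\
  rnorm (lin z (vf a) N) <= Cz * (6 * r%:R) * t * Lam (count B (iota 0 M)).
Proof.
move=> t0 aB; set k := count B (iota 0 M); split.
  by apply: le_trans (ns_Qf _) _; have := le_Lam_count ss t0 aB; rewrite -/k; lra.
apply: le_trans (rnorm_lin_z _ _) _; rewrite -!mulrA ler_wpM2l ?Cz_ge0 //.
have bsM n i : (n < N)%N -> (i < 2 ^ n)%N -> (bs n i < M)%N by move=> nN h; rewrite blk_lt blk_bs.
have small n : (n < N)%N -> rabs (vf a n) <= t * lam n.
  move=> nN; apply: rabs_vf_le => i h; apply: le_trans (aB _ (bsM n i nN h)) _.
  by case: ifP.
have large n : (n < N)%N -> rabs (vf a n) <= t * (k%:R / mu n).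
  move=> nN; rewrite rabs_vf /dyad_ratio invf_div mulrA [leRHS]mulrC ler_wpM2l ?divr_ge0 ?(ltW (lam0 n)) //.
  apply: le_trans (rabs_sum _ _ _) _.
  apply: (@le_trans _ _ (\sum_(j < M) rabs (a j))).
    rewrite (sum_blocks (fun j => rabs (a j))) (bigD1 (Ordinal nN)) //= lerDl.
    by apply: sumr_ge0 => l _; apply: sumr_ge0 => i _; exact: rabs_ge0.
  have -> : t * k%:R = \sum_(j < M) if B j then t else 0.
    rewrite -big_mkcond -(big_mkord B (fun=> t)) big_const_seq iter_addr_0 /index_iota subn0.
    by rewrite mulr_natr.
  by apply: ler_sum => j _; exact: aB.
have [k0|k0] := posnP k.
  rewrite big1 => [|n _]; first by rewrite !mulr_ge0 ?Lam_ge0.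
  by apply: le_anti; rewrite rabs_ge0 andbT; have := large n (ltn_ord n); rewrite k0 mul0r mulr0.
set m := trunc_log 2 k; have /andP[mk km] := trunc_log_bounds (ltnSn 1) k0.
rewrite -/m in mk km.
pose c n := if (n < m.+1)%N then t * lam n else t * (k%:R / mu n).
have c0 n : 0 <= c n.
  by rewrite /c; case: ifP => _; rewrite mulr_ge0 ?(ltW (lam0 _)) // divr_ge0 // ltW // mu0.
apply: (@le_trans _ _ (\sum_(n < m.+1 + N) c n)).
  apply: (@le_trans _ _ (\sum_(n < N) c n)).
    by apply: ler_sum => n _; rewrite /c; case: ifP => _; [exact: small | exact: large].
  by rewrite addnC big_split_ord /= lerDl sumr_ge0.
rewrite big_split_ord /=.
have h1 : \sum_(i < m.+1) c i <= t * (2 * r%:R * lam m).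
  rewrite (eq_bigr (fun i : 'I_m.+1 => t * lam i)) => [|i _]; last by rewrite /c ltn_ord.
  by rewrite -mulr_sumr ler_wpM2l // (doubling_sum lam0 lam_mono r0 lamD).
have h2 : \sum_(i < N) c (m.+1 + i)%N <= t * (4 * r%:R * lam m).
  rewrite (eq_bigr (fun i : 'I_N => t * k%:R * (mu (m.+1 + i)%N)^-1)) => [|i _]; last first.
    by rewrite /c ltnNge leq_addr /= mulrA.
  rewrite -mulr_sumr -mulrA ler_wpM2l //.
  apply: le_trans (ler_wpM2l (ler0n _ _) (doubling_sumV mu0 mu_mono r0 muD m.+1 N)) _.
  rewrite mulrCA /dyad_ratio invf_div -mulrA.
  have e1 : k%:R * (lam m.+1 / (2 ^ m.+1)%:R) <= 2 * lam m.
    apply: le_trans (lamS m); rewrite mulrCA ler_piMr ?(ltW (lam0 _)) //.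
    by rewrite ler_pdivrMr ?pow0 // mul1r ler_nat ltnW.
  by have := ler_wpM2l (ler0n R r) e1; lra.
have h3 : lam m <= Lam k by exact: (Lam_mono ss).
have tr : 0 <= t * r%:R by rewrite mulr_ge0.
by apply: le_trans (lerD h1 h2) _; have := ler_wpM2l tr h3; lra.
Qed.

End finite_level.
End dkk.

(** * The new basis *)

Ltac nonneg := repeat first [ assumption | exact: ler0n | exact: ler01 | exact: normr_ge0
  | exact: rnorm_ge0 | apply: exprn_ge0 | apply: addr_ge0 | apply: mulr_ge0 ].

Lemma le_pow_pred n : (n <= (2 ^ n).-1)%N.
Proof. by have := ltn_expl n (ltnSn 1); lia. Qed.

Lemma count_pred1 j M : (j < M)%N -> count (pred1 j) (iota 0 M) = 1%N.
Proof. by move=> jM; rewrite count_uniq_mem ?iota_uniq // mem_iota add0n jM. Qed.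

Section dkk_basis.
Context (R : realType) (F : scalar_kind).
Local Notation K := (scalars R F).
Context (S : completeNormedModType K) (e : nat -> S) (ss : subsym e).
Local Notation lam := (dyad_norm e).
Local Notation mu := (dyad_ratio e).
Local Notation Lam := (ones_norm e).
Hypothesis lam0 : forall n, 0 < lam n.
Context (r : nat).
Hypotheses (r0 : (0 < r)%N) (lamD : forall n, 2 * lam n <= lam (n + r))
  (muD : forall n, 2 * mu n <= mu (n + r)).
Context (X : completeNormedModType K) (E z : nat -> X) (Cz c1 C1 : R).
Hypotheses (z1 : forall n, rnorm (z n) <= Cz)
  (zcoef : forall b n N, (n < N)%N -> rabs (b n) <= Cz * rnorm (lin z b N))
  (zgru : grunblum z Cz).
Hypotheses (c10 : 0 < c1)
  (low : forall N a b, c1 * (rnorm (lin e (Qf a) (2 ^ N).-1) + rnorm (lin z b N)) <=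
     rnorm (lin E (Qf a) (2 ^ N).-1 + lin z b N))
  (upp : forall N a b, rnorm (lin E (Qf a) (2 ^ N).-1 + lin z b N) <=
     C1 * (rnorm (lin e (Qf a) (2 ^ N).-1) + rnorm (lin z b N))).
Implicit Types (a b : nat -> K) (B G : pred nat).
Local Notation vf := (dkk_coef e).

(** The vector of the [j]-th coordinate in the norm studied above: its first part
    is the image under [E] of [e_j] minus its block average, and the coefficient
    of [z] is the value at [e_j] of the block functional. *)
Definition dkk_basis j : X :=
  E j - (2 ^ blk j)%:R^-1 *: \sum_(i < 2 ^ blk j) E (bs (blk j) i)
  + (emb F (lam (blk j)) / (2 ^ blk j)%:R) *: z (blk j).
Local Notation y := dkk_basis.

Lemma dkk_lin a N : lin y a (2 ^ N).-1 = lin E (Qf a) (2 ^ N).-1 + lin z (vf a) N.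
Proof.
rewrite linB lin_avg !lin_blocks -sumrB [lin z _ _]/lin -big_split /=; apply: eq_bigr => n _.
set w := \sum_(i < 2 ^ n) E (bs n i).
rewrite (eq_bigr (fun i : 'I_(2 ^ n) => a (bs n i) *: E (bs n i) +
   (a (bs n i) *: (emb F (lam n) / (2 ^ n)%:R *: z n - (2 ^ n)%:R^-1 *: w)))) => [|i _]; last first.
  by rewrite -scalerDr /dkk_basis blk_bs // -/w -addrA [_ *: z n - _]addrC.
rewrite big_split /= -addrA; congr (_ + _); rewrite -scaler_suml -/(blksum a n).
by rewrite scalerBr !scalerA addrC /dkk_coef ![blksum a n * _]mulrC.
Qed.

Local Notation nY a N := (rnorm (lin y a (2 ^ N).-1)).

Lemma Cz0 : 0 <= Cz. Proof. exact: Cz_ge0 z1. Qed.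

Let K0 := (1 + Cz) / c1.

Lemma K0_ge0 : 0 <= K0.
Proof. by rewrite /K0 divr_ge0 ?addr_ge0 ?Cz0 // ltW. Qed.

Lemma dkk_bounds a N : [/\ rnorm (lin e (Qf a) (2 ^ N).-1) <= K0 * nY a N,
  forall n, (n < N)%N -> rabs (vf a n) <= K0 * nY a N &
  forall m, (m <= N)%N -> rnorm (lin z (vf a) m) <= K0 * nY a N].
Proof.
have := low N a (vf a); rewrite -dkk_lin => h.
set q := rnorm (lin e _ _) in h *; set w := rnorm (lin z _ N) in h *.
have q0 : 0 <= q := rnorm_ge0 _; have w0 : 0 <= w := rnorm_ge0 _; have C0 := Cz0.
have h' : (1 + Cz) * (q + w) <= K0 * nY a N.
  rewrite /K0 mulrAC ler_pdivlMr // -mulrA; apply: ler_wpM2l; first by rewrite addr_ge0.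
  by rewrite mulrC.
have Cq := mulr_ge0 C0 q0; have Cw := mulr_ge0 C0 w0.
split=> [|n nN|m mN]; apply: le_trans h'.
- lra.
- by apply: le_trans (zcoef _ nN) _; rewrite -/w; lra.
- by apply: le_trans (zgru _ mN) _; rewrite -/w; lra.
Qed.

Lemma dkk_upper a N (p q : R) : rnorm (lin e (Qf a) (2 ^ N).-1) <= p ->
  rnorm (lin z (vf a) N) <= q -> nY a N <= `|C1| * (p + q).
Proof.
move=> hp hq; rewrite dkk_lin; apply: le_trans (upp _ _ _) _.
apply: (@le_trans _ _ (`|C1| * (rnorm (lin e (Qf a) (2 ^ N).-1) + rnorm (lin z (vf a) N)))).
  by rewrite ler_wpM2r ?ler_norm // addr_ge0 ?rnorm_ge0.
by rewrite ler_wpM2l // lerD.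
Qed.

Lemma dkk_quasi_greedy : exists2 C : R, 1 <= C & forall N a G (t : R), 0 <= t ->
  (forall j, (j < (2 ^ N).-1)%N -> G j -> t <= rabs (a j)) ->
  (forall j, (j < (2 ^ N).-1)%N -> ~~ G j -> rabs (a j) <= t) ->
  nY (ind G a) N <= C * nY a N.
Proof.
pose D := `|C1| * (69 * K0 + (K0 + Cz * (4 * r%:R + 16 * r%:R * 4 ^+ r) * K0)).
have D0 : 0 <= D.
  by have := K0_ge0; have := Cz0; rewrite /D => ? ?; nonneg.
exists (1 + D) => [|N a G t]; first by rewrite lerDl.
rewrite le_eqVlt => /predU1P[<-|t0] tG Gt.
  have -> : lin y (ind G a) (2 ^ N).-1 = lin y a (2 ^ N).-1.
    apply: eq_lin => j jM; rewrite /ind; case: ifPn => // Gj.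
    by apply/esym/rabs0_eq0/le_anti; rewrite rabs_ge0 andbT Gt.
  by have := rnorm_ge0 (lin y a (2 ^ N).-1); nra.
have [Qa va za] := dkk_bounds a N.
have h1 := greedy_Q ss lam0 r0 Qa va t0 tG Gt.
have h2 := greedy_v ss lam0 r0 lamD muD z1 Qa va za t0 tG Gt.
apply: le_trans (dkk_upper h1 h2) _.
by have := rnorm_ge0 (lin y a (2 ^ N).-1); rewrite /D; lra.
Qed.

Lemma dkk_lower : exists2 C : R, 0 <= C & forall N a B (t : R), 0 <= t ->
  (forall j, (j < (2 ^ N).-1)%N -> B j -> t <= rabs (a j)) ->
  t * Lam (count B (iota 0 (2 ^ N).-1)) <= C * nY a N.
Proof.
exists (8 * K0) => [|N a B t]; first by rewrite mulr_ge0 ?K0_ge0.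
rewrite le_eqVlt => /predU1P[<- _|t0 tB].
  by rewrite mul0r; have := K0_ge0 => ?; nonneg.
have [Qa va za] := dkk_bounds a N.
by rewrite -mulrA; apply: (democratic_lower ss lam0 r0 Qa va t0 tB).
Qed.

Lemma dkk_democratic : exists2 C : R, 0 <= C & forall N a B (t : R), 0 <= t ->
  (forall j, (j < (2 ^ N).-1)%N -> rabs (a j) <= if B j then t else 0) ->
  nY a N <= C * (t * Lam (count B (iota 0 (2 ^ N).-1))).
Proof.
exists (`|C1| * (6 + Cz * (6 * r%:R))) => [|N a B t t0 aB].
  by have := Cz0 => ?; nonneg.
have [h1 h2] := democratic_upper ss lam0 r0 lamD muD z1 t0 aB.
by apply: le_trans (dkk_upper h1 h2) _; lra.
Qed.

Lemma dkk_conditional : exists2 C : R, 0 <= C & forall N a A, (0 < N)%N ->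
  nY (ind A a) N <= C * N%:R * nY a N.
Proof.
exists (`|C1| * (6 + 3 * Cz) * K0) => [|N a A N0].
  by have := K0_ge0; have := Cz0 => ? ?; nonneg.
have [Qa va za] := dkk_bounds a N.
have [h1 h2] := conditional_bound ss lam0 r0 z1 Qa va A N0.
by apply: le_trans (dkk_upper h1 h2) _; lra.
Qed.

Lemma dkk_grunblum : exists C : R, grunblum y C.
Proof.
pose D := `|C1| * (6 + (1 + 3 * Cz)) * K0.
have D0 : 0 <= D by have := K0_ge0; have := Cz0 => ? ?; nonneg.
exists (1 + D) => a m n mn.
pose a' j := if (j < n)%N then a j else 0; pose N := n.
have En : lin y a n = lin y a' (2 ^ N).-1 by rewrite (lin_trunc y a (le_pow_pred n)).
have Em : lin y a m = lin y (ind (fun j => j < m)%N a') (2 ^ N).-1.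
  rewrite -(lin_trunc y a (leq_trans mn (le_pow_pred n))); apply: eq_lin => j _.
  by rewrite /ind /a'; case: ltnP => // jm; rewrite (leq_trans jm mn).
rewrite {}En {}Em; have [Mm|mM] := leqP (2 ^ N).-1 m.
  have -> : lin y (ind (fun j => j < m)%N a') (2 ^ N).-1 = lin y a' (2 ^ N).-1.
    by apply: eq_lin => j jM; rewrite /ind (leq_trans jM Mm).
  by have := rnorm_ge0 (lin y a' (2 ^ N).-1); nra.
have [Qa va za] := dkk_bounds a' N.
have [h1 h2] := initial_bound ss lam0 r0 z1 Qa va za mM.
apply: le_trans (dkk_upper h1 h2) _.
by have := rnorm_ge0 (lin y a' (2 ^ N).-1); rewrite /D; lra.
Qed.

Lemma dkk_semi_normalized : semi_normalized y.
Proof.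
have [C C0 HC] := dkk_lower; have [D D0 HD] := dkk_democratic.
have L1 : 0 < Lam 1 := lam0 0.
exists (Lam 1 / (C + 1)), (D * Lam 1); split=> [|j].
  by rewrite divr_gt0 // ltr_wpDl.
have jM : (j < (2 ^ j.+1).-1)%N := le_pow_pred j.+1.
have E1 : y j = lin y (fun i => (i == j)%:R) (2 ^ j.+1).-1 by rewrite lin_delta.
have := HC j.+1 (fun i => (i == j)%:R) (pred1 j) 1 ler01.
have := HD j.+1 (fun i => (i == j)%:R) (pred1 j) 1 ler01.
rewrite -E1 (count_pred1 jM) !mul1r => h1 h2; apply/andP; split; last first.
  by apply: h1 => i _ /=; case: eqP => _; rewrite ?rabs1 ?rabs0.
rewrite ler_pdivrMr ?ltr_wpDl // mulrC.
have h3 : Lam 1 <= C * rnorm (y j) by apply: h2 => i _ /= ->; rewrite rabs1.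
by have := rnorm_ge0 (y j); lra.
Qed.

(** A combination which is constant on the blocks is seen by [z] only. *)
Lemma dkk_block_const (b : nat -> K) N :
  lin y (fun j => b (blk j) / emb F (lam (blk j))) (2 ^ N).-1 = lin z b N.
Proof.
rewrite dkk_lin Qf_const => [|i j ->//]; rewrite lin_zero add0r.
apply: eq_lin => n _; rewrite /dkk_coef (@blksum_const _ _ (b n / emb F (lam n))) => [|i h].
  have l0 : emb F (lam n) != 0 by rewrite -(emb0 R F) (inj_eq (@emb_inj R F)) gt_eqF.
  by rewrite mulrA divfK ?nat_neq0 // mulrC divfK.
by rewrite blk_bs.
Qed.

Lemma dkk_dense : (forall f (eps : R), 0 < eps -> exists N a b,
    rnorm (f - (lin E (Qf a) (2 ^ N).-1 + lin z b N)) < eps) -> dense_span y.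
Proof.
move=> H f eps /(H f)[N [a [b h]]].
exists (2 ^ N).-1, (fun j => Qf a j + b (blk j) / emb F (lam (blk j))).
rewrite linD dkk_block_const dkk_lin.
rewrite Qf_Qf.
suff -> : lin z (vf (Qf a)) N = 0 by rewrite addr0.
rewrite -(lin_zero z N); apply: eq_lin => n _; rewrite /dkk_coef.
have := congr1 (fun f => f (bs n 0)) (avg_Qf a); rewrite avg_bs ?expn_gt0 // => /eqP.
by rewrite mulf_eq0 invr_eq0 (negbTE (nat_neq0 R F n)) /= => /eqP->; rewrite mulr0.
Qed.

End dkk_basis.

(** * Almost greediness, fundamental function and conditionality *)

Section projections.
Context (R : realType) (F : scalar_kind).
Local Notation K := (scalars R F).
Context (X : completeNormedModType K) (y : nat -> X).
Implicit Types (a : nat -> K) (f : X).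

Lemma proj_lin f (A : set nat) n :
  (forall j, (n <= j)%N -> j \in A -> coord y f j = 0) ->
  proj y A f = lin y (ind (fun j => j \in A) (coord y f)) n.
Proof.
move=> A0; set c := ind _ _.
have c0 j : (n <= j)%N -> c j = 0 by rewrite /c /ind => nj; case: ifP => // /(A0 _ nj).
rewrite /proj; apply: cvg_lim; first exact: norm_hausdorff.
have : expansion y (lin y c n) c by exact: expansion_lin.
rewrite /expansion.
suff -> : (fun j => if j \in A then coord y f j *: y j else 0) = (fun j => c j *: y j) by [].
by apply: funext => j; rewrite /c /ind; case: ifP; rewrite ?scale0r.
Qed.

Lemma mem_fset_set (G : {fset nat}) j : (j \in [set` G]) = (j \in G).
Proof. by apply/idP/idP; rewrite inE. Qed.

Lemma proj_fset f (G : {fset nat}) n : (forall j, j \in G -> (j < n)%N) ->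
  proj y [set` G] f = lin y (ind (mem G) (coord y f)) n.
Proof.
move=> Gn; rewrite (@proj_lin _ _ n) => [|j nj]; last first.
  by rewrite mem_fset_set => /Gn; rewrite ltnNge nj.
by congr (lin _ (ind _ _) _); apply: funext => j; rewrite mem_fset_set.
Qed.

Lemma count_fset (G : {fset nat}) n : (forall j, j \in G -> (j < n)%N) ->
  count (mem G) (iota 0 n) = #|` G|.
Proof.
move=> Gn; rewrite -size_filter; apply/perm_size/uniq_perm.
- by rewrite filter_uniq ?iota_uniq.
- exact: fset_uniq.
- by move=> j; rewrite mem_filter mem_iota add0n /= andb_idr // => /Gn.
Qed.

Lemma fset_bound (G : {fset nat}) : exists n, forall j, j \in G -> (j < n)%N.
Proof.
exists (\max_(j <- G) j).+1 => j jG; rewrite ltnS.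
by apply: (@leq_bigmax_seq _ (G : seq nat) xpredT id).
Qed.

Lemma fset_min (G : {fset nat}) (g : nat -> R) : G != fset0 ->
  exists2 k, k \in G & forall j, j \in G -> g k <= g j.
Proof.
move=> /fset0Pn[k0 k0G].
suff H (s : seq nat) : k0 \in s -> exists2 k, k \in s & forall j, j \in s -> g k <= g j.
  exact: (H (G : seq nat)).
elim: s k0 {k0G} => // x s IH k0 _; case: s IH => [_|w s IH].
  by exists x => [|j]; rewrite inE // => /eqP->.
have [k ks km] := IH w (mem_head _ _).
have [xk|kx] := leP (g x) (g k).
  exists x => [|j]; rewrite ?mem_head // in_cons => /predU1P[->//|/km].
  exact: le_trans.
exists k => [|j]; first by rewrite in_cons ks orbT.
by rewrite in_cons => /predU1P[->|/km//]; exact: ltW.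
Qed.

End projections.

Section consequences.
Context (R : realType) (F : scalar_kind).
Local Notation K := (scalars R F).
Context (X : completeNormedModType K) (y : nat -> X) (ybasis : is_basis y).
Context (L : nat -> R).
Hypotheses (L0 : forall n, 0 <= L n) (Lmono : forall m n, (m <= n)%N -> L m <= L n).
Local Notation nY a N := (rnorm (lin y a (2 ^ N).-1)).
Implicit Types (a : nat -> K) (G B : pred nat) (f : X).

Hypothesis quasi_greedy : exists2 C : R, 1 <= C & forall N a G (t : R), 0 <= t ->
  (forall j, (j < (2 ^ N).-1)%N -> G j -> t <= rabs (a j)) ->
  (forall j, (j < (2 ^ N).-1)%N -> ~~ G j -> rabs (a j) <= t) ->
  nY (ind G a) N <= C * nY a N.
Hypothesis lower : exists2 C : R, 0 <= C & forall N a B (t : R), 0 <= t ->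
  (forall j, (j < (2 ^ N).-1)%N -> B j -> t <= rabs (a j)) ->
  t * L (count B (iota 0 (2 ^ N).-1)) <= C * nY a N.
Hypothesis upper : exists2 C : R, 0 <= C & forall N a B (t : R), 0 <= t ->
  (forall j, (j < (2 ^ N).-1)%N -> rabs (a j) <= if B j then t else 0) ->
  nY a N <= C * (t * L (count B (iota 0 (2 ^ N).-1))).

(** Quasi-greedy and democratic bases are almost greedy: with [g = f - S_A(f)]
    one has [f - S_G(f) = (g - S_H(g)) + S_D(f)], where [H], the set of indices
    in [G] but not in [A], is greedy for [g] and at least as large as [D], the
    indices in [A] but not in [G], where the coefficients of [f] do not exceed
    those in [H]. *)
Lemma almost_greedy_finite : exists2 C : R, 1 <= C & forall N a G A (t : R), 0 <= t ->
  (forall j, (j < (2 ^ N).-1)%N -> G j -> t <= rabs (a j)) ->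
  (forall j, (j < (2 ^ N).-1)%N -> ~~ G j -> rabs (a j) <= t) ->
  (count A (iota 0 (2 ^ N).-1) <= count G (iota 0 (2 ^ N).-1))%N ->
  nY (ind (predC G) a) N <= C * nY (ind (predC A) a) N.
Proof.
have [C1 C10 HC1] := quasi_greedy; have [C2 C20 HC2] := lower; have [C3 C30 HC3] := upper.
exists (1 + C1 + C3 * C2) => [|N a G A t t0 tG Gt AG].
  by have := mulr_ge0 C30 C20; lra.
set g := ind (predC A) a.
pose H j := G j && ~~ A j; pose D j := A j && ~~ G j.
have -> : lin y (ind (predC G) a) (2 ^ N).-1 =
    lin y g (2 ^ N).-1 - lin y (ind H g) (2 ^ N).-1 + lin y (ind D a) (2 ^ N).-1.
  rewrite -linB -linD; apply: eq_lin => j _; rewrite /g /H /D /ind /=.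
  by case: (G j); case: (A j); rewrite /= ?subrr ?subr0 ?addr0 ?add0r.
have h1 : nY (ind H g) N <= C1 * nY g N.
  apply: (HC1 _ _ _ t t0) => j jM; rewrite /H /g /ind /=.
    by case/andP=> Gj ->; exact: tG.
  by case: (A j); rewrite /= ?rabs0 // andbT; exact: Gt.
have cnt : (count D (iota 0 (2 ^ N).-1) <= count H (iota 0 (2 ^ N).-1))%N.
  have split (P Q : pred nat) s : count P s = (count (fun j => P j && Q j) s + count (fun j => P j && ~~ Q j) s)%N.
    by elim: s => //= j s ->; case: (P j); case: (Q j) => /=; lia.
  move: AG; rewrite (split A G) (split G A) /D /H.
  have -> : count (fun j => G j && A j) (iota 0 (2 ^ N).-1) = count (fun j => A j && G j) (iota 0 (2 ^ N).-1).
    by apply: eq_count => j; rewrite andbC.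
  by rewrite leq_add2l.
have h2 : nY (ind D a) N <= C3 * (C2 * nY g N).
  apply: le_trans (HC3 _ _ D t t0 _) _ => [j jM|].
    by rewrite /ind; case: ifP => [/andP[_ Gj]|_]; rewrite ?rabs0 // Gt.
  rewrite ler_wpM2l //; apply: le_trans (HC2 _ _ H t t0 _) => [|j jM /andP[Gj Aj]].
    by rewrite ler_wpM2l // Lmono.
  by rewrite /g /ind /= Aj; exact: tG.
apply: le_trans (rnormD _ _) _; apply: le_trans (lerD (rnorm_triB _ _) (lexx _)) _.
lra.
Qed.

Lemma expansion_pow f (eps : R) : 0 < eps -> exists N0, forall N, (N0 <= N)%N ->
  rnorm (lin y (coord y f) (2 ^ N).-1 - f) < eps.
Proof.
move=> e0; have [sy _] := ybasis.
have /expansionP Hexp : expansion y f (coord y f) by exact: coordP.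
have [N0 H] := Hexp _ e0.
by exists N0 => N NN; apply: H; apply: leq_trans NN _; exact: le_pow_pred.
Qed.

Lemma almost_greedy_of_inequalities : almost_greedy y.
Proof.
have [C C1 HC] := almost_greedy_finite; exists C => f A G AG greedy.
have C0 : 0 <= C by lra.
have [G0|/fset_min-/(_ R (fun j => rabs (coord y f j)))[k kG kmin]] := eqVneq G fset0.
  have A0 : A = fset0 by apply/eqP; rewrite -cardfs_eq0; move: AG; rewrite G0 cardfs0 leqn0.
  by rewrite A0 G0 ler_peMl // rnorm_ge0.
set a := coord y f in greedy kmin *.
have [nA HA] := fset_bound A; have [nG HG] := fset_bound G.
apply/ler_addgt0Pl => eps e0.
have e1 : 0 < eps / (1 + C) by rewrite divr_gt0 //; lra.
have [N0 HN] := expansion_pow f e1.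
pose N := maxn N0 (maxn nA nG); have hN := HN N (leq_maxl _ _).
have NM := le_pow_pred N.
have AM j : j \in A -> (j < (2 ^ N).-1)%N.
  by move=> /HA jn; apply: leq_trans NM; rewrite !leq_max jn orbT.
have GM j : j \in G -> (j < (2 ^ N).-1)%N.
  by move=> /HG jn; apply: leq_trans NM; rewrite !leq_max jn !orbT.
rewrite (proj_fset y f AM) (proj_fset y f GM) -/a.
have compl (B : {fset nat}) : lin y a (2 ^ N).-1 - lin y (ind (mem B) a) (2 ^ N).-1 =
    lin y (ind (predC (mem B)) a) (2 ^ N).-1.
  by rewrite -linB; apply: eq_lin => j _; rewrite /ind /=; case: (j \in B); rewrite ?subrr ?subr0.
have := HC N a (mem G) (mem A) (rabs (a k)) (rabs_ge0 _).
rewrite (count_fset AM) (count_fset GM) => H.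
have {}H := H (fun j _ jG => kmin j jG) (fun j _ jG => greedy j k jG kG) AG.
rewrite -!compl in H.
have h1 := rnorm_tri (lin y a (2 ^ N).-1) f (lin y (ind (mem G) a) (2 ^ N).-1 : X).
move: h1 H hN; rewrite (rnormB f (lin y a _)).
set gA := lin y (ind (mem A) a) _; set gG := lin y (ind (mem G) a) _; set fN := lin y a _.
have h2 : rnorm (fN - gA) <= rnorm (fN - f) + rnorm (f - gA) by exact: rnorm_tri.
move=> h1 H hN; have := ler_wpM2l C0 h2.
have : (1 + C) * rnorm (fN - f) <= eps.
  by rewrite mulrC -ler_pdivlMr; [exact: ltW | lra].
lra.
Qed.

Lemma lin_indicator (A : {fset nat}) n : (forall j, j \in A -> (j < n)%N) ->
  \sum_(j <- A) y j = lin y (fun j => if j \in A then 1 else 0) n.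
Proof.
move=> An; rewrite /lin.
transitivity (\sum_(j < n | val j \in A) y j).
  rewrite -(big_mkord (mem A) y) -big_filter; apply: perm_big; apply: uniq_perm.
  - exact: fset_uniq.
  - by rewrite filter_uniq ?iota_uniq.
  - by move=> j; rewrite mem_filter mem_index_iota leq0n /= andb_idr // => /An.
by rewrite big_mkcond; apply: eq_bigr => j _; case: ifP; rewrite ?scale1r ?scale0r.
Qed.

Lemma fundamental_equiv : equivalent_on [set m | (1 <= m)%N] (fundamental y) (fun m => (L m)%:E).
Proof.
have [C1 C10 HC1] := lower; have [C2 C20 HC2] := upper.
have bound (A : {fset nat}) : rnorm (\sum_(j <- A) y j) <= C2 * L #|` A| /\
    L #|` A| <= C1 * rnorm (\sum_(j <- A) y j).
  have [n HA] := fset_bound A.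
  have AM j : j \in A -> (j < (2 ^ n).-1)%N by move=> /HA h; apply: leq_trans h (le_pow_pred n).
  rewrite (lin_indicator AM); split.
    have := HC2 n (fun j => if j \in A then 1 else 0) (mem A) 1 ler01.
    rewrite (count_fset AM) mul1r; apply=> j _ /=.
    by case: (j \in A); rewrite ?rabs1 ?rabs0.
  have := HC1 n (fun j => if j \in A then 1 else 0) (mem A) 1 ler01.
  by rewrite (count_fset AM) mul1r; apply=> j _ /= ->; rewrite rabs1.
exists (C1 + C2 + 1); split=> [|m _]; first lra.
split.
  apply: ge_ereal_sup => _ [A /= Am <-]; rewrite -EFinM lee_fin.
  have [h _] := bound A; have := Lmono Am; have := L0 m => l0 l1.
  by have := ler_wpM2l C20 l1; have := mulr_ge0 C10 l0; lra.
pose A : {fset nat} := [fset j | j in iota 0 m]%fset.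
have cA : #|` A| = m by rewrite card_fseq undup_id ?iota_uniq ?size_iota.
have [_ h] := bound A; rewrite cA in h.
apply: (@le_trans _ _ ((C1 + C2 + 1)%:E * (rnorm (\sum_(j <- A) y j))%:E)%E).
  rewrite -EFinM lee_fin; apply: le_trans h _.
  by rewrite ler_wpM2r ?rnorm_ge0 //; lra.
apply: lee_wpmul2l; first by rewrite lee_fin; lra.
by apply: ereal_sup_ubound; exists A => //=; rewrite cA.
Qed.

Lemma trunc_log_ln m : (1 <= m)%N ->
  (trunc_log 2 m)%:R * ln 2 <= ln (m%:R : R) /\ ln (m%:R : R) <= (trunc_log 2 m).+1%:R * ln 2.
Proof.
move=> m1; have /andP[h1 h2] := trunc_log_bounds (ltnSn 1) m1.
have m0 : 0 < m%:R :> R by rewrite ltr0n.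
rewrite !mulr_natl -!lnXn // -!natrX; split; rewrite ler_ln ?posrE ?ltr0n ?expn_gt0 // ler_nat //.
exact: ltnW.
Qed.

Hypothesis conditional : exists2 C : R, 0 <= C & forall N a A, (0 < N)%N ->
  nY (ind A a) N <= C * N%:R * nY a N.
Hypothesis very_conditional : exists (q : nat) (c : R), [/\ (0 < q)%N, 0 < c &
  forall n, (0 < n)%N -> exists a A, 0 < nY a (q * n) /\ c * n%:R * nY a (q * n) <= nY (ind A a) (q * n)].

(** The first [m] vectors fill about [log m] dyadic blocks, so that bounds that
    are linear in the number of blocks become logarithmic in [m]. *)
Lemma cond_L_equiv :
  equivalent_on [set m | (2 <= m)%N] (cond_L y) (fun m => (ln (m%:R : R))%:E).
Proof.
have [C C0 HC] := conditional; have [q [c [q0 c0 Hc]]] := very_conditional.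
have sy : schauder y by case: ybasis.
have l2 : 0 < ln 2 :> R by rewrite ln_gt0 // ltr1n.
have up m : (2 <= m)%N -> (cond_L y m <= ((2 * C / ln 2) * ln m%:R)%:E)%E.
  move=> m2; apply: ge_ereal_sup => _ [f [A [f0 fm ->]]]; rewrite lee_fin.
  rewrite ler_pdivrMr ?rnorm_gt0 //.
  set k := trunc_log 2 m; have [k1 _] := trunc_log_ln (ltnW m2); rewrite -/k in k1.
  have k0 : (0 < k)%N by rewrite trunc_log_gt0.
  have mk : (m <= (2 ^ k.+1).-1)%N by have := trunc_log_ltn m (ltnSn 1); rewrite -/k; lia.
  have fE : f = lin y (coord y f) (2 ^ k.+1).-1.
    have h j : ((2 ^ k.+1).-1 <= j)%N -> coord y f j = 0 by move=> hj; apply: fm; exact: leq_trans hj.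
    have u : expansion y f (coord y f) by exact: coordP.
    have v : expansion y (lin y (coord y f) (2 ^ k.+1).-1) (coord y f) by exact: expansion_lin.
    exact: (cvg_unique (@norm_hausdorff _ _) u v).
  rewrite (@proj_lin _ _ _ _ _ _ (2 ^ k.+1).-1) => [|j hj _]; last by apply: fm; exact: leq_trans hj.
  apply: le_trans (HC k.+1 (coord y f) _ (ltn0Sn k)) _; rewrite -fE ler_wpM2r ?rnorm_ge0 //.
  have kk : k.+1%:R <= 2 * k%:R :> R by rewrite -natrM ler_nat; lia.
  have kl : k.+1%:R * ln 2 <= 2 * ln (m%:R : R) by have := ler_wpM2r (ltW l2) kk; lra.
  have Cl : 0 <= C / ln 2 by rewrite divr_ge0 // ltW.
  have -> : C * k.+1%:R = C / ln 2 * (k.+1%:R * ln 2) by field; rewrite gt_eqF.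
  by apply: le_trans (ler_wpM2l Cl kl) _; lra.
have lo m (a : nat -> K) n A : (n <= m)%N -> 0 < rnorm (lin y a n) ->
    ((rnorm (lin y (ind A a) n) / rnorm (lin y a n))%:E <= cond_L y m)%E.
  move=> nm a0; apply: ereal_sup_ubound.
  pose b j := if (j < n)%N then a j else 0.
  have b0 j : (n <= j)%N -> b j = 0 by rewrite /b ltnNge => ->.
  have ab : lin y a n = lin y b n by apply: eq_lin => j jn; rewrite /b jn.
  have cb : coord y (lin y a n) = b by rewrite ab coord_lin.
  exists (lin y a n), [set j | A j]; split.
  - by rewrite -rnorm_gt0.
  - by move=> j mj; rewrite cb b0 // (leq_trans nm).
  congr (_ / _)%:E; rewrite (@proj_lin _ _ _ _ _ _ n) => [|j nj _]; last by rewrite cb b0.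
  rewrite cb; congr rnorm; apply: eq_lin => j jn.
  rewrite /ind /b jn; have -> // : (j \in [set j | A j]) = A j.
  by apply/idP/idP; rewrite inE.
have lo1 m : (2 <= m)%N -> (1%:E <= cond_L y m)%E.
  move=> m2; have y0 : 0 < rnorm (lin y (fun=> 1) 1).
    have [c' c'0 cy] := basis_lb ybasis.
    by rewrite /lin big_ord1 scale1r; exact: lt_le_trans (cy 0%N).
  have := lo m (fun=> 1) 1%N predT (ltnW m2) y0.
  by rewrite (_ : ind predT (fun=> 1) = fun=> 1) // divff // gt_eqF.
pose D := q%:R * (1 + c^-1) * 2 * ln 2.
have D0 : 0 < D by rewrite /D !mulr_gt0 ?ltr0n // addr_gt0 // invr_gt0.
exists (2 * C / ln 2 + D); split=> [|m /= m2].
  by rewrite ltr_wpDl // divr_ge0 ?mulr_ge0 // ltW.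
have lnm : 0 <= ln (m%:R : R) by rewrite ln_ge0 // ler1n ltnW.
split.
  apply: le_trans (up m m2) _; rewrite -EFinM lee_fin.
  by rewrite ler_wpM2r // lerDl ltW.
set k := trunc_log 2 m; have [_ k1] := trunc_log_ln (ltnW m2); rewrite -/k in k1.
have k0 : (0 < k)%N by rewrite trunc_log_gt0.
apply: (@le_trans _ _ (D%:E * cond_L y m)%E); last first.
  apply: lee_wpmul2r; first by apply: le_trans (lo1 m m2); rewrite lee_fin.
  by rewrite lee_fin lerDr divr_ge0 ?mulr_ge0 // ltW.
have cL : ((c * (k %/ q)%N%:R)%:E <= cond_L y m)%E.
  have [->|n0] := posnP (k %/ q)%N.
    by rewrite mulr0; apply: le_trans (lo1 m m2); rewrite lee_fin.
  have [a [A [a0 Ha]]] := Hc _ n0.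
  apply: le_trans (lo m a _ A _ a0); first by rewrite lee_fin ler_pdivlMr.
  have h1 : (2 ^ (q * (k %/ q)) <= 2 ^ k)%N by rewrite leq_exp2l // mulnC leq_trunc_div.
  by have /andP[h2 _] := trunc_log_bounds (ltnSn 1) (ltnW m2); rewrite -/k in h2; lia.
have kq : k.+1%:R <= 2 * q%:R * (1 + (k %/ q)%N%:R) :> R.
  have := divn_eq k q; have := ltn_pmod k q0; set d := (k %/ q)%N => r1 r2.
  rewrite -[1]/(1%:R) -natrD -!natrM ler_nat; nia.
have step : (ln (m%:R : R))%:E = (D%:E * (D^-1 * ln m%:R)%:E)%E.
  by rewrite -EFinM mulrA divff ?mul1r // gt_eqF.
rewrite step; apply: lee_wpmul2l; first by rewrite lee_fin ltW.
have fin : (D^-1 * ln m%:R <= Num.max 1 (c * (k %/ q)%N%:R)).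
  rewrite ler_pdivrMl //; set w := Num.max _ _.
  have w1 : 1 <= w by rewrite le_max lexx.
  have w2 : c * (k %/ q)%N%:R <= w by rewrite le_max lexx orbT.
  have w3 : (k %/ q)%N%:R <= c^-1 * w by rewrite ler_pdivlMl.
  apply: le_trans k1 _; apply: le_trans (ler_wpM2r (ltW l2) kq) _.
  rewrite /D; set d := (k %/ q)%N%:R in w3 *.
  have ql : 0 <= q%:R * ln 2 :> R by rewrite mulr_ge0 // ltW.
  have : 1 + d <= (1 + c^-1) * w by rewrite mulrDl mul1r lerD.
  by move=> /(ler_wpM2l ql); lra.
apply: le_trans (_ : (Num.max 1 (c * (k %/ q)%N%:R))%:E <= _)%E; first by rewrite lee_fin.
by rewrite EFin_max ge_max lo1.
Qed.

End consequences.

(** * Absorbing complemented squares *)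

Definition interlace (T : Type) (u w : nat -> T) (j : nat) : T :=
  if odd j then w j./2 else u j./2.

Lemma interlace_double T (u w : nat -> T) j : interlace u w j.*2 = u j.
Proof. by rewrite /interlace odd_double doubleK. Qed.

Lemma interlace_doubleS T (u w : nat -> T) j : interlace u w j.*2.+1 = w j.
Proof. by rewrite /interlace /= odd_double /= uphalf_double. Qed.

Section interlacing.
Context (R : realType) (F : scalar_kind).
Local Notation K := (scalars R F).

Lemma lin_interlace (V : lmodType K) (u w : nat -> V) (c : nat -> K) k :
  lin (interlace u w) c k = lin u (fun j => c j.*2) (uphalf k) + lin w (fun j => c j.*2.+1) k./2.
Proof.
have even q : lin (interlace u w) c q.*2 =
    lin u (fun j => c j.*2) q + lin w (fun j => c j.*2.+1) q.
  elim: q => [|q IH]; first by rewrite !lin0 addr0.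
  by rewrite doubleS !linS IH interlace_double interlace_doubleS -addrA addrACA.
rewrite -(odd_double_half k); case: (odd k); last by rewrite add0n even uphalf_double doubleK.
by rewrite add1n linS even interlace_double /= uphalf_double doubleK linS addrAC.
Qed.

Lemma lin_interlace2 (V : lmodType K) (u w : nat -> V) (a b : nat -> K) k :
  lin (interlace u w) (interlace a b) k = lin u a (uphalf k) + lin w b k./2.
Proof.
rewrite lin_interlace; congr (_ + _); apply: eq_lin => j _.
  by rewrite interlace_double.
by rewrite interlace_doubleS.
Qed.

Lemma bounded_linear (X : completeNormedModType K) (P : {linear X -> X}) : continuous P ->
  exists2 C : R, 0 <= C & forall x, rnorm (P x) <= C * rnorm x.
Proof.
move=> /linear_bounded_continuous/linear_boundedP[M [Mr HM]].
have M1 : M < `|M| + 1 by rewrite ltr_pwDr // real_ler_norm.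
exists (scalar_Re (`|M| + 1 : K)) => [|x].
  by rewrite -(@emb_nneg R F) scalar_ReK addr_ge0.
by rewrite -(@emb_le R F) embM !emb_rnorm scalar_ReK ?addr_ge0 // HM.
Qed.

(** [od] and [ev] embed the two halves of a space that is isomorphic to its
    square; density of their sum is enough to produce bases. *)
Definition square_like (V : lmodType K) (D : set V) (N : V -> R) : Prop :=
  exists ev od : V -> V,
  [/\ forall (t : K) u v, D u -> D v -> [/\ D (ev u), D (od u),
        ev (t *: u + v) = t *: ev u + ev v & od (t *: u + v) = t *: od u + od v],
      forall u v, D u -> D v -> [/\ N u <= N (od u + ev v), N v <= N (od u + ev v) &
        N (od u + ev v) <= N u + N v] &
      forall t (eps : R), D t -> 0 < eps -> exists u v, [/\ D u, D v & N (t - (od u + ev v)) < eps]].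

Definition subspace (V : lmodType K) (D : set V) (N : V -> R) : Prop :=
  [/\ D 0, forall (t : K) u v, D u -> D v -> D (t *: u + v) & forall u, D u -> 0 <= N u].

(** [A] and [B] embed [(D, N)] and [X] in [X] as a direct sum of subspaces. *)
Definition direct_sum (V : lmodType K) (D : set V) (N : V -> R) (X : completeNormedModType K)
    (A : V -> X) (B : X -> X) (c C : R) : Prop :=
  [/\ forall (t : K) u v, D u -> D v -> A (t *: u + v) = t *: A u + A v,
      forall (t : K) x y, B (t *: x + y) = t *: B x + B y,
      0 < c /\ 0 < C &
      forall u x, D u -> c * (N u + rnorm x) <= rnorm (A u + B x) <= C * (N u + rnorm x)].

Definition dense_sum (V : lmodType K) (D : set V) (X : completeNormedModType K)
    (A : V -> X) (B : X -> X) : Prop :=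
  forall y (eps : R), 0 < eps -> exists u x, D u /\ rnorm (y - (A u + B x)) < eps.

(** The decomposition trick: if [X] is [V + Z] and [V] is [V + V], then [X] is
    [V + (V + Z)], that is, [V + X].  Here [A] embeds the new copy of [V] and
    [B] maps [X] onto the complement. *)
Lemma absorb (V : lmodType K) (D : set V) (N : V -> R) (X : completeNormedModType K) :
  subspace D N -> square_like D N -> complemented_in D N X ->
  exists (A : V -> X) (B : X -> X) (c C : R), direct_sum D N A B c C /\ dense_sum D A B.
Proof.
move=> [D0 DD N0] [ev [od [evod Nevod dense]]] [J [P [Jlin [c [C [c0 Jb]]] Pc PP PJ]]].
have [CP CP0 HP] := bounded_linear Pc.
have J0 : J 0 = 0.
  by have /eqP := Jlin 1 0 0 D0 D0; rewrite !scale1r addr0 eq_sym -subr_eq0 addrK => /eqP.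
have ev0 : ev 0 = 0.
  have [_ _ /eqP + _] := evod 1 0 0 D0 D0; by rewrite !scale1r addr0 eq_sym -subr_eq0 addrK => /eqP.
have od0 : od 0 = 0.
  have [_ _ _ /eqP] := evod 1 0 0 D0 D0; by rewrite !scale1r addr0 eq_sym -subr_eq0 addrK => /eqP.
have N00 : N 0 = 0.
  apply: le_anti; rewrite N0 // andbT; have /andP[+ _] := Jb 0 D0.
  by rewrite J0 rnorm0 pmulr_rle0.
have Dev u : D u -> D (ev u) by move=> Du; have [] := evod 1 u u Du Du.
have Dod u : D u -> D (od u) by move=> Du; have [] := evod 1 u u Du Du.
have DB u v : D u -> D v -> D (u - v).
  by move=> Du Dv; rewrite addrC -scaleN1r; exact: DD.
have Dadd u v : D u -> D v -> D (u + v) by move=> Du Dv; rewrite -[u]scale1r; exact: DD.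
have JB u v : D u -> D v -> J (u - v) = J u - J v.
  by move=> Du Dv; rewrite addrC -scaleN1r Jlin // scaleN1r addrC.
have Jadd u v : D u -> D v -> J (u + v) = J u + J v.
  by move=> Du Dv; have := Jlin 1 u v Du Dv; rewrite !scale1r.
have Nev w : D w -> N w = N (ev w).
  move=> Dw; have [_ h1 h2] := Nevod 0 w D0 Dw; apply: le_anti.
  by move: h1 h2; rewrite od0 add0r N00 add0r => -> ->.
have evinj u v : D u -> D v -> J u = J v -> J (ev u) = J (ev v).
  move=> Du Dv Juv; apply/eqP; rewrite -subr_eq0 -JB //; try exact: Dev.
  have -> : ev u - ev v = ev (u - v).
    by rewrite addrC -scaleN1r; have [_ _ <- _] := evod (-1) v u Dv Du; rewrite scaleN1r addrC.
  have Nuv : N (u - v) = 0.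
    apply: le_anti; rewrite N0 ?andbT; last exact: DB.
    by have /andP[+ _] := Jb _ (DB _ _ Du Dv); rewrite JB // Juv subrr rnorm0 pmulr_rle0.
  apply/eqP/rnorm0_eq0/le_anti; rewrite rnorm_ge0 andbT.
  have /andP[_] := Jb _ (Dev _ (DB _ _ Du Dv)); rewrite -Nev ?Nuv ?mulr0 //; exact: DB.
have /choice[Ji HJi] x : exists u, D u /\ J u = P x.
  have [u Du e] : (J @` D) (P x) by rewrite -PJ; exists x.
  by exists u.
have DJi x : D (Ji x) by have [] := HJi x.
have JJi x : J (Ji x) = P x by have [] := HJi x.
have PJu u : D u -> P (J u) = J u.
  move=> Du; have [x _ <-] : range P (J u) by rewrite PJ; exists u.
  exact: PP.
pose A u := J (od u); pose B x := J (ev (Ji x)) + (x - P x).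
have AB u x : D u -> A u + B x = J (od u + ev (Ji x)) + (x - P x).
  by move=> Du; rewrite addrA -Jadd //; [exact: Dod | exact: Dev].
exists A, B.
have C0 : 0 <= `|C| := normr_ge0 _.
have JbC u : D u -> rnorm (J u) <= `|C| * N u.
  move=> Du; have /andP[_ h] := Jb u Du; apply: le_trans h _.
  by rewrite ler_wpM2r ?ler_norm // N0.
(* [P] sends [A u + B x] to its first component, which dominates both
   [N u] and [rnorm (P x)]; the second component is [x - P x] *)
pose c' := (2 * CP / c + 1 + CP + `|C| * (CP / c))^-1.
have den0 : 0 < 2 * CP / c + 1 + CP + `|C| * (CP / c).
  have h1 : 0 <= CP / c by rewrite divr_ge0 // ltW.
  by have := mulr_ge0 C0 h1; lra.
have c'0 : 0 < c' by rewrite invr_gt0.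
pose C' := `|C| + `|C| * (CP / c) + 1 + CP.
have C'0 : 0 < C'.
  have h1 : 0 <= CP / c by rewrite divr_ge0 // ltW.
  by have := mulr_ge0 C0 h1; rewrite /C'; lra.
exists c', C'; split; first split=> //.
- move=> t u v Du Dv; rewrite /A; have [_ _ _ ->] := evod t u v Du Dv.
  by rewrite Jlin //; exact: Dod.
- move=> t x y; rewrite /B.
  have -> : J (ev (Ji (t *: x + y))) = t *: J (ev (Ji x)) + J (ev (Ji y)).
    have [_ _ e _] := evod t (Ji x) (Ji y) (DJi x) (DJi y).
    rewrite -(Jlin _ _ _ (Dev _ (DJi x)) (Dev _ (DJi y))) -e.
    apply: evinj; [exact: DJi | exact: DD | ].
    by rewrite JJi Jlin // !JJi linearP.
  have -> : t *: x + y - P (t *: x + y) = t *: (x - P x) + (y - P y).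
    by rewrite linearP opprD addrACA scalerBr.
  by rewrite addrACA -scalerDr.
- move=> u x Du; rewrite AB //.
  set w := od u + ev (Ji x).
  have Dw : D w by apply: Dadd; [exact: Dod | exact: Dev].
  have PT : P (J w + (x - P x)) = J w by rewrite linearD PJu // linearB PP subrr addr0.
  have [Nu NJ Nw] := Nevod u (Ji x) Du (DJi x); rewrite -/w in Nu NJ Nw.
  have PxC : rnorm (P x) <= `|C| * N (Ji x) by rewrite -JJi JbC.
  have Jix : c * N (Ji x) <= rnorm (P x) by have /andP[+ _] := Jb _ (DJi x); rewrite JJi.
  have xPx : rnorm x <= rnorm (P x) + rnorm (x - P x) by exact: rnorm_dist.
  apply/andP; split.
    set T := J w + _.
    have hJ : rnorm (J w) <= CP * rnorm T by rewrite -PT HP.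
    have hx : rnorm (x - P x) <= (1 + CP) * rnorm T.
      have -> : x - P x = T - J w by rewrite /T addrAC subrr add0r.
      by apply: le_trans (rnorm_triB _ _) _; lra.
    have hN : N w <= CP / c * rnorm T.
      rewrite mulrAC ler_pdivlMr //; have /andP[h _] := Jb w Dw.
      by apply: le_trans hJ; rewrite mulrC.
    rewrite /c' mulrC ler_pdivrMr // mulrC.
    have := ler_wpM2l C0 hN; have := ler_wpM2l C0 NJ; lra.
  have hx : rnorm (x - P x) <= (1 + CP) * rnorm x.
    by apply: le_trans (rnorm_triB _ _) _; have := HP x; lra.
  have hJ : N (Ji x) <= CP / c * rnorm x.
    by rewrite mulrAC ler_pdivlMr // mulrC; apply: le_trans Jix (HP x).
  apply: le_trans (rnormD _ _) _.
  have := JbC w Dw; have := ler_wpM2l C0 Nw; have := ler_wpM2l C0 hJ.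
  have p1 : 0 <= CP / c by rewrite divr_ge0 // ltW.
  have := N0 u Du; have := rnorm_ge0 x; have := mulr_ge0 C0 p1.
  rewrite /C' => h1 h2 h3 h4 h5 h6.
  have := mulr_ge0 h1 h3; have := mulr_ge0 C0 h2; have := mulr_ge0 CP0 h3; lra.
- move=> y eps e0; have [t Dt Jt] : (J @` D) (P y) by rewrite -PJ; exists y.
  have e1 : 0 < eps / (`|C| + 1) by rewrite divr_gt0 // ltr_wpDl.
  have [u [v [Du Dv h]]] := dense t _ Dt e1.
  exists u, (J v + (y - P y)); split=> //; rewrite AB //.
  have Px : P (J v + (y - P y)) = J v by rewrite linearD PJu // linearB PP subrr addr0.
  have -> : J (od u + ev (Ji (J v + (y - P y)))) = J (od u + ev v).
    rewrite !Jadd; try solve [exact: Dod | exact: Dev | exact/Dev/DJi].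
    by congr (_ + _); apply: evinj; [exact: DJi | by [] | rewrite JJi Px].
  rewrite Px [J v + _]addrC addrK opprD addrA.
  have -> : y - J (od u + ev v) - (y - P y) = J (t - (od u + ev v)).
    rewrite JB //; last by apply: Dadd; [exact: Dod | exact: Dev].
    by rewrite Jt opprB addrC addrA subrK.
  apply: le_lt_trans (JbC _ _) _.
    by apply: DB => //; apply: Dadd; [exact: Dod | exact: Dev].
  have h2 := N0 (t - (od u + ev v)).
  have /h2 {}h2 : D (t - (od u + ev v)) by apply: DB => //; apply: Dadd; [exact: Dod | exact: Dev].
  by move: h; rewrite ltr_pdivlMr ?ltr_wpDl //; lra.
Qed.

Lemma interlace_grunblum (X : completeNormedModType K) (u w : nat -> X) (Cu Cw C : R) :
  (forall a b m n, rnorm (lin u a m) + rnorm (lin w b n) <= C * rnorm (lin u a m + lin w b n)) ->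
  grunblum u Cu -> grunblum w Cw ->
  grunblum (interlace u w) ((`|Cu| + `|Cw|) * C).
Proof.
move=> sep gu gw c m n mn; rewrite !lin_interlace.
have half := half_leq mn; have uhalf : (uphalf m <= uphalf n)%N by rewrite !uphalfE half_leq.
have h1 : rnorm (lin u (fun j => c j.*2) (uphalf m)) <= `|Cu| * rnorm (lin u (fun j => c j.*2) (uphalf n)).
  by apply: le_trans (gu _ _ _ uhalf) _; rewrite ler_wpM2r ?rnorm_ge0 // ler_norm.
have h2 : rnorm (lin w (fun j => c j.*2.+1) m./2) <= `|Cw| * rnorm (lin w (fun j => c j.*2.+1) n./2).
  by apply: le_trans (gw _ _ _ half) _; rewrite ler_wpM2r ?rnorm_ge0 // ler_norm.
apply: le_trans (rnormD _ _) _; apply: le_trans (lerD h1 h2) _.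
rewrite -mulrA; apply: le_trans (ler_wpM2l _ (sep _ _ _ _)); last by rewrite addr_ge0.
set p := rnorm (lin u _ _); set q := rnorm (lin w _ _).
have p0 : 0 <= p := rnorm_ge0 _; have q0 : 0 <= q := rnorm_ge0 _.
by have := mulr_ge0 (normr_ge0 Cu) q0; have := mulr_ge0 (normr_ge0 Cw) p0; lra.
Qed.

Lemma interlace_semi_normalized (X : completeNormedModType K) (u w : nat -> X) :
  semi_normalized u -> semi_normalized w -> semi_normalized (interlace u w).
Proof.
move=> [c [C [c0 H]]] [d [D [d0 H']]]; exists (Num.min c d), (Num.max C D).
split=> [|j]; first by rewrite lt_min c0.
have /andP[h1 h2] := H j./2; have /andP[h3 h4] := H' j./2.
by rewrite /interlace ge_min le_max; case: odd; rewrite ?h1 ?h2 ?h3 ?h4 ?orbT.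
Qed.

Lemma interlace_dense (X : completeNormedModType K) (u w : nat -> X) :
  (forall f (eps : R), 0 < eps -> exists a b m n, rnorm (f - (lin u a m + lin w b n)) < eps) ->
  dense_span (interlace u w).
Proof.
move=> H f eps /(H f)[a [b [m [n h]]]].
pose a' j := if (j < m)%N then a j else 0; pose b' j := if (j < n)%N then b j else 0.
exists (maxn m n).*2, (interlace a' b').
rewrite lin_interlace2 uphalf_double doubleK.
by rewrite !lin_trunc ?leq_maxl ?leq_maxr.
Qed.

(** Linear growth of the conditionality constants.  The factor [q] makes the
    notion stable under interlacing. *)
Definition conditional_seq (X : completeNormedModType K) (x : nat -> X) : Prop :=
  exists (q : nat) (c : R), [/\ (0 < q)%N, 0 < c &
  forall n, (0 < n)%N -> exists a A, 0 < rnorm (lin x a (q * n)) /\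
    c * n%:R * rnorm (lin x a (q * n)) <= rnorm (lin x (ind A a) (q * n))].

Lemma interlace_conditional (X : completeNormedModType K) (u w : nat -> X) :
  conditional_seq u \/ conditional_seq w -> conditional_seq (interlace u w).
Proof.
have zero (V : lmodType K) (v : nat -> V) A n : lin v (ind A (fun=> 0 : K)) n = 0.
  by rewrite -(lin_zero v n); apply: eq_lin => j _; rewrite /ind; case: ifP.
case=> -[q [c [q0 c0 H]]]; exists q.*2, c; (split=> //; first by rewrite double_gt0) => n n0.
  have [a [A [a0 h]]] := H n n0.
  exists (interlace a (fun=> 0)), (interlace A predT).
  have -> : ind (interlace A predT) (interlace a (fun=> 0)) = interlace (ind A a) (fun=> 0).
    by apply: funext => j; rewrite /ind /interlace; case: (odd j).
  by rewrite -doubleMl !lin_interlace2 uphalf_double doubleK lin_zero !addr0.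
have [a [A [a0 h]]] := H n n0.
exists (interlace (fun=> 0) a), (interlace predT A).
have -> : ind (interlace predT A) (interlace (fun=> 0) a) = interlace (fun=> 0) (ind A a).
  by apply: funext => j; rewrite /ind /interlace; case: (odd j).
by rewrite -doubleMl !lin_interlace2 uphalf_double doubleK lin_zero !add0r.
Qed.

End interlacing.

(** * Subsymmetric spaces are squares *)

Section subsymmetric_square.
Context (R : realType) (F : scalar_kind).
Local Notation K := (scalars R F).
Context (S : completeNormedModType K) (iota : S -> nat -> K) (e : nat -> S).
Hypothesis Se : subsymmetric_seq_space iota e.

Lemma expansion_unique (x : nat -> S) (f g : S) a : expansion x f a -> expansion x g a -> f = g.
Proof. by move=> u v; exact: (cvg_unique (@norm_hausdorff _ _) u v). Qed.

Lemma subsym_of_space : subsym e.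
Proof.
case: Se => _ _ _ _ H n a eps phi hphi.
pose a' j := if (j < n)%N then a j else 0.
have a'0 j : (n <= j)%N -> a' j = 0 by rewrite /a' ltnNge => ->.
have ea : expansion e (lin e a' n) a' by exact: expansion_lin.
have [g g1 g2] := H a' eps phi _ hphi ea.
have g3 : expansion (e \o phi) g (fun j => (-1) ^+ (eps j) * a' j) by exact: g1.
have g4 : expansion (e \o phi) (lin (e \o phi) (fun j => (-1) ^+ (eps j) * a' j) n)
    (fun j => (-1) ^+ (eps j) * a' j).
  by apply: expansion_lin => j nj; rewrite a'0 ?mulr0.
have aa' : lin e a n = lin e a' n by apply: eq_lin => j jn; rewrite /a' jn.
rewrite aa' -g2 (expansion_unique g3 g4); congr rnorm.
by apply: eq_lin => j jn; rewrite /a' jn.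
Qed.

Let ebasis : is_basis e. Proof. by case: Se. Qed.
Let sche : schauder e. Proof. by case: ebasis. Qed.
Let ss := subsym_of_space.

Lemma basis_dense (X : completeNormedModType K) (x : nat -> X) : is_basis x -> dense_span x.
Proof.
move=> [sx _] f eps e0.
have /expansionP H : expansion x f (coord x f) by exact: coordP.
have [N HN] := H _ e0; exists N, (coord x f); rewrite rnormB; exact: HN.
Qed.

(** The two halves are applied to arbitrary vectors in [absorb], so reindexings
    are needed on the whole space and not only on the span of [e]. *)
Lemma reindex_isometry phi : {homo phi : i j / (i < j)%N} -> exists T : S -> S,
  [/\ forall (t : K) u v, T (t *: u + v) = t *: T u + T v,
      forall u, rnorm (T u) = rnorm u &
      forall u, expansion (e \o phi) (T u) (coord e u)].
Proof.
move=> hphi; case: Se => _ _ _ _ H.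
have /choice[T HT] (u : S) : exists g, expansion (e \o phi) g (coord e u) /\ rnorm g = rnorm u.
  have eu : expansion e u (coord e u) by exact: coordP.
  have [g g1 g2] := H _ (fun=> false) phi _ hphi eu; exists g; split=> //.
  have {g1} : expansion (e \o phi) g (fun j => (-1) ^+ false * coord e u j) by exact: g1.
  by under eq_fun do rewrite expr0 mul1r.
exists T; split=> [t u v|u|u]; try by case: (HT u).
have [hu _] := HT u; have [hv _] := HT v; have [huv _] := HT (t *: u + v).
apply: (expansion_unique huv); rewrite coordD // coordZ //.
by apply: expansionD => //; exact: expansionZ.
Qed.

Lemma rnorm_lim_le (x y : nat -> S) (f g : S) :
  (forall eps : R, 0 < eps -> exists N, forall n, (N <= n)%N -> rnorm (x n - f) < eps) ->
  (forall eps : R, 0 < eps -> exists N, forall n, (N <= n)%N -> rnorm (y n - g) < eps) ->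
  (forall n, rnorm (x n) <= rnorm (y n)) -> rnorm f <= rnorm g.
Proof.
move=> xf yg xy; apply/ler_addgt0Pl => eps e0.
have e2 : 0 < eps / 2 by rewrite divr_gt0.
have [N1 H1] := xf _ e2; have [N2 H2] := yg _ e2.
have h1 := H1 _ (leq_maxl N1 N2); have h2 := H2 _ (leq_maxr N1 N2).
have := xy (maxn N1 N2); have := rnorm_dist f (x (maxn N1 N2)).
by have := rnorm_dist (y (maxn N1 N2)) g; rewrite (rnormB f); lra.
Qed.

(** The even and the odd coordinates span two isometric copies of the space. *)
Lemma subsym_square : square_like [set: S] (@rnorm R F S).
Proof.
have [ev [evl evn eve]] := @reindex_isometry double ltac:(by move=> i j; rewrite ltn_double).
have [od [odl odn ode]] := @reindex_isometry (succn \o double)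
  ltac:(by move=> i j /=; rewrite ltnS ltn_double).
have eE : interlace (e \o double) (e \o (succn \o double)) = e.
  apply: funext => j; rewrite /interlace /=; have := odd_double_half j.
  by case: (odd j) => /= hj; rewrite -[in RHS]hj.
exists ev, od; split=> [//|u v _ _|t eps _ e0].
  pose a := coord e u; pose b := coord e v.
  pose c := interlace b a.
  have cE n : lin e c n.*2 = lin (e \o (succn \o double)) a n + lin (e \o double) b n.
    by rewrite -{1}eE lin_interlace2 uphalf_double doubleK addrC.
  have /expansionP hu := ode u; have /expansionP hv := eve v.
  have huv : forall eps : R, 0 < eps -> exists N, forall n, (N <= n)%N ->
      rnorm (lin e c n.*2 - (od u + ev v)) < eps.
    move=> eps e0; have e2 : 0 < eps / 2 by rewrite divr_gt0.
    have [N1 H1] := hu _ e2; have [N2 H2] := hv _ e2.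
    exists (maxn N1 N2) => n; rewrite geq_max => /andP[/H1 h1 /H2 h2].
    rewrite cE opprD addrACA; apply: le_lt_trans (rnormD _ _) _.
    by rewrite (splitr eps) ltrD.
  split.
  - rewrite -odn; apply: (rnorm_lim_le hu huv) => n.
    have -> : lin (e \o (succn \o double)) a n = lin e (ind odd c) n.*2.
      rewrite -{2}eE lin_interlace uphalf_double doubleK.
      rewrite [X in _ = X + _](eq_lin _ (b := fun=> 0)) => [|j _]; last by rewrite /ind odd_double.
      rewrite lin_zero add0r; apply: eq_lin => j _.
      by rewrite /ind /= odd_double /= /c interlace_doubleS.
    exact: subsym_ind.
  - rewrite -evn; apply: (rnorm_lim_le hv huv) => n.
    have -> : lin (e \o double) b n = lin e (ind (predC odd) c) n.*2.
      rewrite -{2}eE lin_interlace uphalf_double doubleK addrC.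
      rewrite [X in _ = X + _](eq_lin _ (b := fun=> 0)) => [|j _]; last by rewrite /ind /= odd_double.
      rewrite lin_zero add0r; apply: eq_lin => j _.
      by rewrite /ind /= odd_double /= /c interlace_double.
    exact: subsym_ind.
  - by rewrite -(odn u) -(evn v) rnormD.
have /expansionP H : expansion e t (coord e t) by exact: coordP.
have [n /(_ n.*2) h] := H _ e0.
have fin (T : S -> S) phi a : (forall u, expansion (e \o phi) (T u) (coord e u)) ->
    T (lin e (fun j => if (j < n)%N then a j else 0) n) = lin (e \o phi) a n.
  move=> HT; set a' := fun j => _.
  have a'0 j : (n <= j)%N -> a' j = 0 by rewrite /a' ltnNge => ->.
  have h1 := HT (lin e a' n); rewrite coord_lin // in h1.
  have h2 : expansion (e \o phi) (lin (e \o phi) a' n) a' by exact: expansion_lin.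
  rewrite (expansion_unique h1 h2); apply: eq_lin => j jn; by rewrite /a' jn.
exists (lin e (fun j => if (j < n)%N then coord e t j.*2.+1 else 0) n).
exists (lin e (fun j => if (j < n)%N then coord e t j.*2 else 0) n).
split=> //; rewrite (fin od _ (fun j => coord e t j.*2.+1) ode).
rewrite (fin ev _ (fun j => coord e t j.*2) eve).
rewrite rnormB [lin (e \o (succn \o double)) _ _ + _]addrC.
have {}h := h ltac:(by rewrite -addnn leq_addr).
by move: h; rewrite -{1}eE lin_interlace uphalf_double doubleK.
Qed.

End subsymmetric_square.

(** * Conditional sequences in the model spaces *)

Section sequence_spaces.
Context (R : realType) (F : scalar_kind).
Local Notation K := (scalars R F).
Local Notation seqs := (nat -> K^o).
Implicit Types (a b t u v : nat -> K) (n : nat).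

(** What is needed of [d] for its image in a Banach space that contains a copy
    of [(D, N)] to be a conditional basis of that copy. *)
Definition conditional_model (V : lmodType K) (D : set V) (N : V -> R) (d : nat -> V) : Prop :=
  [/\ forall a n, D (lin d a n),
      exists c C : R, 0 < c /\ forall j, c <= N (d j) <= C,
      exists C : R, forall a m n, (m <= n)%N -> N (lin d a m) <= C * N (lin d a n),
      forall (t : V) (eps : R), D t -> 0 < eps -> exists a n, N (t - lin d a n) < eps &
      forall n, (0 < n)%N -> exists a A, 0 < N (lin d a (2 * n)) /\
        n%:R * N (lin d a (2 * n)) <= N (lin d (ind A a) (2 * n))].

Lemma lin_seq (d : nat -> seqs) a n i : lin d a n i = \sum_(j < n) a j * d j i.
Proof. by elim: n => [|n IH]; rewrite ?lin0 ?big_ord0 // linS big_ord_recr /= -IH. Qed.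

Definition head n t : seqs := fun j => if (j < n)%N then t j else 0.
Definition evenpart t : seqs := fun j => t j.*2.
Definition oddpart t : seqs := fun j => t j.*2.+1.
Definition evplace t : seqs := interlace t (fun=> 0).
Definition odplace t : seqs := interlace (fun=> 0) t.

Lemma placeE (u v : seqs) : odplace u + evplace v = interlace v u.
Proof.
apply: funext => j; rewrite /odplace /evplace /interlace /GRing.add /=.
by case: odd; rewrite ?addr0 ?add0r.
Qed.

Lemma interlace_parts (t : seqs) : interlace (evenpart t) (oddpart t) = t.
Proof.
apply: funext => j; rewrite /interlace /evenpart /oddpart; have := odd_double_half j.
by case: (odd j) => /= hj; rewrite -[in RHS]hj.
Qed.

Lemma place_linear (s : K) (u v : seqs) :
  evplace (s *: u + v) = s *: evplace u + evplace v /\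
  odplace (s *: u + v) = s *: odplace u + odplace v.
Proof.
split; apply: funext => j; rewrite /evplace /odplace /interlace /GRing.add /GRing.scale /=;
by case: odd; rewrite // /GRing.scale /= mulr0 addr0.
Qed.

(** Since [evplace] and [odplace] commute with the vector operations, only the
    norm of an interlaced sequence and closure properties are left to check. *)
Lemma square_like_seqs (D : set seqs) (N : seqs -> R) :
  (forall u v, D u -> D v -> D (interlace u v)) -> D 0 ->
  (forall t, D t -> D (evenpart t) /\ D (oddpart t)) ->
  (forall u v, D u -> D v -> [/\ N u <= N (interlace v u), N v <= N (interlace v u) &
     N (interlace v u) <= N u + N v]) -> N 0 <= 0 ->
  square_like D N.
Proof.
move=> Di D0 Dp Ni N0; exists evplace, odplace; split=> [s u v Du Dv|u v Du Dv|t eps Dt e0].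
- by have [-> ->] := place_linear s u v; split=> //; exact: Di.
- by rewrite placeE; exact: Ni.
have [De Do] := Dp _ Dt; exists (oddpart t), (evenpart t); split=> //.
by rewrite placeE interlace_parts subrr; exact: le_lt_trans N0 e0.
Qed.

(** * The space of absolutely summable sequences *)

Local Notation D1 := [set a : seqs | cvgn (series (fun j => rabs (a j)))].
Local Notation N1 := (fun a : seqs => limn (series (fun j => rabs (a j)))).

Definition psum a n : R := \sum_(j < n) rabs (a j).

Lemma psumE a n : series (fun j => rabs (a j)) n = psum a n.
Proof. by rewrite /series /= big_mkord. Qed.

Lemma psum_ge0 a n : 0 <= psum a n.
Proof. by apply: sumr_ge0 => i _; exact: rabs_ge0. Qed.

Lemma psum_mono a : nondecreasing_seq (series (fun j => rabs (a j))).
Proof. by apply: nondecreasing_series => i _ _; exact: rabs_ge0. Qed.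

Lemma psum_bounded_cvg a (M : R) : (forall n, psum a n <= M) -> D1 a.
Proof.
move=> aM; apply: nondecreasing_is_cvgn; first exact: psum_mono.
by exists M => _ [n _ <-]; rewrite psumE.
Qed.

Lemma psum_le_lim a n : D1 a -> psum a n <= N1 a.
Proof. by move=> Da; rewrite -psumE; apply: nondecreasing_cvgn_le => //; exact: psum_mono. Qed.

Lemma lim_psum_le a (M : R) : D1 a -> (forall n, psum a n <= M) -> N1 a <= M.
Proof. by move=> Da aM; apply: limr_le => //; apply: nearW => n; rewrite psumE. Qed.

Lemma psum_supp a n : (forall j, (n <= j)%N -> a j = 0) -> D1 a /\ N1 a = psum a n.
Proof.
move=> a0.
have le m : psum a m <= psum a n.
  have [mn|nm] := leqP m n.
    by rewrite /psum -(subnKC mn) big_split_ord /= lerDl; apply: sumr_ge0 => i _; exact: rabs_ge0.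
  rewrite /psum -(subnKC (ltnW nm)) big_split_ord /= [X in _ + X]big1 ?addr0 // => i _.
  by rewrite a0 ?rabs0 // leq_addr.
have Da := psum_bounded_cvg le; split=> //.
by apply: le_anti; rewrite psum_le_lim // lim_psum_le.
Qed.

Lemma psum_interlace u v n : psum (interlace u v) n.*2 = psum u n + psum v n.
Proof.
elim: n => [|n IH]; first by rewrite /psum !big_ord0 addr0.
rewrite doubleS /psum !big_ord_recr /= -/(psum _ _) IH -/(psum u n) -/(psum v n).
by rewrite interlace_double interlace_doubleS -addrA addrACA.
Qed.

Lemma psum_le_double a n : psum a n <= psum a n.*2.
Proof.
rewrite -addnn /psum big_split_ord /= lerDl.
by apply: sumr_ge0 => i _; exact: rabs_ge0.
Qed.

Lemma ell1_interlace u v : D1 u -> D1 v -> D1 (interlace u v) /\ N1 (interlace u v) = N1 u + N1 v.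
Proof.
move=> Du Dv.
have le n : psum (interlace u v) n <= N1 u + N1 v.
  apply: le_trans (psum_le_double _ _) _; rewrite psum_interlace.
  by apply: lerD; exact: psum_le_lim.
have Di := psum_bounded_cvg le; split=> //; apply: le_anti; rewrite lim_psum_le //=.
suff : N1 u <= N1 (interlace u v) - N1 v by lra.
apply: lim_psum_le => // n; rewrite lerBrDr -lerBrDl; apply: lim_psum_le => // m.
rewrite lerBrDl.
have mono a k l : (k <= l)%N -> psum a k <= psum a l.
  by move=> kl; rewrite -!psumE; exact: psum_mono.
apply: le_trans (lerD (mono u _ _ (leq_maxl n m)) (mono v _ _ (leq_maxr n m))) _.
by rewrite -psum_interlace psum_le_lim.
Qed.

Lemma ell1_subspace : @subspace R F seqs D1 N1.
Proof.
split=> [|s u v Du Dv|u Du].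
- by have [] := @psum_supp (fun=> 0) 0%N (fun _ _ => erefl).
- apply: (@psum_bounded_cvg _ (rabs s * N1 u + N1 v)) => n.
  apply: (@le_trans _ _ (rabs s * psum u n + psum v n)).
    rewrite /psum mulr_sumr -big_split /=; apply: ler_sum => j _.
    by apply: le_trans (rabsD _ _) _; rewrite rabsM.
  by apply: lerD; [rewrite ler_wpM2l ?rabs_ge0 // | ]; exact: psum_le_lim.
- by apply: le_trans (psum_le_lim 0 Du); rewrite psum_ge0.
Qed.

Lemma ell1_square : square_like D1 N1.
Proof.
have [D0 _ N0] := ell1_subspace.
apply: square_like_seqs => //.
- by move=> u v Du Dv; have [] := ell1_interlace Du Dv.
- move=> t Dt; rewrite -(interlace_parts t) in Dt.
  by split; apply: (@psum_bounded_cvg _ (N1 (interlace (evenpart t) (oddpart t)))) => n;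
    apply: le_trans (psum_le_lim n.*2 Dt); rewrite psum_interlace ?lerDl ?lerDr psum_ge0.
- move=> u v Du Dv; have [_ ->] := ell1_interlace Dv Du.
  by rewrite lerDl lerDr !N0 // addrC.
- by have [_ ->] := @psum_supp (fun=> 0) 0%N (fun _ _ => erefl); rewrite /psum big_ord0.
Qed.

(** The difference basis [e_0, e_1 - e_0, e_2 - e_1, ...] of $\ell_1$: its first
    [2 * n] terms add up to a unit vector, those of odd index to one of norm [2 * n]. *)
Definition diff_seq (j : nat) : seqs := fun i => (i == j)%:R - (i.+1 == j)%:R.

Lemma lin_diff a n : lin diff_seq a n = (fun i => head n a i - head n a i.+1).
Proof.
apply: funext => i; rewrite lin_seq.
have pick (k : nat) : \sum_(j < n) a j * (k == j)%:R = head n a k.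
  rewrite /head; case: ltnP => kn.
    rewrite (bigD1 (Ordinal kn)) //= eqxx mulr1 big1 ?addr0 // => j.
    by rewrite -val_eqE /= eq_sym => /negbTE->; rewrite mulr0.
  by rewrite big1 // => j _; rewrite gtn_eqF ?mulr0 // (leq_trans (ltn_ord j)).
rewrite -!pick -sumrB; apply: eq_bigr => j _; by rewrite /diff_seq mulrBr.
Qed.

Lemma N1_diff a n : D1 (lin diff_seq a n.+1) /\
  N1 (lin diff_seq a n.+1) = \sum_(i < n) rabs (a i - a i.+1) + rabs (a n).
Proof.
have [j nj|D N] := @psum_supp (lin diff_seq a n.+1) n.+1.
  have h1 : (j < n.+1)%N = false by lia.
  have h2 : (j.+1 < n.+1)%N = false by lia.
  by rewrite lin_diff /head h1 h2 subrr.
split=> //; rewrite N /psum big_ord_recr /= lin_diff /head ltnSn ltnn subr0; congr (_ + _).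
apply: eq_bigr => i _; have in_ := ltn_ord i.
have h1 : (i < n.+1)%N by lia.
have h2 : (i.+1 < n.+1)%N by lia.
by rewrite h1 h2.
Qed.

Lemma ell1_model : @conditional_model seqs D1 N1 diff_seq.
Proof.
have [D0 DD N0] := ell1_subspace.
have Dlin a n : D1 (lin diff_seq a n).
  by case: n => [|n]; [rewrite lin0 | have [] := N1_diff a n].
split=> //.
- exists 1, 2; split=> // j.
  rewrite -(lin_delta diff_seq (ltnSn j)); have [_ ->] := N1_diff (fun i => (i == j)%:R) j.
  rewrite eqxx rabs1 lerDr sumr_ge0 => [|i _]; last exact: rabs_ge0.
  rewrite -lerBrDr /=; have -> : 2 - 1 = 1 :> R by lra.
  case: j => [|j]; first by rewrite big_ord0.
  rewrite big_ord_recr /= eqxx big1 ?add0r => [|i _].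
    by rewrite ltn_eqF // sub0r rabsN rabs1.
  by rewrite eqSS !ltn_eqF ?subrr ?rabs0 // ltnW // ltnS ltn_ord.
- exists 1 => a m n mn; rewrite mul1r -(subnKC mn).
  elim: (n - m)%N => [|k IH]; first by rewrite addn0.
  apply: le_trans IH _; rewrite addnS; case: (m + k)%N => [|l].
    by rewrite lin0; have [_ ->] := @psum_supp 0 0%N (fun _ _ => erefl); rewrite /psum big_ord0 N0.
  have [_ ->] := N1_diff a l; have [_ ->] := N1_diff a l.+1.
  rewrite big_ord_recr /= -addrA lerD2l.
  by have := rabsD (a l - a l.+1) (a l.+1); rewrite subrK.
- move=> t eps Dt e0.
  have /cvgrPdist_lt/(_ _ e0)[n _ Hn] : series (fun j => rabs (t j)) @ \oo --> N1 t by exact: Dt.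
  exists (fun j => \sum_(i < n - j) t (j + i)%N), n.
  have E : lin diff_seq (fun j => \sum_(i < n - j) t (j + i)%N) n = head n t.
    rewrite lin_diff; apply: funext => i; rewrite /head.
    case: (ltnP i n) => ni; last first.
      by have -> : (i.+1 < n)%N = false by [lia]; rewrite subrr.
    rewrite -(subnSK ni) big_ord_recl addn0 /=.
    have -> : \sum_(i0 < n - i.+1) t (i + bump 0 i0)%N = \sum_(i0 < n - i.+1) t (i.+1 + i0)%N.
      by apply: eq_bigr => l _; rewrite /bump /= add1n addSnnS.
    case: ltnP => h; first by rewrite addrK.
    by rewrite (_ : n - i.+1 = 0)%N ?big_ord0 ?addr0 ?subr0 //; lia.
  have Dr : D1 (t - head n t) by rewrite addrC -scaleN1r; apply: DD => //; rewrite -E.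
  apply: le_lt_trans (_ : N1 t - psum t n < eps); last first.
    have := Hn n (leqnn n); rewrite /= psumE ger0_norm // subr_ge0; exact: psum_le_lim.
  rewrite E; apply: lim_psum_le => // m.
  rewrite lerBrDr; apply: le_trans (psum_le_lim (n + m) Dt).
  rewrite [leLHS]addrC /psum [leRHS]big_split_ord /= lerD2l.
  have hd j : (j < n)%N -> (t - head n t) j = 0.
    by move=> jn; rewrite /head /GRing.add /GRing.opp /= jn subrr.
  have tl j : (n <= j)%N -> (t - head n t) j = t j.
    by move=> nj; rewrite /head /GRing.add /GRing.opp /= ltnNge nj subr0.
  apply: (@le_trans _ _ (psum (t - head n t) (n + m))).
    by have h := psum_mono (t - head n t) (leq_addl n m); rewrite !psumE in h; exact: h.
  rewrite /psum big_split_ord /= big1 ?add0r => [|i _]; last by rewrite hd ?rabs0.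
  by apply: ler_sum => i _; rewrite tl // leq_addr.
- move=> n n0; exists (fun=> 1), odd.
  have n2 : (2 * n = (2 * n).-1.+1)%N by lia.
  rewrite n2; have [_ ->] := N1_diff (fun=> 1) (2 * n).-1.
  have [_ ->] := N1_diff (ind odd (fun=> 1)) (2 * n).-1.
  rewrite big1 => [|i _]; last by rewrite subrr rabs0.
  rewrite rabs1 add0r mulr1; split=> //.
  rewrite (eq_bigr (fun=> 1)) => [|i _]; last first.
    by rewrite /ind /=; case: (odd i); rewrite /= ?subr0 ?sub0r ?rabsN rabs1.
  rewrite sumr_const card_ord; apply: (@le_trans _ _ ((2 * n).-1%:R : R)).
    by rewrite ler_nat; lia.
  by rewrite lerDl rabs_ge0.
Qed.

(** * The space of null sequences *)

Local Notation D0 := [set a : seqs | (fun j => rabs (a j)) @ \oo --> (0 : R)].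
Local Notation N0 := (fun a : seqs => sup (range (fun j => rabs (a j)))).

Lemma c0P a : D0 a <-> forall eps : R, 0 < eps -> exists n, forall j, (n <= j)%N -> rabs (a j) < eps.
Proof.
split=> [/cvgrPdist_lt H eps /H[n _ Hn]|H].
  by exists n => j nj; have := Hn j nj; rewrite sub0r normrN ger0_norm // rabs_ge0.
apply/cvgrPdist_lt => eps /H[n Hn]; exists n => // j /= /Hn.
by rewrite sub0r normrN ger0_norm // rabs_ge0.
Qed.

Lemma c0_bounded a : D0 a -> has_sup (range (fun j => rabs (a j))).
Proof.
move=> /c0P/(_ 1 ltr01)[n Hn]; split; first by exists (rabs (a 0%N)), 0%N.
exists (psum a n + 1) => _ [j _ <-]; have p0 := psum_ge0 a n.
have [nj|jn] := leqP n j; first by have := Hn j nj; lra.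
rewrite /psum (bigD1 (Ordinal jn)) //=.
have : 0 <= \sum_(i < n | i != Ordinal jn) rabs (a i) by apply: sumr_ge0 => i _; exact: rabs_ge0.
lra.
Qed.

Lemma le_c0 a j : D0 a -> rabs (a j) <= N0 a.
Proof. by move=> Da; apply: sup_upper_bound; [exact: c0_bounded | exists j]. Qed.

Lemma c0_le a (M : R) : (forall j, rabs (a j) <= M) -> N0 a <= M.
Proof.
move=> aM; apply: ge_sup => [|_ [j _ <-]//].
by exists (rabs (a 0%N)), 0%N.
Qed.

Lemma c0_supp a n : (forall j, (n <= j)%N -> a j = 0) -> D0 a.
Proof. by move=> a0; apply/c0P => eps e0; exists n => j /a0->; rewrite rabs0. Qed.

Lemma c0_subspace : @subspace R F seqs D0 N0.
Proof.
split=> [|s u v /c0P Du /c0P Dv|u Du].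
- exact: (@c0_supp (fun=> 0) 0%N).
- apply/c0P => eps e0; have s1 : 0 < rabs s + 1 by rewrite ltr_wpDl ?rabs_ge0.
  have e1 : 0 < eps / 2 / (rabs s + 1) by rewrite !divr_gt0.
  have [n Hn] := Du _ e1; have [m Hm] := Dv _ (divr_gt0 e0 (ltr0Sn R 1)).
  exists (maxn n m) => j; rewrite geq_max => /andP[/Hn h1 /Hm h2].
  apply: le_lt_trans (rabsD _ _) _; rewrite rabsM.
  rewrite ltr_pdivlMr // in h1; have := rabs_ge0 (u j); lra.
- by apply: le_trans (le_c0 0 Du); exact: rabs_ge0.
Qed.

Lemma c0_square : square_like D0 N0.
Proof.
have [Dz _ Nz] := c0_subspace; apply: square_like_seqs => //.
- move=> u v /c0P Du /c0P Dv; apply/c0P => eps e0.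
  have [n Hn] := Du _ e0; have [m Hm] := Dv _ e0; exists (maxn n m).*2 => j nj.
  have : (maxn n m <= j./2)%N by rewrite -(doubleK (maxn n m)) half_leq.
  by rewrite geq_max /interlace => /andP[/Hn h1 /Hm h2]; case: odd.
- move=> t /c0P Dt; split; apply/c0P => eps /Dt[n Hn]; exists n => j nj; apply: Hn; lia.
- move=> u v Du Dv.
  have Di : D0 (interlace v u).
    apply/c0P => eps e0; have /c0P/(_ _ e0)[n Hn] := Du; have /c0P/(_ _ e0)[m Hm] := Dv.
    exists (maxn n m).*2 => j nj.
    have : (maxn n m <= j./2)%N by rewrite -(doubleK (maxn n m)) half_leq.
    by rewrite geq_max /interlace => /andP[/Hn h1 /Hm h2]; case: odd.
  split; apply: c0_le => j.
  - by rewrite -(interlace_doubleS v u j); exact: le_c0.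
  - by rewrite -(interlace_double v u j); exact: le_c0.
  have := Nz u Du; have := Nz v Dv; rewrite /interlace; case: odd => /= h1 h2.
    by apply: le_trans (le_c0 _ Du) _; lra.
  by apply: le_trans (le_c0 _ Dv) _; lra.
- by apply: c0_le => j; rewrite rabs0.
Qed.

(** The summing basis [e_0, e_0 + e_1, e_0 + e_1 + e_2, ...] of $c_0$: with
    alternating signs, the first [2 * n] terms add up to a vector of norm 1, while
    those of even index add up to one of norm [n]. *)
Definition summing_seq (j : nat) : seqs := fun i => (i <= j)%N%:R.

Lemma lin_summing a n i :
  lin summing_seq a n i = \sum_(j < n) a j - \sum_(j < minn i n) a j.
Proof.
rewrite lin_seq; have [ni|inn] := leqP n i.
  rewrite subrr big1 // => j _.
  by rewrite /summing_seq leqNgt (leq_trans (ltn_ord j) ni) mulr0.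
have [k ->] : exists k, n = (i + k)%N by exists (n - i)%N; lia.
rewrite !big_split_ord /= big1 => [|j _].
  by rewrite add0r addrAC subrr add0r; apply: eq_bigr => j _; rewrite /summing_seq leq_addr mulr1.
by rewrite /summing_seq leqNgt ltn_ord mulr0.
Qed.

Lemma c0_model : @conditional_model seqs D0 N0 summing_seq.
Proof.
have [Dz DD Nz] := c0_subspace.
have Dlin a n : D0 (lin summing_seq a n).
  apply: (@c0_supp _ n) => j nj; by rewrite lin_summing (minn_idPr nj) subrr.
have altsum k : \sum_(j < k) (-1) ^+ j = (odd k)%:R :> K.
  elim: k => [|k IH]; first by rewrite big_ord0.
  rewrite big_ord_recr /= IH -signr_odd; case: (odd k) => /=.
    by rewrite expr1 subrr.
  by rewrite expr0 add0r.
split=> //.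
- exists 1, 1; split=> // j; apply/andP; split.
    have Dj : D0 (summing_seq j) by rewrite -(lin_delta summing_seq (ltnSn j)).
    by apply: le_trans (le_c0 0 Dj); rewrite /summing_seq leq0n rabs1.
  by apply: c0_le => i; rewrite /summing_seq; case: (i <= j)%N; rewrite ?rabs1 ?rabs0.
- exists 2 => a m n mn; apply: c0_le => i; rewrite lin_summing.
  have D := Dlin a n.
  have := le_c0 (minn i m) D; have := le_c0 m D; rewrite !lin_summing (minn_idPl mn).
  rewrite (minn_idPl (leq_trans (geq_minr i m) mn)).
  set x := \sum_(j < n) _; set y := \sum_(j < m) _; set z := \sum_(j < minn i m) _.
  have -> : y - z = (x - z) - (x - y) by rewrite opprB [RHS]addrC addrA subrK.
  by have := rabsD (x - z) (- (x - y)); rewrite rabsN; lra.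
- move=> t eps /c0P Dt e0; have [n Hn] := Dt _ (divr_gt0 e0 (ltr0Sn R 1)).
  exists (fun j => head n t j - head n t j.+1), n.
  have tel k : \sum_(j < k) (head n t j - head n t j.+1) = head n t 0 - head n t k.
    elim: k => [|k IH]; first by rewrite big_ord0 subrr.
    by rewrite big_ord_recr /= IH addrA subrK.
  have E : lin summing_seq (fun j => head n t j - head n t j.+1) n = head n t.
    apply: funext => i; rewrite lin_summing !tel opprB addrC addrA subrK.
    rewrite {2}/head ltnn subr0 /head.
    by case: (ltnP i n) => ni; rewrite ?ni ?ltnn.
  rewrite E; apply: le_lt_trans (_ : eps / 2 < eps); last by rewrite ltr_pdivrMr // ltr_pMr // ltr1n.
  apply: c0_le => j; rewrite /head /GRing.add /GRing.opp /=; case: ltnP => nj.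
    by rewrite subrr rabs0 divr_ge0 // ltW.
  by rewrite subr0 ltW // Hn.
- move=> n n0; pose a j : K := (-1) ^+ j; exists a, (predC odd).
  have odd2 : odd (2 * n) = false by rewrite mul2n odd_double.
  have n2 : N0 (lin summing_seq a (2 * n)) <= 1.
    apply: c0_le => i; rewrite lin_summing /a !altsum odd2 sub0r rabsN.
    by case: odd; rewrite ?rabs1 ?rabs0.
  split.
    apply: lt_le_trans (le_c0 1 (Dlin a (2 * n))).
    rewrite lin_summing /a !altsum odd2 (minn_idPl _) /=; last by lia.
    by rewrite sub0r rabsN rabs1.
  apply: (@le_trans _ _ n%:R); first by rewrite ler_piMr.
  apply: le_trans (le_c0 0 (Dlin _ (2 * n))).
  rewrite lin_summing min0n big_ord0 subr0.
  suff -> : \sum_(j < 2 * n) ind (predC odd) a j = n%:R by rewrite rabs_nat.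
  rewrite mul2n; elim: n {n0 odd2 n2} => [|n IH]; first by rewrite big_ord0.
  rewrite doubleS !big_ord_recr /= IH /ind /= odd_double /= addr0 /a -signr_odd odd_double.
  by rewrite expr0 natr1.
Qed.

End sequence_spaces.

(** * Bases of direct sums *)

Section direct_sums.
Context (R : realType) (F : scalar_kind).
Local Notation K := (scalars R F).
Context (V : lmodType K) (D : set V) (N : V -> R) (X : completeNormedModType K).
Context (A : V -> X) (B : X -> X) (c C : R).
Hypotheses (DN : subspace D N) (ds : direct_sum D N A B c C).

Let Alin (t : K) u v : D u -> D v -> A (t *: u + v) = t *: A u + A v.
Proof. by case: ds => H _ _ _; exact: H. Qed.

Let Blin (t : K) x y : B (t *: x + y) = t *: B x + B y.
Proof. by case: ds. Qed.

Let c0 : 0 < c. Proof. by case: ds => _ _ []. Qed.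
Let C0 : 0 < C. Proof. by case: ds => _ _ []. Qed.

Let AB u x : D u -> c * (N u + rnorm x) <= rnorm (A u + B x) <= C * (N u + rnorm x).
Proof. by case: ds => _ _ _; apply. Qed.

Lemma sum_A0 : A 0 = 0.
Proof.
have [D0 _ _] := DN.
by have /eqP := Alin 1 D0 D0; rewrite !scale1r addr0 eq_sym -subr_eq0 addrK => /eqP.
Qed.

Lemma sum_B0 : B 0 = 0.
Proof. by have /eqP := Blin 1 0 0; rewrite !scale1r addr0 eq_sym -subr_eq0 addrK => /eqP. Qed.

Lemma lin_B (x : nat -> X) b n : lin (B \o x) b n = B (lin x b n).
Proof.
elim: n => [|n IH]; first by rewrite !lin0 sum_B0.
by rewrite !linS IH addrC -Blin addrC.
Qed.

Lemma lin_A (d : nat -> V) a n : (forall j, D (d j)) ->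
  D (lin d a n) /\ lin (A \o d) a n = A (lin d a n).
Proof.
have [D0 DD _] := DN => Dd; elim: n => [|n [Dn IH]]; first by rewrite !lin0 sum_A0.
rewrite !linS IH; split; first by rewrite addrC; exact: DD.
by rewrite addrC -Alin // addrC.
Qed.

Lemma sum_B x : c * rnorm x <= rnorm (B x) <= C * rnorm x.
Proof.
have [D0 _ N0] := DN; have /andP[h1 h2] := AB x D0; have n0 := N0 _ D0.
rewrite sum_A0 add0r in h1 h2.
have N00 : N 0 = 0.
  apply: le_anti; rewrite n0 andbT; have /andP[+ _] := AB 0 D0.
  by rewrite sum_A0 sum_B0 addr0 rnorm0 addr0 pmulr_rle0.
by move: h1 h2; rewrite N00 add0r => -> ->.
Qed.

Lemma sum_A u : D u -> c * N u <= rnorm (A u) <= C * N u.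
Proof. by move=> Du; have := AB 0 Du; rewrite sum_B0 rnorm0 !addr0. Qed.

Lemma sum_separated (d : nat -> V) (x : nat -> X) a b m n : (forall j, D (d j)) ->
  rnorm (lin (A \o d) a m) + rnorm (lin (B \o x) b n) <=
  C / c * rnorm (lin (A \o d) a m + lin (B \o x) b n).
Proof.
move=> Dd; have [Dl ->] := lin_A a m Dd; rewrite lin_B.
have /andP[_ h1] := sum_A Dl; have /andP[_ h2] := sum_B (lin x b n).
have /andP[h3 _] := AB (lin x b n) Dl.
apply: le_trans (lerD h1 h2) _; rewrite -mulrDr -mulrA ler_pM2l // mulrC ler_pdivlMr //.
by rewrite mulrC.
Qed.

Lemma sum_B_semi_normalized x : semi_normalized x -> semi_normalized (B \o x).
Proof.
move=> [k [l [k0 H]]]; exists (c * k), (C * l); split=> [|j]; first exact: mulr_gt0.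
have /andP[h1 h2] := H j; have /andP[h3 h4] := sum_B (x j); apply/andP; split => /=.
  by apply: le_trans h3; rewrite ler_pM2l.
by apply: le_trans h4 _; rewrite ler_pM2l.
Qed.

Lemma sum_B_grunblum x (Cx : R) : grunblum x Cx -> grunblum (B \o x) (C * `|Cx| / c).
Proof.
move=> gx a m n mn; rewrite !lin_B.
have /andP[_ h1] := sum_B (lin x a m); have /andP[h2 _] := sum_B (lin x a n).
apply: le_trans h1 _; rewrite -!mulrA ler_pM2l //.
apply: le_trans (gx a m n mn) _.
apply: (@le_trans _ _ (`|Cx| * rnorm (lin x a n))); first by rewrite ler_wpM2r ?rnorm_ge0 ?ler_norm.
by rewrite ler_wpM2l // mulrC ler_pdivlMr // mulrC.
Qed.

Lemma sum_A_semi_normalized (d : nat -> V) : (forall j, D (d j)) ->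
  (exists k l : R, 0 < k /\ forall j, k <= N (d j) <= l) -> semi_normalized (A \o d).
Proof.
move=> Dd [k [l [k0 H]]]; exists (c * k), (C * l); split=> [|j]; first exact: mulr_gt0.
have /andP[h1 h2] := H j; have /andP[h3 h4] := sum_A (Dd j); apply/andP; split => /=.
  by apply: le_trans h3; rewrite ler_pM2l.
by apply: le_trans h4 _; rewrite ler_pM2l.
Qed.

Lemma sum_A_grunblum (d : nat -> V) (Cd : R) : (forall j, D (d j)) ->
  (forall a m n, (m <= n)%N -> N (lin d a m) <= Cd * N (lin d a n)) ->
  grunblum (A \o d) (C * `|Cd| / c).
Proof.
move=> Dd gd a m n mn; have [Dm ->] := lin_A a m Dd; have [Dn ->] := lin_A a n Dd.
have [_ _ N0] := DN.
have /andP[_ h1] := sum_A Dm; have /andP[h2 _] := sum_A Dn.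
apply: le_trans h1 _; rewrite -!mulrA ler_pM2l //.
apply: le_trans (gd a m n mn) _.
apply: (@le_trans _ _ (`|Cd| * N (lin d a n))); first by rewrite ler_wpM2r ?N0 ?ler_norm.
by rewrite ler_wpM2l // mulrC ler_pdivlMr // mulrC.
Qed.

Lemma sum_dense (d : nat -> V) (x : nat -> X) : (forall j, D (d j)) ->
  (forall t (eps : R), D t -> 0 < eps -> exists a n, N (t - lin d a n) < eps) ->
  dense_span x ->
  dense_sum D A B ->
  forall f (eps : R), 0 < eps -> exists a b m n,
    rnorm (f - (lin (A \o d) a m + lin (B \o x) b n)) < eps.
Proof.
move=> Dd dd dx H f eps e0; have [D0 DD N0] := DN.
have e2 : 0 < eps / 2 by rewrite divr_gt0.
have [u [y [Du huy]]] := H f _ e2.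
have e3 : 0 < eps / 4 / C by rewrite !divr_gt0.
have [a [m h1]] := dd u _ Du e3; have [n [b h2]] := dx y _ e3.
exists a, b, m, n; have [Dl ->] := lin_A a m Dd; rewrite lin_B.
have Dul : D (u - lin d a m) by rewrite addrC -scaleN1r; exact: DD.
have AE : A u - A (lin d a m) = A (u - lin d a m).
  by have := Alin (-1) Dl Du; rewrite !scaleN1r [- _ + u]addrC [- _ + A u]addrC => ->.
have BE : B y - B (lin x b n) = B (y - lin x b n).
  by have := Blin (-1) (lin x b n) y; rewrite !scaleN1r [- _ + y]addrC [- _ + B y]addrC => ->.
have h3 : rnorm (A u + B y - (A (lin d a m) + B (lin x b n))) <= C * (eps / 4 / C + eps / 4 / C).
  rewrite opprD addrACA AE BE; have /andP[_ h] := AB (y - lin x b n) Dul.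
  by apply: le_trans h _; rewrite ler_pM2l // lerD // ltW.
apply: le_lt_trans (rnorm_tri (A u + B y) _ _) _.
have -> : eps = eps / 2 + C * (eps / 4 / C + eps / 4 / C) by field; rewrite gt_eqF.
exact: ltr_leD.
Qed.

Lemma sum_A_conditional (d : nat -> V) : (forall j, D (d j)) ->
  (forall n, (0 < n)%N -> exists a A, 0 < N (lin d a (2 * n)) /\
     n%:R * N (lin d a (2 * n)) <= N (lin d (ind A a) (2 * n))) ->
  conditional_seq (A \o d).
Proof.
move=> Dd H; exists 2%N, (c / C); split=> // [|n n0]; first exact: divr_gt0.
have [a [G [a0 h]]] := H n n0; exists a, G.
have [D1 ->] := lin_A a (2 * n) Dd; have [D2 ->] := lin_A (ind G a) (2 * n) Dd.
have /andP[h1 h2] := sum_A D1; have /andP[h3 _] := sum_A D2.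
split; first by apply: lt_le_trans h1; exact: mulr_gt0.
apply: le_trans h3; rewrite -!mulrA ler_pM2l //.
rewrite mulrC ler_pdivrMr // mulrC.
have := ler_wpM2l (ler0n R n) h2; have := ler_wpM2l (ltW C0) h; lra.
Qed.

Lemma sum_B_conditional x : conditional_seq x -> conditional_seq (B \o x).
Proof.
move=> [q [k [q0 k0 H]]]; exists q, (c * k / C); split=> // [|n n0].
  by rewrite divr_gt0 ?mulr_gt0.
have [a [G [a0 h]]] := H n n0; exists a, G; rewrite !lin_B.
have /andP[h1 h2] := sum_B (lin x a (q * n)); have /andP[h3 _] := sum_B (lin x (ind G a) (q * n)).
split; first by apply: lt_le_trans h1; exact: mulr_gt0.
apply: le_trans h3; rewrite -!mulrA ler_pM2l //.
apply: le_trans h; rewrite -!mulrA ler_pM2l //.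
rewrite mulrC ler_pdivrMr // mulrC.
have := ler_wpM2l (ler0n R n) h2; lra.
Qed.

End direct_sums.

Section conditional_bases.
Context (R : realType) (F : scalar_kind).
Local Notation K := (scalars R F).

(** A complemented square with a conditional model is absorbed as a direct
    summand, and interlacing transfers the conditionality to a basis of [X]. *)
Lemma conditional_basis (V : lmodType K) (D : set V) (N : V -> R) (d : nat -> V)
    (X : completeNormedModType K) :
  subspace D N -> square_like D N -> conditional_model D N d -> complemented_in D N X ->
  (exists x : nat -> X, is_basis x) ->
  exists w : nat -> X, is_basis w /\ conditional_seq w.
Proof.
move=> DN sq [Dlin sd [Cd gd] dd cd] comp [x bx].
have [A [B [c [C [ds dense]]]]] := absorb DN sq comp.
have Dd j : D (d j) by rewrite -(lin_delta d (ltnSn j)).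
have [Cx gx] := basis_grunblum bx; have [_ snx] := bx.
exists (interlace (A \o d) (B \o x)); split; last first.
  apply: interlace_conditional; left; exact: (sum_A_conditional DN ds Dd cd).
apply: grunblum_basis.
- apply: interlace_semi_normalized.
    exact: (sum_A_semi_normalized ds Dd sd).
  exact: (sum_B_semi_normalized DN ds snx).
- apply: (interlace_grunblum (C := C / c)).
  + by move=> a b m n; apply: (sum_separated DN ds).
  + exact: (sum_A_grunblum DN ds Dd gd).
  + exact: (sum_B_grunblum DN ds gx).
- apply: interlace_dense.
  exact: (sum_dense DN ds Dd dd (basis_dense bx) dense).
Qed.

End conditional_bases.

(** * Assembling the decomposition *)

(** The space is [A(S) + B(X)].  Splitting [S] further by the averaging
    projection, whose range has the basis [vblock], the complement of the image
    of the vectors with vanishing averages has the basis [zseq], and this is the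
    sequence to which the norm above is applied. *)
Section assembly.
Context (R : realType) (F : scalar_kind).
Local Notation K := (scalars R F).
Context (S : completeNormedModType K) (e : nat -> S) (ss : subsym e) (edense : dense_span e).
Local Notation lam := (dyad_norm e).
Hypothesis lam0 : forall n, 0 < lam n.
Context (X : completeNormedModType K) (A : S -> X) (B : X -> X) (c C : R).
Local Notation nrm := (@rnorm R F S).
Hypotheses (ds : direct_sum [set: S] nrm A B c C) (dense : dense_sum [set: S] A B).
Context (w : nat -> X).
Hypotheses (wbasis : is_basis w) (wcond : conditional_seq w).

Lemma full_subspace : subspace [set: S] nrm.
Proof. by split=> // u _; exact: rnorm_ge0. Qed.

Definition vblock n : S := (emb F (lam n))^-1 *: \sum_(i < 2 ^ n) e (bs n i).

Lemma emb_lam_neq0 n : emb F (lam n) != 0.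
Proof. by rewrite -(emb0 R F) (inj_eq (@emb_inj R F)) gt_eqF. Qed.

Definition blockwise (b : nat -> K) (j : nat) : K := b (blk j) / emb F (lam (blk j)).

Lemma lin_vblock b N : lin vblock b N = lin e (blockwise b) (2 ^ N).-1.
Proof.
rewrite lin_blocks; apply: eq_bigr => n _; rewrite /vblock scalerA scaler_sumr.
by apply: eq_bigr => i _; rewrite /blockwise blk_bs.
Qed.

Lemma rnorm_vblock n : rnorm (vblock n) = 1.
Proof.
rewrite /vblock rnormZ rabsV rabs_emb gtr0_norm // /bs (Lam_shift ss).
by rewrite mulVf // gt_eqF // lam0.
Qed.

Lemma vblock_grunblum b m n : (m <= n)%N -> rnorm (lin vblock b m) <= 1 * rnorm (lin vblock b n).
Proof.
move=> mn; rewrite mul1r !lin_vblock; apply: (subsym_grunblum ss).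
by have : (2 ^ m <= 2 ^ n)%N by [rewrite leq_exp2l]; lia.
Qed.

Definition zseq : nat -> X := interlace (A \o vblock) (B \o w).

Lemma zseq_bounds : exists Cz : R, [/\ forall n, rnorm (zseq n) <= Cz,
  forall b n N, (n < N)%N -> rabs (b n) <= Cz * rnorm (lin zseq b N) & grunblum zseq Cz].
Proof.
have [_ snw] := wbasis; have [Cw gw] := basis_grunblum wbasis.
have Dv j : [set: S] (vblock j) by [].
have [k [l [k0 kl]]] : semi_normalized zseq.
  apply: interlace_semi_normalized.
    apply: (sum_A_semi_normalized ds Dv); exists 1, 1; split=> // j.
    by rewrite rnorm_vblock lexx.
  exact: (sum_B_semi_normalized full_subspace ds snw).
have [G gz] : exists G, grunblum zseq G.
  eexists; apply: (interlace_grunblum (C := C / c)).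
  + by move=> a b m n; apply: (sum_separated full_subspace ds).
  + exact: (sum_A_grunblum full_subspace ds Dv vblock_grunblum).
  + exact: (sum_B_grunblum full_subspace ds gw).
have k1 j : k <= rnorm (zseq j) by have /andP[] := kl j.
have l1 j : rnorm (zseq j) <= l by have /andP[] := kl j.
have n1 := normr_ge0 G; have n2 := normr_ge0 (2 * G / k).
have n3 : 0 <= l := le_trans (rnorm_ge0 _) (l1 0%N).
exists (l + `|G| + `|2 * G / k|); split=> [n|b n N nN|a m n mn].
- by apply: le_trans (l1 n) _; lra.
- apply: le_trans (grunblum_coef b k0 k1 gz nN) _.
  by rewrite ler_wpM2r ?rnorm_ge0 //; apply: le_trans (ler_norm _) _; lra.
- apply: le_trans (gz a m n mn) _.
  by rewrite ler_wpM2r ?rnorm_ge0 //; apply: le_trans (ler_norm _) _; lra.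
Qed.

Lemma zseq_conditional : conditional_seq zseq.
Proof.
by apply: interlace_conditional; right; exact: (sum_B_conditional full_subspace ds wcond).
Qed.

Lemma lin_zseq b N :
  lin zseq b N = A (lin vblock (fun j => b j.*2) (uphalf N)) + B (lin w (fun j => b j.*2.+1) N./2).
Proof.
rewrite lin_interlace (lin_B ds).
by have [_ ->] := @lin_A _ _ _ _ _ _ _ _ _ _ full_subspace ds vblock (fun j => b j.*2) (uphalf N) (fun=> I).
Qed.

Lemma A_add u v : A (u + v) = A u + A v.
Proof. by case: ds => /(_ 1 u v I I); rewrite !scale1r. Qed.

(** On the span of [e], the averaging projection splits [q + p], where [q] has
    vanishing averages and [p] is constant on the blocks. *)
Lemma block_split a b k N : (k <= N)%N ->
  rnorm (lin e (Qf a) (2 ^ N).-1) <= 3 * rnorm (lin e (Qf a) (2 ^ N).-1 + lin vblock b k).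
Proof.
move=> kN; have kM : ((2 ^ k).-1 <= (2 ^ N).-1)%N.
  by have : (2 ^ k <= 2 ^ N)%N by [rewrite leq_exp2l]; lia.
rewrite lin_vblock -(lin_trunc e _ kM); set p := fun j => _.
have Qp : Qf p = fun=> 0.
  by apply: Qf_const => i j ij; rewrite /p !blk_lt /blockwise ij.
rewrite -linD; set h := fun j => _.
have <- : Qf h = Qf a; last exact: (ns_Qf ss).
by rewrite /h QfD Qf_Qf Qp; apply: funext => j; rewrite addr0.
Qed.

Lemma assembly_low : exists2 c1 : R, 0 < c1 & forall N a b,
  c1 * (rnorm (lin e (Qf a) (2 ^ N).-1) + rnorm (lin zseq b N)) <=
  rnorm (lin (A \o e) (Qf a) (2 ^ N).-1 + lin zseq b N).
Proof.
have [_ _ [c0 C0] AB] := ds.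
have D0 : 0 < 3 + 4 * C by lra.
exists (c / (3 + 4 * C)) => [|N a b]; first exact: divr_gt0.
rewrite lin_zseq; have [_ ->] := @lin_A _ _ _ _ _ _ _ _ _ _ full_subspace ds e (Qf a) (2 ^ N).-1 (fun=> I).
rewrite addrA -A_add.
set p := lin vblock _ _; set x := lin w _ _; set q := lin e _ _.
have kN : (uphalf N <= N)%N by rewrite uphalfE; lia.
have hq : rnorm q <= 3 * rnorm (q + p) by exact: block_split.
have hp : rnorm p <= 4 * rnorm (q + p).
  by have := rnorm_triB (q + p) q; rewrite addrAC subrr add0r; lra.
have /andP[h1 _] := AB (q + p) x I; have /andP[_ h2] := AB p x I.
rewrite mulrAC ler_pdivrMr // [leRHS]mulrC.
have s0 := rnorm_ge0 (q + p); have x0 := rnorm_ge0 x.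
have Cp := ler_wpM2l (ltW C0) hp.
have hh : rnorm q + rnorm (A p + B x) <= (3 + 4 * C) * (rnorm (q + p) + rnorm x).
  have := mulr_ge0 (ltW C0) x0; lra.
apply: le_trans (ler_wpM2l (ltW c0) hh) _.
by rewrite mulrCA; apply: ler_wpM2l => //; exact: ltW.
Qed.

Lemma assembly_upp N a b :
  rnorm (lin (A \o e) (Qf a) (2 ^ N).-1 + lin zseq b N) <=
  (C + 1) * (rnorm (lin e (Qf a) (2 ^ N).-1) + rnorm (lin zseq b N)).
Proof.
have [_ _ [c0 C0] AB] := ds.
have [_ ->] := @lin_A _ _ _ _ _ _ _ _ _ _ full_subspace ds e (Qf a) (2 ^ N).-1 (fun=> I).
have /andP[_ h] := @sum_A _ _ _ _ _ _ _ _ _ _ ds (lin e (Qf a) (2 ^ N).-1) I.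
apply: le_trans (rnormD _ _) _.
set q := lin e _ _ in h *; set z := lin zseq _ _.
by have := mulr_ge0 (ltW C0) (rnorm_ge0 z); have := rnorm_ge0 q; lra.
Qed.

Lemma assembly_dense f (eps : R) : 0 < eps -> exists N a b,
  rnorm (f - (lin (A \o e) (Qf a) (2 ^ N).-1 + lin zseq b N)) < eps.
Proof.
move=> e0.
have edense' t (d : R) : [set: S] t -> 0 < d -> exists a n, rnorm (t - lin e a n) < d.
  by move=> _ /(edense t)[n [a h]]; exists a, n.
have [a [b [m [n h]]]] := sum_dense full_subspace ds (fun=> I) edense' (basis_dense wbasis) dense f e0.
pose a' j := if (j < m)%N then a j else 0; pose b' j := if (j < n)%N then b j else 0.
pose p' j := if (j < m)%N then dkk_coef e a' j else 0.
pose L := maxn m n.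
have ea : lin (A \o e) a m = lin (A \o e) a' (2 ^ m).-1.
  by rewrite (lin_trunc _ _ (le_pow_pred m)).
have av : lin (A \o e) (avg a') (2 ^ m).-1 = lin (A \o vblock) (dkk_coef e a') m.
  rewrite lin_avg; apply: eq_bigr => k _ /=.
  have vE : A (vblock k) = (emb F (lam k))^-1 *: \sum_(i < 2 ^ k) A (e (bs k i)).
    have [Alin _ _ _] := ds.
    have A0 := sum_A0 full_subspace ds.
    have AZ (t : K) u : A (t *: u) = t *: A u by have := Alin t u 0 I I; rewrite A0 !addr0.
    rewrite /vblock AZ; congr (_ *: _); elim/big_rec2: _ => // i y1 y2 _ <-.
    exact: A_add.
  rewrite vE scalerA; congr (_ *: _).
  by rewrite /dkk_coef -[X in X / _]mulrA [X in X / _]mulrC mulfK ?emb_lam_neq0.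
have sp : lin (A \o e) a' (2 ^ m).-1 = lin (A \o e) (Qf a') (2 ^ m).-1 + lin (A \o vblock) (dkk_coef e a') m.
  by rewrite -av -linD; apply: eq_lin => j _; rewrite /Qf subrK.
exists L.*2, a', (interlace p' b').
have -> : lin zseq (interlace p' b') L.*2 = lin (A \o vblock) (dkk_coef e a') m + lin (B \o w) b n.
  by rewrite lin_interlace2 uphalf_double doubleK !lin_trunc ?leq_maxl ?leq_maxr.
have -> : lin (A \o e) (Qf a') (2 ^ L.*2).-1 = lin (A \o e) (Qf a') (2 ^ m).-1.
  apply: lin_supp => [|j].
    have : (2 ^ m <= 2 ^ L.*2)%N; last by lia.
    by rewrite leq_exp2l // -addnn /L; have := leq_maxl m n; lia.
  rewrite leqNgt blk_lt -leqNgt => mj.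
  have big i : (m <= blk i)%N -> a' i = 0.
    move=> mi; rewrite /a' ltnNge; suff -> : (m <= i)%N by [].
    apply: leq_trans (le_pow_pred m) _; by rewrite leqNgt blk_lt -leqNgt.
  rewrite /Qf big // /avg (@blksum_const _ _ 0) ?mulr0 ?subrr // => i ilt.
  by rewrite big // blk_bs.
by rewrite addrA -sp -ea.
Qed.

(** The projections of [zseq] reappear as projections on unions of blocks. *)
Lemma dkk_very_conditional : exists (q : nat) (k : R), [/\ (0 < q)%N, 0 < k &
  forall n, (0 < n)%N -> exists a G,
    0 < rnorm (lin (dkk_basis e (A \o e) zseq) a (2 ^ (q * n)).-1) /\
    k * n%:R * rnorm (lin (dkk_basis e (A \o e) zseq) a (2 ^ (q * n)).-1) <=
    rnorm (lin (dkk_basis e (A \o e) zseq) (ind G a) (2 ^ (q * n)).-1)].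
Proof.
have [q [k [q0 k0 H]]] := zseq_conditional; exists q, k; split=> // n /H[a [G [a0 h]]].
exists (blockwise a), (G \o blk).
have -> : ind (G \o blk) (blockwise a) = blockwise (ind G a).
  by apply: funext => j; rewrite /ind /blockwise /=; case: (G _); rewrite ?mul0r.
by rewrite !(dkk_block_const lam0).
Qed.

End assembly.

Theorem theorem4p13 (R : realType) (F : scalar_kind)
    (X S : completeNormedModType (scalars R F))
    (iota : S -> nat -> scalars R F) (e : nat -> S) :
  (exists x : nat -> X, is_basis x) ->
  subsymmetric_seq_space iota e ->
  space_complemented_in S X ->
  nontrivial_type S ->
  ell1_complemented_in X \/ c0_complemented_in X ->
  exists x : nat -> X,
    [/\ is_basis x,
        almost_greedy x,
        equivalent_on [set m | (1 <= m)%N] (fundamental x)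
          (fun m => (rnorm (\sum_(j < m) e j))%:E) &
        equivalent_on [set m | (2 <= m)%N] (cond_L x)
          (fun m => (ln (m%:R : R))%:E)].
Proof.
move=> Xbasis Se Scomp Stype ell.
have [w [wbasis wcond]] : exists w : nat -> X, is_basis w /\ conditional_seq w.
  case: ell => comp.
    exact: (conditional_basis (ell1_subspace R F) (ell1_square R F) (ell1_model R F) comp Xbasis).
  exact: (conditional_basis (c0_subspace R F) (c0_square R F) (c0_model R F) comp Xbasis).
have ss := subsym_of_space Se.
have ebasis : is_basis e by case: Se.
have [c' c'0 ec] := basis_lb ebasis.
have lam0 n : 0 < dyad_norm e n.
  apply: lt_le_trans (_ : ones_norm e 1 <= _); first by rewrite /ones_norm big_ord1; exact: lt_le_trans (ec 0%N).
  by apply: (Lam_mono ss); rewrite expn_gt0.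
have [r r0 growth] := lam_growth ss Stype lam0.
have lamD n : 2 * dyad_norm e n <= dyad_norm e (n + r) by have [] := growth n.
have muD n : 2 * dyad_ratio e n <= dyad_ratio e (n + r) by have [] := growth n.
have [A [B [c [C [ds dense]]]]] := absorb (full_subspace S) (subsym_square Se) Scomp.
have [Cz [z1 zcoef zgru]] := zseq_bounds ss lam0 ds wbasis.
have [c1 c10 low] := assembly_low ss ds w.
have upp := assembly_upp e ds w.
exists (dkk_basis e (A \o e) (zseq e A B w)).
have ybasis : is_basis (dkk_basis e (A \o e) (zseq e A B w)).
  have [G gy] := dkk_grunblum ss lam0 r0 z1 zcoef zgru c10 low upp.
  apply: (grunblum_basis _ gy).
    exact: (dkk_semi_normalized ss lam0 r0 lamD muD z1 zcoef zgru c10 low upp).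
  apply: (dkk_dense lam0); exact: (assembly_dense (basis_dense ebasis) lam0 ds dense wbasis).
have QG := dkk_quasi_greedy ss lam0 r0 lamD muD z1 zcoef zgru c10 low upp.
have lower := dkk_lower ss lam0 r0 z1 zcoef zgru c10 low.
have upper := dkk_democratic ss lam0 r0 lamD muD z1 upp.
split=> //.
- exact: (almost_greedy_of_inequalities ybasis (Lam_mono ss) QG lower upper).
- exact: (fundamental_equiv (Lam_ge0 e) (Lam_mono ss) lower upper).
- apply: (cond_L_equiv ybasis).
    exact: (dkk_conditional ss lam0 r0 z1 zcoef zgru c10 low upp).
  exact: (dkk_very_conditional lam0 ds wcond).
Qed.
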